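(* Let $0\le a\le p-2$ and $1\le b\le p$. For $1\le t\le p$ put $$\alpha_t=\begin{cases}\ell_{a,b,t}-c_{a,b,t}&\text{if } b\le p-1,\\ \ell_{a,b,t}&\text{if } b=p.\end{cases}$$ Let $n_p=\alpha_p$ and, for $1\le i\le p-1$ (all sums being over $1\le j\le \frac{p-1}{2}$ of the indicated parity), $$n_i=\begin{cases}\sum_{j\text{ odd}}\Gamma_{i,j}\alpha_j+\sum_{j\text{ even}}\Gamma_{i,j}\alpha_{p-j}&\text{if } i\in[1,\frac{p-1}{2}]\text{ odd},\\ \sum_{j\text{ odd}}\Gamma_{p-i,j}\alpha_j+\sum_{j\text{ even}}\Gamma_{p-i,j}\alpha_{p-j}&\text{if } i\in[\frac{p+1}{2},p-1]\text{ odd},\\ \sum_{j\text{ odd}}\Gamma_{i,j}\alpha_{p-j}+\sum_{j\text{ even}}\Gamma_{i,j}\alpha_{j}&\text{if } i\in[1,\frac{p-1}{2}]\text{ even},\\ \sum_{j\text{ odd}}\Gamma_{p-i,j}\alpha_{p-j}+\sum_{j\text{ even}}\Gamma_{p-i,j}\alpha_{j}&\text{if } i\in[\frac{p+1}{2},p-1]\text{ even}.\end{cases}$$ Then $$\mathrm{Ind}_B^G(U_{a,b})\cong W\oplus\bigoplus_{i=1}^{p}P_{V_i}^{\oplus n_i},\qquad W=\begin{cases}V_{a,b}&\text{if } b\le p-1,\\0&\text{if } b=p.\end{cases}$$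
   Context: Let $p$ be an odd prime, $\mathbb{F}$ an algebraically closed field of characteristic $p$, $G=SL_2(\mathbb{F}_p)$ and $B\le G$ the subgroup of upper triangular matrices. All modules are finite-dimensional right modules. Let $\zeta$ be a generator of $\mathbb{F}_p^\times$, $g=\begin{pmatrix}1&1\\0&1\end{pmatrix}$ and $\lambda=\begin{pmatrix}\zeta&0\\0&\zeta^{-1}\end{pmatrix}$, so $B=\langle g,\lambda\rangle$. For $a\in\mathbb{Z}$, $S_a$ is the one-dimensional $\mathbb{F}[B]$-module on which $g$ acts trivially and $\lambda$ acts as $\zeta^a$. For $1\le b\le p$, $U_{a,b}$ is the (unique up to isomorphism) uniserial $\mathbb{F}[B]$-module of dimension $b$ whose composition factors, from the socle upwards, are $S_a,S_{a+2},S_{a+4},\dots$; it is projective iff $b=p$. For $1\le t\le p$, $V_t\subset\mathbb{F}[x,y]$ is the space of homogeneous polynomials of degree $t-1$ with right action $x^iy^j\cdot\begin{pmatrix}\alpha&\beta\\\gamma&\delta\end{pmatrix}=(\alpha x+\beta y)^i(\gamma x+\delta y)^j$; these are the simple $\mathbb{F}[G]$-modules. $P_{V_t}$ is the projective cover of $V_t$. For $1\le b\le p-1$, $V_{a,b}$ is the Green correspondent of $U_{a,b}$: the unique (up to isomorphism) non-projective indecomposable $\mathbb{F}[G]$-module whose restriction to $B$ is isomorphic to $U_{a,b}\oplus(\text{projective})$. For $1\le i,j\le\frac{p-1}{2}$, $\Gamma_{i,j}=(-1)^{i+j}\left(i-\frac{2ij}{p}\right)$ if $i\le j$ and $\Gamma_{i,j}=(-1)^{i+j}\left(j-\frac{2ij}{p}\right)$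 if $i>j$. The numbers $\ell_{a,b,t}$ (multiplicity of $V_t$ as a composition factor of $\mathrm{Ind}_B^G(U_{a,b})$): for $0\le c\le p-2$ let $\theta_{a,b,c}=0$ if $a\not\equiv c\pmod 2$ and $\theta_{a,b,c}=\left\lfloor\frac{2(b-1)+a-c}{p-1}\right\rfloor-\left\lceil\frac{a-c}{p-1}\right\rceil+1$ otherwise. Then $\ell_{a,b,t}=\theta_{a,b,t-1}+\theta_{a,b,p-t}$ for $2\le t\le p-1$, and $\ell_{a,b,1}=\ell_{a,b,p}=\theta_{a,b,0}$. The numbers $c_{a,b,t}$ (multiplicity of $V_t$ as a composition factor of $V_{a,b}$), for $1\le b\le p-1$: $c_{a,b,p}=0$, and for $1\le t\le p-1$, $c_{a,b,t}=0$ if $t\equiv a\pmod 2$; if $t\not\equiv a\pmod 2$, $c_{a,b,t}=c_{a,b}(t)$ for $t\le\frac{p-1}2$ and $c_{a,b,t}=c_{a,b}(p-t)$ for $t\ge\frac{p+1}2$. Here $c_{a,b}(t)=\mathbf 1_{[l+1,l+s]}(t)+\mathbf 1_{[p-l-s,p-1]}(t)$, where $\mathbf 1$ denotes an indicator function and $(l,s)$ is given by: if $a\in\{0,1\}$: $(0,2b+a-1)$ for $b\in[1,\frac{p-1}2]$, $(0,2(p-b)-a)$ for $b\in[\frac{p+1}2,p-1]$; if $a\in[2,\frac{p-1}2]$: $(a-1,2b)$ for $b\in[1,\frac{p-a}2]$, $(a-1,2(p-a-b)+1)$ for $b\in[\frac{p-a+1}2,p-a]$, $(2(p-b)-a-1,2(a+b-p)+1)$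 for $b\in[p-a,p-\frac{a+1}2]$, $(a+2(b-p),2(p-b))$ for $b\in[p-\frac a2,p-1]$; if $a\in[\frac{p+1}2,p-2]$: $(p-a-2b,2b)$ for $b\in[1,\frac{p-a}2]$, $(a+2b-p-1,2(p-a-b)+1)$ for $b\in[\frac{p-a+1}2,p-a]$, $(p-1-a,2(a+b-p)+1)$ for $b\in[p-a,p-\frac{a+1}2]$, $(p-1-a,2(p-b))$ for $b\in[p-\frac a2,p-1]$. *)

(* Defs.v *)
From HB Require Import structures.
From mathcomp Require Import all_boot all_order all_algebra.
From mathcomp Require Import all_fingroup all_solvable all_field all_character.
From mathcomp Require Import mpoly.

Set Implicit Arguments.
Unset Strict Implicit.
Unset Printing Implicit Defensive.

Import Order.TTheory GRing.Theory Num.Theory.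
Local Open Scope group_scope.
Local Open Scope ring_scope.

(* Right modules: in MathComp a matrix representation acts on row vectors by  *)
(* v |-> v *m rG x, so that mx_representation F G n is exactly the type of    *)
(* right F[G]-modules with underlying space F^n.                              *)

Section Modules.

Variables (F : fieldType) (gT : finGroupType) (G : {group gT}).

Definition mx_hom n1 n2 (rG1 : mx_representation F G n1)
    (rG2 : mx_representation F G n2) (f : 'M[F]_(n1, n2)) : Prop :=
  {in G, forall x, rG1 x *m f = f *m rG2 x}.

Definition mx_projective n (rP : mx_representation F G n) : Prop :=
  forall (m k : nat) (rM : mx_representation F G m)
    (rN : mx_representation F G k) (f : 'M[F]_(m, k)) (h : 'M[F]_(n, k)),
  mx_hom rM rN f -> row_full f -> mx_hom rP rN h ->
  exists2 h' : 'M[F]_(n, m), mx_hom rP rM h' & h' *m f = h.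

(* (P, f) with P projective and f : P -> V a surjection whose kernel is       *)
(* superfluous: no proper submodule of P surjects onto V.                     *)
Definition projective_cover n (rP : mx_representation F G n)
    m (rV : mx_representation F G m) : Prop :=
  mx_projective rP /\
  exists f : 'M[F]_(n, m),
    [/\ mx_hom rP rV f, row_full f
      & forall W : 'M[F]_n,
          mxmodule rP W -> row_full (W *m f) -> row_full W].

Definition mx_indecomposable n (rV : mx_representation F G n) : Prop :=
  (0 < n)%N /\
  forall W1 W2 : 'M[F]_n, mxmodule rV W1 -> mxmodule rV W2 ->
    (W1 + W2 :=: 1%:M)%MS -> (W1 :&: W2)%MS = 0 -> W1 = 0 \/ W2 = 0.

Definition mx_uniserial n (rV : mx_representation F G n) : Prop :=
  forall W1 W2 : 'M[F]_n, mxmodule rV W1 -> mxmodule rV W2 ->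
    (W1 <= W2)%MS \/ (W2 <= W1)%MS.

End Modules.

(* M (x)_{F[H]} F[G] as the sum of the M (x) x over representatives x of the  *)
(* right cosets H x: the block of the matrix of y from M (x) x to M (x) x' is *)
(* the action of x y x'^-1 when this element is in H, and 0 otherwise.        *)
Section Induced.

Variables (F : fieldType) (gT : finGroupType) (H G : {group gT}).
Variables (n : nat) (rH : mx_representation F H n).

Definition coset_rep (i : 'I_#|rcosets H G|) : gT := repr (enum_val i).

Definition ind_block (x : gT) : 'M[F]_n := if x \in H then rH x else 0.

Definition ind_mx (y : gT) : 'M[F]_(\sum_(i < #|rcosets H G|) n) :=
  \mxblock_(i, j) ind_block (coset_rep i * y * (coset_rep j)^-1)%g.

Hypothesis sHG : H \subset G.

Lemma coset_rep_in i : coset_rep i \in G.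
Proof.
rewrite /coset_rep; have /rcosetsP [x Gx ->] := enum_valP i.
have := mem_repr_rcoset H x; case/rcosetP => h Hh ->.
by rewrite groupM // (subsetP sHG).
Qed.

Lemma rcoset_coset_rep i : H :* coset_rep i = enum_val i.
Proof.
rewrite /coset_rep; have /rcosetsP [x Gx ->] := enum_valP i.
exact: rcoset_repr.
Qed.

Lemma coset_rep_mem x i :
  (x * (coset_rep i)^-1 \in H)%g = (H :* x == enum_val i).
Proof. by rewrite -mem_rcoset -rcoset_coset_rep; apply/rcoset_eqP/eqP. Qed.

Lemma ind_mx_repr : mx_repr G ind_mx.
Proof.
split=> [|x y Gx Gy].
  rewrite /ind_mx -mxdiagZ /mxdiag; apply: eq_mxblock => i j.
  rewrite mulg1 /ind_block coset_rep_mem rcoset_coset_rep.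
  rewrite (inj_eq enum_val_inj) conform_mx_id.
  by case: eqP => // ->; rewrite mulgV repr_mx1.
rewrite /ind_mx mul_mxblock; apply: eq_mxblock => i j.
have Gix : (coset_rep i * x)%g \in G by rewrite groupM ?coset_rep_in.
have Rix : H :* (coset_rep i * x) \in rcosets H G.
  by apply/rcosetsP; exists (coset_rep i * x)%g.
pose k := enum_rank_in Rix (H :* (coset_rep i * x)).
have Ek : enum_val k = H :* (coset_rep i * x) by rewrite enum_rankK_in.
have Hk : (coset_rep i * x * (coset_rep k)^-1)%g \in H.
  by rewrite coset_rep_mem Ek.
rewrite (bigD1 k) //= big1 ?addr0 => [|k' ne_k'k]; last first.
  rewrite {1}/ind_block coset_rep_mem -Ek (inj_eq enum_val_inj).
  by rewrite eq_sym (negPf ne_k'k) mul0mx.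
rewrite /ind_block Hk.
have -> : (coset_rep i * (x * y) * (coset_rep j)^-1 =
  (coset_rep i * x * (coset_rep k)^-1) * (coset_rep k * y * (coset_rep j)^-1))%g.
  by rewrite !mulgA mulgKV.
by rewrite groupMl //; case: ifP => Hj; rewrite ?mulmx0 // repr_mxM.
Qed.

Definition induced_repr := MxRepresentation ind_mx_repr.

End Induced.

Section SL2.

Variable p : nat.

Local Notation GL := {'GL_2['F_p]}.

Definition SL2_set : {set GL} := [set x | \det (GLval x) == 1].

Lemma SL2_group_set : group_set SL2_set.
Proof.
apply/group_setP; split=> [|x y]; first by rewrite inE GL_1E det1.
by rewrite !inE GL_ME det_mulmx => /eqP -> /eqP ->; rewrite mulr1.
Qed.

Canonical SL2 := Group SL2_group_set.

Definition borel_set : {set GL} := [set x in SL2 | GLval x 1 0 == 0].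

Lemma borel_group_set : group_set borel_set.
Proof.
apply/group_setP; split=> [|x y].
  by rewrite inE group1 GL_1E mxE.
rewrite !(inE, groupM) => /andP [/eqP Sx /eqP x0] /andP [/eqP Sy /eqP y0].
rewrite GL_ME det_mulmx Sx Sy mulr1 mxE big_ord_recl big_ord1 x0 mul0r add0r.
have -> : lift ord0 ord0 = 1 :> 'I_2 by apply: val_inj.
by rewrite y0 mulr0 !eqxx.
Qed.

Canonical borel := Group borel_group_set.

Lemma borel_sub : borel \subset SL2.
Proof. by apply/subsetP => x; rewrite inE => /andP []. Qed.

End SL2.

Section NaturalModules.

Variables (F : fieldType) (p : nat) (charFp : p \in [pchar F]).

Definition Fp_emb of p \in [pchar F] := fun x : 'F_p => (x : nat)%:R : F.

Local Notation emb := (Fp_emb charFp).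

Lemma Fp_emb_nat n : emb n%:R = n%:R.
Proof.
have pr_p := pcharf_prime charFp.
rewrite /Fp_emb val_Fp_nat // [in RHS](divn_eq n p) natrD natrM.
by rewrite (pcharf0 charFp) mulr0 add0r.
Qed.

Lemma Fp_emb_zmod : zmod_morphism emb.
Proof.
have D x y : emb (x + y) = emb x + emb y.
  by rewrite -[x]natr_Zp -[y]natr_Zp -natrD !Fp_emb_nat natrD.
by move=> x y; apply: (addIr (emb y)); rewrite -D !subrK.
Qed.

Lemma Fp_emb_monoid : monoid_morphism emb.
Proof.
split=> [|x y]; first exact: (Fp_emb_nat 1).
by rewrite -[x]natr_Zp -[y]natr_Zp -natrM !Fp_emb_nat natrM.
Qed.

HB.instance Definition _ := GRing.isZmodMorphism.Build _ _ emb Fp_emb_zmod.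
HB.instance Definition _ := GRing.isMonoidMorphism.Build _ _ emb Fp_emb_monoid.

(* (u, v; 0, u^-1) acts as u ^ a: unipotent matrices act trivially, and       *)
(* diag(zeta, zeta^-1) acts as zeta ^ a for any generator zeta of F_p^*.      *)
Definition S_mx (a : int) (x : {'GL_2['F_p]}) : 'M[F]_1 :=
  (emb (GLval x 0 0) ^ a)%:M.

Lemma borel_diagM x y : x \in borel p -> y \in borel p ->
  GLval (x * y)%g 0 0 = GLval x 0 0 * GLval y 0 0.
Proof.
rewrite !inE => _ /andP [_ /eqP y0]; rewrite GL_ME mxE big_ord_recl big_ord1.
have -> : lift ord0 ord0 = 1 :> 'I_2 by apply: val_inj.
by rewrite y0 mulr0 addr0.
Qed.

Lemma S_mx_repr a : mx_repr (borel p) (S_mx a).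
Proof.
split=> [|x y Bx By]; first by rewrite /S_mx GL_1E mxE rmorph1 exp1rz.
by rewrite /S_mx borel_diagM // rmorphM expfzMl scalar_mxM.
Qed.

Definition S_repr a := MxRepresentation (S_mx_repr a).

(* V_t, in the basis x^i y^(t-1-i) (0 <= i < t) of the homogeneous            *)
(* polynomials of degree t-1, where x = 'X_0 and y = 'X_1.                    *)

Definition lin_subst (M : 'M['F_p]_2) : 2.-tuple {mpoly F[2]} :=
  [tuple \sum_(j < 2) emb (M i j) *: 'X_j | i < 2].

Definition poly_act (M : 'M['F_p]_2) (f : {mpoly F[2]}) : {mpoly F[2]} :=
  f \mPo lin_subst M.

Definition V_monom t (i : 'I_t) : 'X_{1..2} :=
  [multinom (if j == 0%R :> 'I_2 then i : nat else (t.-1 - i)%N) | j < 2].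

Definition V_mx t (x : {'GL_2['F_p]}) : 'M[F]_t :=
  \matrix_(i, k) (poly_act (GLval x) 'X_[V_monom i])@_(V_monom k).

Lemma V_monom_deg t (i : 'I_t) : mdeg (V_monom i) = t.-1.
Proof.
rewrite mdegE big_ord_recl big_ord1 !mnmE /= subnKC //.
by case: t i => [[]|t] //= i; rewrite -ltnS.
Qed.

Lemma V_monom_inj t : injective (@V_monom t).
Proof. by move=> i k /mnmP /(_ 0); rewrite !mnmE /= => /val_inj. Qed.

Lemma V_monom_surj t (m : 'X_{1..2}) :
  (0 < t)%N -> mdeg m = t.-1 -> exists i : 'I_t, m = V_monom i.
Proof.
move=> t0; rewrite mdegE big_ord_recl big_ord1 => dm.
have lt : (m 0%R < t)%N by rewrite -(prednK t0) ltnS -dm leq_addr.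
exists (Ordinal lt); apply/mnmP => j; rewrite mnmE /=.
case: eqVneq => [-> //|]; rewrite -dm addKn.
by case: j => -[|[|//]] //= lj _; congr (m _); apply: val_inj.
Qed.

Lemma lin_subst_homog M i : tnth (lin_subst M) i \is 1.-homog.
Proof.
rewrite tnth_mktuple rpred_sum // => j _; apply: rpredZ.
by rewrite dhomogX /= mdeg1.
Qed.

Lemma poly_act_homog M t (i : 'I_t) : poly_act M 'X_[V_monom i] \is t.-1.-homog.
Proof.
rewrite -(V_monom_deg i) mdegE /poly_act comp_mpolyX.
rewrite !big_ord_recl !big_ord0 mulr1 addn0.
have H n k : tnth (lin_subst M) k ^+ n \is n.-homog.
  by rewrite -[X in X.-homog]mul1n dhomogMn // lin_subst_homog.
exact: dhomogM.
Qed.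

Lemma homog_expand t (f : {mpoly F[2]}) : (0 < t)%N -> f \is t.-1.-homog ->
  f = \sum_(i < t) f@_(V_monom i) *: 'X_[V_monom i].
Proof.
move=> t0 hf; apply/mpolyP => m; rewrite raddf_sum /=.
under eq_bigr => i _ do rewrite mcoeffZ mcoeffX.
have [dm|dm] := eqVneq (mdeg m) t.-1.
  have [i ->] := V_monom_surj t0 dm.
  rewrite (bigD1 i) //= eqxx mulr1 big1 ?addr0 // => k ne_ki.
  by rewrite (inj_eq (@V_monom_inj t)) (negPf ne_ki) mulr0.
rewrite (dhomog_nemf_coeff hf dm) big1 // => i _.
by case: eqP => [e|_]; rewrite ?mulr0 //; rewrite -e V_monom_deg eqxx in dm.
Qed.

Lemma poly_act_mul (M N : 'M['F_p]_2) f :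
  poly_act N (poly_act M f) = poly_act (M *m N) f.
Proof.
rewrite /poly_act [f \mPo lin_subst M]comp_mpolyEX raddf_sum [RHS]comp_mpolyEX.
apply: eq_bigr => m _; rewrite /= comp_mpolyZ; congr (_ *: _).
rewrite !comp_mpolyX rmorph_prod; apply: eq_bigr => i _.
rewrite rmorphXn; congr (_ ^+ _); rewrite !tnth_mktuple raddf_sum.
under eq_bigr => j _.
  rewrite /= comp_mpolyZ comp_mpolyXU -tnth_nth tnth_mktuple scaler_sumr.
  over.
rewrite exchange_big /=; apply: eq_bigr => k _.
rewrite mxE raddf_sum scaler_suml; apply: eq_bigr => j _.
by rewrite /= ?scalerA rmorphM.
Qed.

Lemma V_mx_repr t : mx_repr (SL2 p) (V_mx t).
Proof.
split=> [|x y _ _]; apply/matrixP => i k; rewrite !mxE.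
  rewrite GL_1E /poly_act (_ : lin_subst 1 = [tuple 'X_j | j < 2]).
    by rewrite comp_mpoly_id mcoeffX (inj_eq (@V_monom_inj t)).
  apply: eq_from_tnth => j; rewrite !tnth_mktuple (bigD1 j) //= big1 => [|l].
    by rewrite mxE eqxx rmorph1 scale1r addr0.
  by rewrite mxE eq_sym => /negPf ->; rewrite rmorph0 scale0r.
have t0 : (0 < t)%N by case: t i {k} => [[]|].
rewrite GL_MxE -poly_act_mul [in LHS](homog_expand t0 (poly_act_homog _ i)).
rewrite [poly_act (GLval y) _]raddf_sum raddf_sum; apply: eq_bigr => j _.
by rewrite /= /poly_act comp_mpolyZ mcoeffZ !mxE.
Qed.

Definition V_repr t := MxRepresentation (V_mx_repr t).

(* The factors of a composition series are indexed upwards: series_repr 0 is   *)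
(* the bottom one, so that the hypothesis lists them from the socle.          *)
Definition is_U (a : int) b
    (rU : mx_representation F (borel p) b) : Prop :=
  mx_uniserial rU /\
  exists (Us : seq 'M[F]_b) (compU : mx_composition_series rU Us),
    [/\ size Us = b, (last 0 Us :=: 1%:M)%MS
      & forall i, (i < b)%N ->
          mx_rsim (series_repr i compU) (S_repr (a + 2 * i%:Z))].

End NaturalModules.

Definition green_correspondent (F : fieldType) (p b n : nat)
    (rU : mx_representation F (borel p) b)
    (rV : mx_representation F (SL2 p) n) : Prop :=
  [/\ mx_indecomposable rV, ~ mx_projective rV
    & exists rQ : representation F (borel p),
        mx_projective rQ /\
        mx_rsim (subg_repr rV (borel_sub p))
                (dadd_grepr (Representation rU) rQ)].

Section Multiplicities.

Variables p a b : nat.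

Definition theta (c : nat) : int :=
  if a != c %[mod 2] then 0
  else Num.floor ((2 * (b%:R - 1) + a%:R - c%:R) / (p%:R - 1) : rat)
       - Num.ceil ((a%:R - c%:R) / (p%:R - 1) : rat) + 1.

Definition ell (t : nat) : int :=
  if (t == 1)%N || (t == p) then theta 0 else theta (t - 1)%N + theta (p - t)%N.

(* The pair (l, s); consecutive ranges of b that overlap give the same pair. *)
Definition green_ls : int * int :=
  let P := p%:Z in let A := a%:Z in let B := b%:Z in
  if A <= 1 then
    if 2 * B <= P - 1 then (0, 2 * B + A - 1) else (0, 2 * (P - B) - A)
  else if 2 * A <= P - 1 then
    if 2 * B <= P - A then (A - 1, 2 * B)
    else if B <= P - A then (A - 1, 2 * (P - A - B) + 1)
    else if 2 * B <= 2 * P - (A + 1) then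
      (2 * (P - B) - A - 1, 2 * (A + B - P) + 1)
    else (A + 2 * (B - P), 2 * (P - B))
  else
    if 2 * B <= P - A then (P - A - 2 * B, 2 * B)
    else if B <= P - A then (A + 2 * B - P - 1, 2 * (P - A - B) + 1)
    else if 2 * B <= 2 * P - (A + 1) then (P - 1 - A, 2 * (A + B - P) + 1)
    else (P - 1 - A, 2 * (P - B)).

Definition green_mult_low (t : nat) : int :=
  let l := green_ls.1 in let s := green_ls.2 in
  ((l + 1 <= t%:Z <= l + s)%R : nat)%:Z
  + ((p%:Z - l - s <= t%:Z <= p%:Z - 1)%R : nat)%:Z.

Definition green_mult (t : nat) : int :=
  if (t == p) || (t == a %[mod 2]) then 0
  else if (t <= p.-1./2)%N then green_mult_low t
  else green_mult_low (p - t)%N.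

Definition alpha (t : nat) : int :=
  if (b <= p - 1)%N then ell t - green_mult t else ell t.

Definition Gamma (i j : nat) : rat :=
  (-1) ^+ (i + j)
  * (if (i <= j)%N then i%:R - 2 * i%:R * j%:R / p%:R
     else j%:R - 2 * i%:R * j%:R / p%:R).

Definition proj_mult (i : nat) : rat :=
  if i == p then (alpha p)%:~R else
  let h := p.-1./2 in
  let k := if (i <= h)%N then i else (p - i)%N in
  if odd i then
    \sum_(1 <= j < h.+1 | odd j) Gamma k j * (alpha j)%:~R
    + \sum_(1 <= j < h.+1 | ~~ odd j) Gamma k j * (alpha (p - j)%N)%:~R
  else
    \sum_(1 <= j < h.+1 | odd j) Gamma k j * (alpha (p - j)%N)%:~R
    + \sum_(1 <= j < h.+1 | ~~ odd j) Gamma k j * (alpha j)%:~R.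

End Multiplicities.

(* Main.v *)
Require Import Defs.
From mathcomp Require Import all_boot all_order all_algebra.
From mathcomp Require Import all_fingroup all_solvable all_field all_character.
From mathcomp Require Import zify ring mpoly.

Set Implicit Arguments.
Unset Strict Implicit.
Unset Printing Implicit Defensive.

Import Order.TTheory GRing.Theory Num.Theory.
Local Open Scope group_scope.
Local Open Scope ring_scope.

(** Write P for the subgroup generated by g and Y = g^-1 - 1 for the generator of
    the augmentation ideal of F[P]. The induced module is W + Q with Q
    projective, and the multiplicity of P_i in Q is dim Hom(Q, V_i); the work is
    in splitting off W and in computing these dimensions.

    Projectivity is handled through traces: M is projective if and only if its
    identity is of the form sum_x x^-1 h x for a linear map h
    ([gtrace_projective], [projective_traced]). For b < p, Frobenius reciprocity
    gives maps V -> Ind U -> V whose composite is the relative trace of the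
    projection of V onto U. As |G : B| = p + 1 is 1 modulo p, it differs from
    the identity by a map through a projective module, and V being
    indecomposable and not projective, it is invertible ([green_summand]). The
    complement Q of V is projective because it is free over P, as a comparison
    of its dimension with the rank of Y^(p-1) shows ([green_complement]): U does
    not contribute to that rank, while the points of the projective line that P
    permutes freely contribute b. For b = p, U itself is free over P.

    A nonzero module has a nonzero map to some V_i ([natural_quotient]), whence
    the projective module Q is the sum of the covers of the simple modules in
    its head, with multiplicities dim Hom(Q, V_i) ([projective_decomposition]).
    No map from W to V_i is a nonzero trace, since it would make W a projective
    cover ([indecomposable_gtrace]); so Hom(Q, V_i) consists of the maps from
    Ind U to V_i that are traces, and by Frobenius reciprocity of the
    B-equivariant maps from U to V_i that are traces. Now U is generated by a
    weight vector v of the torus with v Y^b = 0 ([uniserial_generator]), and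
    such maps take v to any vector of the same weight in the image of Y^(p-b). In
    V_i the monomials are weight vectors and the images of the powers of Y are
    given by bounds on the degree in x, which reduces the dimension to a count
    of exponents k subject to an inequality and to a congruence modulo p - 1
    ([homs_dim_induced]).

    Finally these counts satisfy alpha_t = 2 n_t + n_(p-1-t) + n_(p+1-t)
    ([alpha_chain]), the Cartan matrix of a chain of simple modules, and Gamma
    is the inverse of that matrix ([Gamma_inverse], [proj_mult_count]). *)

(** * Direct sums and Fitting's lemma *)

Section Biproducts.

Variables (F : fieldType) (gT : finGroupType) (G : {group gT}).
Local Notation reprG := (mx_representation F G).
Local Notation grepr := (representation F G).

Lemma mx_hom0 n m (rM : reprG n) (rN : reprG m) : mx_hom rM rN 0.
Proof. by move=> x _; rewrite mul0mx mulmx0. Qed.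

Lemma mx_hom1 n (rM : reprG n) : mx_hom rM rM 1%:M.
Proof. by move=> x _; rewrite mul1mx mulmx1. Qed.

Lemma mx_homM n m k (rM : reprG n) (rN : reprG m) (rL : reprG k) f h :
  mx_hom rM rN f -> mx_hom rN rL h -> mx_hom rM rL (f *m h).
Proof. by move=> homf homh x Gx; rewrite mulmxA homf // -!mulmxA homh. Qed.

Lemma mx_homB n m (rM : reprG n) (rN : reprG m) f h :
  mx_hom rM rN f -> mx_hom rM rN h -> mx_hom rM rN (f - h).
Proof. by move=> homf homh x Gx; rewrite mulmxBr mulmxBl homf ?homh. Qed.

Lemma mx_homZ n m (rM : reprG n) (rN : reprG m) a f :
  mx_hom rM rN f -> mx_hom rM rN (a *: f).
Proof. by move=> homf x Gx; rewrite -scalemxAr -scalemxAl homf. Qed.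

Lemma mx_homX n (rM : reprG n) (f : 'M_n) k :
  mx_hom rM rM f -> mx_hom rM rM (f ^+ k).
Proof.
move=> homf; elim: k => [|k IHk]; first by rewrite expr0; apply: mx_hom1.
by rewrite exprS; apply: mx_homM homf IHk.
Qed.

Lemma mx_hom_inv n (rM : reprG n) (f : 'M_n) :
  mx_hom rM rM f -> f \in unitmx -> mx_hom rM rM (invmx f).
Proof.
move=> homf uf x Gx.
by rewrite -[LHS](mulKmx uf) (mulmxA f) -homf // !mulmxA mulmxK.
Qed.

Lemma mx_hom_kermx n m (rM : reprG n) (rN : reprG m) (f : 'M_(n, m)) :
  mx_hom rM rN f -> mxmodule rM (kermx f).
Proof.
move=> homf; apply/mxmoduleP => x Gx.
by apply/sub_kermxP; rewrite -mulmxA homf // mulmxA mulmx_ker mul0mx.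
Qed.

Lemma mx_hom_im n m k (rM : reprG n) (rN : reprG m) (f : 'M_(n, m))
    (W : 'M_(k, n)) :
  mx_hom rM rN f -> mxmodule rM W -> mxmodule rN (W *m f).
Proof.
move=> homf /mxmoduleP modW; apply/mxmoduleP => x Gx.
by rewrite -mulmxA -homf // mulmxA submxMr ?modW.
Qed.

Lemma mx_hom_val n (rM : reprG n) U (modU : mxmodule rM U) :
  mx_hom (submod_repr modU) rM (val_submod 1%:M).
Proof.
by move=> x Gx; rewrite /= -val_submodE -[X in val_submod X]mul1mx val_submodJ.
Qed.

(** Direct sums given by their injections and projections, which, unlike a
    block decomposition, can be restricted to subgroups and composed with
    homomorphisms. *)
Definition biproduct n nA nB (rM : reprG n) (rA : reprG nA) (rB : reprG nB) :=
  exists iA qA iB qB,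
    [/\ [/\ mx_hom rA rM iA, mx_hom rM rA qA, mx_hom rB rM iB & mx_hom rM rB qB],
        iA *m qA = 1%:M, iB *m qB = 1%:M & qA *m iA + qB *m iB = 1%:M].

(** The relations between the two summands follow from the splitting of the
    identity, because in a vector space complementary projections of full rank
    on each side are orthogonal. *)
Lemma biproduct_ortho n nA nB iA (qA : 'M[F]_(n, nA)) iB (qB : 'M[F]_(n, nB)) :
    iA *m qA = 1%:M -> iB *m qB = 1%:M -> qA *m iA + qB *m iB = 1%:M ->
  iA *m qB = 0 /\ iB *m qA = 0.
Proof.
move=> A1 B1 split1; split.
  have: iA *m (qA *m iA + qB *m iB) *m qB = iA *m qB + 0.
    by rewrite split1 mulmx1 addr0.
  rewrite mulmxDr mulmxDl !mulmxA A1 mul1mx -(mulmxA _ iB) B1 mulmx1.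
  exact: addrI.
have: iB *m (qA *m iA + qB *m iB) *m qA = iB *m qA + 0.
  by rewrite split1 mulmx1 addr0.
rewrite mulmxDr mulmxDl !mulmxA B1 mul1mx -(mulmxA _ iA) A1 mulmx1.
exact: addrI.
Qed.

Lemma biproduct_rsim n (rM : reprG n) (A B : grepr) :
  biproduct rM A B <-> mx_rsim rM (dadd_grepr A B).
Proof.
split=> [[iA [qA [iB [qB [[hiA hqA hiB hqB] A1 B1 AB1]]]]] | ].
  have [ABo BAo] := biproduct_ortho A1 B1 AB1.
  pose f := row_mx qA qB; pose h := col_mx iA iB.
  have fh : f *m h = 1%:M by rewrite mul_row_col.
  have hf : h *m f = 1%:M.
    by rewrite mul_col_row A1 B1 ABo BAo -scalar_mx_block.
  have def_n : n = (rdegree A + rdegree B)%N.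
    apply/eqP; rewrite eqn_leq; apply/andP; split.
      by rewrite -(mxrank1 F n) -fh (leq_trans (mxrankM_maxl _ _)) ?rank_leq_col.
    by rewrite -(mxrank1 F (_ + _)) -hf (leq_trans (mxrankM_maxl _ _)) ?rank_leq_col.
  exists f => // [|x Gx]; first by apply/row_freeP; exists h.
  by rewrite mul_row_block !mulmx0 addr0 add0r mul_mx_row hqA ?hqB.
case=> f def_n freef homf.
have uf : exists2 h, f *m h = 1%:M & h *m f = 1%:M.
  have [h fh] := row_freeP freef; exists h => //.
  by move: f h fh {freef homf}; rewrite -def_n => f h; apply: mulmx1C.
have {def_n freef uf} [h fh hf] := uf.
have homh x : x \in G -> dadd_grepr A B x *m h = h *m rM x.
  move=> Gx; rewrite -[LHS]mul1mx -hf mulmxA -(mulmxA h) -homf //.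
  by rewrite -!mulmxA fh mulmx1.
exists (usubmx h), (lsubmx f), (dsubmx h), (rsubmx f).
move: fh hf; rewrite -[f in f *m h]hsubmxK -[h in _ *m h]vsubmxK mul_row_col => fh.
rewrite -[h in h *m _]vsubmxK -[f in _ *m f]hsubmxK mul_col_row.
rewrite scalar_mx_block => /eq_block_mx[hfA _ _ hfB].
split=> //.
split=> x Gx.
- have := homh x Gx; rewrite -[h in LHS]vsubmxK -[h in RHS]vsubmxK /=.
  rewrite mul_block_col mul_col_mx !mul0mx addr0 add0r => /eq_col_mx.
  by case.
- have := homf x Gx; rewrite -[f in LHS]hsubmxK -[f in RHS]hsubmxK /=.
  rewrite mul_row_block mul_mx_row !mulmx0 addr0 add0r => /eq_row_mx.
  by case.
- have := homh x Gx; rewrite -[h in LHS]vsubmxK -[h in RHS]vsubmxK /=.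
  rewrite mul_block_col mul_col_mx !mul0mx addr0 add0r => /eq_col_mx.
  by case.
have := homf x Gx; rewrite -[f in LHS]hsubmxK -[f in RHS]hsubmxK /=.
rewrite mul_row_block mul_mx_row !mulmx0 addr0 add0r => /eq_row_mx.
by case.
Qed.

Lemma biproduct_degree n (rM : reprG n) (A B : grepr) :
  biproduct rM A B -> n = (rdegree A + rdegree B)%N.
Proof. by case/biproduct_rsim. Qed.

Lemma rsim_homs n m (rM : reprG n) (rN : reprG m) : mx_rsim rM rN ->
  exists f h, [/\ mx_hom rM rN f, mx_hom rN rM h, f *m h = 1%:M & h *m f = 1%:M].
Proof.
case=> f def_m; case: m / def_m in rN f * => /row_freeP[h fh] homf.
have hf := mulmx1C fh; exists f, h; split=> // x Gx.
by rewrite -[LHS]mul1mx -hf mulmxA -(mulmxA h) -homf // -!mulmxA fh mulmx1.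
Qed.

(** A split epimorphism onto P has its kernel as a complementary summand. *)
Lemma biproduct_split n m (rM : reprG n) (rP : reprG m) s t :
    mx_hom rP rM s -> mx_hom rM rP t -> s *m t = 1%:M ->
  exists K : grepr, biproduct rM rP K.
Proof.
move=> homs homt st1; have modK := mx_hom_kermx homt.
have sK : (1%:M - t *m s <= kermx t)%MS.
  by apply/sub_kermxP; rewrite mulmxBl mul1mx -mulmxA st1 mulmx1 subrr.
exists (Representation (submod_repr modK)); rewrite /biproduct /=.
exists s, t, (val_submod 1%:M), (in_submod (kermx t) (1%:M - t *m s)).
split=> //; first split=> //; first exact: mx_hom_val.
- have homK : mx_hom rM rM (1%:M - t *m s).
    by apply: mx_homB (mx_hom1 _) _; apply: mx_homM homt homs.
  move=> x Gx; rewrite -(in_submodJ modK) // -homK //.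
  by rewrite in_submodE mulmxA -in_submodE.
- set v := val_submod _; have vt0 : v *m t = 0.
    by apply/sub_kermxP; rewrite val_submod1.
  rewrite in_submodE mulmxA -in_submodE mulmxBr mulmx1 (mulmxA v) vt0.
  by rewrite mul0mx subr0 val_submodK.
by rewrite -val_submodE in_submodK // addrC subrK.
Qed.

Lemma biproduct_trans n nA nB nC nD (rM : reprG n) (rA : reprG nA)
    (rB : reprG nB) (rC : reprG nC) (rD : reprG nD) :
    biproduct rM rA rB -> biproduct rB rC rD ->
  biproduct rM
    (dadd_grepr (Representation rA) (Representation rC)) rD.
Proof.
case=> iA [qA [iB [qB [[hiA hqA hiB hqB] A1 B1 AB1]]]].
case=> iC [qC [iD [qD [[hiC hqC hiD hqD] C1 D1 CD1]]]].
have [ABo BAo] := biproduct_ortho A1 B1 AB1.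
exists (col_mx iA (iC *m iB)), (row_mx qA (qB *m qC)), (iD *m iB), (qB *m qD).
have hD := mx_homM hiD hiB; have hD' := mx_homM hqB hqD.
split; first split=> //.
- move=> x Gx; rewrite /= mul_block_col mul_col_mx !mul0mx addr0 add0r hiA //.
  by rewrite mulmxA hiC // -!mulmxA hiB.
- move=> x Gx; rewrite /= mul_row_block mul_mx_row !mulmx0 addr0 add0r hqA //.
  by rewrite mulmxA hqB // -!mulmxA hqC.
- rewrite /= mul_col_row A1 -!mulmxA (mulmxA iB) B1 mul1mx C1.
  by rewrite BAo mulmx0 mulmxA ABo mul0mx -scalar_mx_block.
- by rewrite -mulmxA (mulmxA iB) B1 mul1mx.
rewrite mul_row_col -addrA !mulmxA -mulmxDl -!(mulmxA qB) -mulmxDr.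
by rewrite CD1 mulmx1.
Qed.

Lemma biproduct_eqr n nA nB nC (rM : reprG n) (rA : reprG nA)
    (rB : reprG nB) (rC : reprG nC) :
  biproduct rM rA rB -> mx_rsim rB rC -> biproduct rM rA rC.
Proof.
case=> iA [qA [iB [qB [[hiA hqA hiB hqB] A1 B1 AB1]]]].
case/rsim_homs=> f [h [homf homh fh hf]].
exists iA, qA, (h *m iB), (qB *m f); split=> //; last first.
- by rewrite -mulmxA (mulmxA f) fh mul1mx.
- by rewrite -mulmxA (mulmxA iB) B1 mul1mx.
by split=> //; apply: mx_homM; eassumption.
Qed.

Lemma biproduct0 n nA (rM : reprG n) (rA : reprG nA) :
  mx_rsim rM rA -> biproduct rM (@grepr0 F gT G) rA.
Proof.
case/rsim_homs=> f [h [homf homh fh hf]].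
exists 0, 0, h, f; split=> //; first by split=> //; apply: mx_hom0.
  by rewrite mulmx0; apply/matrixP => -[].
by rewrite mul0mx add0r.
Qed.

(** Fitting's lemma: a power of f whose kernel is as large as possible splits
    the module into that kernel and its image. *)
Lemma indecomposable_endo n (rV : reprG n) (f : 'M_n) :
    mx_indecomposable rV -> mx_hom rV rV f ->
  f \in unitmx \/ 1%:M - f \in unitmx.
Proof.
case=> n_gt0 indV homf.
have [k k_gt0 kerK] : exists2 k, (0 < k)%N
    & (\rank (kermx (f ^+ (k + k))) <= \rank (kermx (f ^+ k)))%N.
  suffices H m : (exists2 k, (0 < k)%N
        & \rank (kermx (f ^+ (k + k))) <= \rank (kermx (f ^+ k)))%N
      \/ (m <= \rank (kermx (f ^+ (2 ^ m))))%N.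
    have [//|] := H n.+1; by rewrite leqNgt ltnS rank_leq_row.
  elim: m => [|m [|IHm]]; [by right | by left |].
  case: (leqP (\rank (kermx (f ^+ (2 ^ m + 2 ^ m)))) (\rank (kermx (f ^+ (2 ^ m))))).
    by left; exists (2 ^ m)%N; rewrite ?expn_gt0.
  by right; rewrite expnS mul2n -addnn (leq_ltn_trans IHm).
have expD : f ^+ (k + k) = f ^+ k *m f ^+ k by rewrite exprD.
have homfk := mx_homX k homf; have modK := mx_hom_kermx homfk.
have eqK : (kermx (f ^+ (k + k)) <= kermx (f ^+ k))%MS.
  rewrite -(geq_leqif (mxrank_leqif_sup _)) //.
  by apply/sub_kermxP; rewrite expD mulmxA mulmx_ker mul0mx.
have cap0 : (<<kermx (f ^+ k)>> :&: <<f ^+ k>> = 0)%MS.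
  apply/eqP; rewrite -submx0; apply/rV_subP => u.
  rewrite sub_capmx !genmxE => /andP[/sub_kermxP uf0 /submxP[z def_u]].
  rewrite submx0 def_u; apply/eqP/sub_kermxP; apply: submx_trans eqK.
  by apply/sub_kermxP; rewrite expD mulmxA -def_u.
have sum1 : (<<kermx (f ^+ k)>> + <<f ^+ k>> :=: 1%:M)%MS.
  apply/eqmxP; rewrite submx1 sub1mx /row_full eqn_leq rank_leq_col /=.
  by rewrite mxrank_disjoint_sum // !genmxE mxrank_ker subnK ?rank_leq_row.
have [] := indV _ _ _ _ sum1 cap0.
- by rewrite (eqmx_module _ (genmxE _)).
- rewrite (eqmx_module _ (genmxE _)) -[f ^+ k]mul1mx.
  exact: mx_hom_im homfk (mxmodule1 _).
- move/eqP; rewrite -submx0 genmxE submx0 kermx_eq0 row_free_unit => uk; left.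
  by move: uk; rewrite -(prednK k_gt0) exprS unitmx_mul => /andP[].
move/eqP; rewrite -submx0 genmxE submx0 => /eqP fk0; right.
have := subrX1 f k; rewrite fk0 sub0r => /(congr1 -%R).
by rewrite opprK -mulNr opprB => /esym/mulmx1_unit[].
Qed.

End Biproducts.

(** * Traces and Higman's criterion *)

Section Traces.

Variables (F : fieldType) (gT : finGroupType).

(** The trace of h from the trivial subgroup to A ... *)
Definition gtrace (A : {set gT}) n m (rM : gT -> 'M[F]_n) (rN : gT -> 'M[F]_m)
    (h : 'M_(n, m)) : 'M_(n, m) :=
  \sum_(x in A) rM x^-1%g *m h *m rN x.

(** ... and from H to G, defined with representatives of the cosets; the choice
    of the latter does not matter when h is H-equivariant. *)
Definition rtrace (H G : {set gT}) n m (rM : gT -> 'M[F]_n)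
    (rN : gT -> 'M[F]_m) (h : 'M_(n, m)) : 'M_(n, m) :=
  \sum_(C in rcosets H G) rM (repr C)^-1%g *m h *m rN (repr C).

Lemma sum_rcosets (V : zmodType) (H G : {group gT}) (f : gT -> V) :
    H \subset G ->
  \sum_(x in G) f x = \sum_(C in rcosets H G) \sum_(x in H) f (x * repr C)%g.
Proof.
move=> sHG; rewrite (set_partition_big _ (rcosets_partition sHG)).
apply: eq_bigr => C /rcosetsP[y Gy ->]; set z := repr _.
have -> : H :* y = H :* z by rewrite rcoset_repr.
rewrite (reindex_inj (mulIg z)); apply: eq_bigl => x.
by rewrite mem_rcoset mulgK.
Qed.

Lemma repr_rcosets (H G : {group gT}) C :
  H \subset G -> C \in rcosets H G -> repr C \in G /\ C = H :* repr C.
Proof.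
move=> sHG /rcosetsP[y Gy ->]; rewrite rcoset_repr; split=> //.
by case: repr_rcosetP => z Hz; rewrite groupM // (subsetP sHG).
Qed.

Section OneGroup.

Variables (G : {group gT}).
Local Notation reprG := (mx_representation F G).

Lemma cycle_fixed n k (rM : reprG n) x (f : 'M_(n, k)) : x \in G ->
  rM x^-1%g *m f = f -> forall j, rM (x ^+ j)%g *m f = f.
Proof.
move=> Gx fixV; have fix1 : rM x *m f = f.
  by rewrite -[in LHS]fixV mulmxA -repr_mxM ?groupV // mulgV repr_mx1 mul1mx.
elim=> [|j IHj]; first by rewrite expg0 repr_mx1 mul1mx.
by rewrite expgS repr_mxM ?groupX // -mulmxA IHj.
Qed.

Definition traced n (rM : reprG n) := exists h, gtrace G rM rM h = 1%:M.

Lemma gtrace_hom n m (rM : reprG n) (rN : reprG m) h :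
  mx_hom rM rN (gtrace G rM rN h).
Proof.
move=> y Gy; rewrite mulmx_sumr mulmx_suml (reindex_inj (mulIg y)) /=.
apply: eq_big => [x|x Gyx]; first by rewrite groupMr.
have Gx : x \in G by rewrite -(groupMr _ Gy).
by rewrite !mulmxA -repr_mxM ?groupV ?groupM // invMg mulKVg repr_mxM // !mulmxA.
Qed.

Lemma gtraceM n m k l (rM : reprG n) (rN : reprG m) (rK : reprG k)
    (rL : reprG l) u h v :
    mx_hom rK rM u -> mx_hom rN rL v ->
  u *m gtrace G rM rN h *m v = gtrace G rK rL (u *m h *m v).
Proof.
move=> homu homv; rewrite mulmx_sumr mulmx_suml; apply: eq_bigr => x Gx.
by rewrite !mulmxA homu ?groupV // -!mulmxA homv.
Qed.

(** Higman's criterion, easy half: averaging a linear lift over the group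
    with the weight given by h turns it into an equivariant lift. *)
Lemma gtrace_projective n (rM : reprG n) h :
  gtrace G rM rM h = 1%:M -> mx_projective rM.
Proof.
move=> tr1 m k rN rL f g homf /row_fullP[s sf] homg.
exists (gtrace G rM rN (h *m g *m s)); first exact: gtrace_hom.
rewrite -[_ *m f]mul1mx mulmxA (gtraceM _ (mx_hom1 _) homf) mul1mx.
rewrite -(mulmxA (h *m g)) sf mulmx1.
by rewrite -[h *m g]mul1mx mulmxA -(gtraceM _ (mx_hom1 _) homg) tr1 !mul1mx.
Qed.

Lemma traced_summand n m (rM : reprG n) (rN : reprG m) i q :
    mx_hom rN rM i -> mx_hom rM rN q -> i *m q = 1%:M -> traced rM ->
  traced rN.
Proof.
move=> homi homq iq1 [h tr1]; exists (i *m h *m q).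
by rewrite -(gtraceM _ homi homq) tr1 mulmx1.
Qed.

Definition homs n m (rM : reprG n) (rN : reprG m) : {vspace 'M[F]_(n, m)} :=
  (\bigcap_(x in G) lker (linfun (mulmx (rM x) \- mulmxr (rN x))))%VS.

Lemma homsP n m (rM : reprG n) (rN : reprG m) f :
  reflect (mx_hom rM rN f) (f \in homs rM rN).
Proof.
rewrite memvE; apply: (iffP subv_bigcapP) => homf x Gx.
  have := homf x Gx; rewrite -memvE memv_ker lfunE /= subr_eq0.
  by move/eqP.
by rewrite -memvE memv_ker lfunE /= subr_eq0 homf.
Qed.

Lemma homs_dim0 n m (rM : reprG n) (rN : reprG m) :
  \dim (homs rM rN) = 0 -> forall f, mx_hom rM rN f -> f = 0.
Proof. by move/eqP; rewrite dimv_eq0 => /eqP h0 f /homsP; rewrite h0 memv0 => /eqP. Qed.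

Lemma homs_dim_eq0 n m (rM : reprG n) (rN : reprG m) :
  (forall f, mx_hom rM rN f -> f = 0) -> \dim (homs rM rN) = 0.
Proof.
move=> h0; apply/eqP; rewrite dimv_eq0 -subv0; apply/subvP => f /homsP/h0->.
exact: mem0v.
Qed.

Lemma homs_dim_biproduct n nA nB m (rM : reprG n) (rA : reprG nA)
    (rB : reprG nB) (rN : reprG m) :
    biproduct rM rA rB ->
  \dim (homs rM rN) = (\dim (homs rA rN) + \dim (homs rB rN))%N.
Proof.
case=> iA [qA [iB [qB [[hiA hqA hiB hqB] A1 B1 AB1]]]].
have [ABo BAo] := biproduct_ortho A1 B1 AB1.
pose fA : 'Hom('M[F]_(nA, m), 'M[F]_(n, m)) := linfun (mulmx qA).
pose fB : 'Hom('M[F]_(nB, m), 'M[F]_(n, m)) := linfun (mulmx qB).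
have injA : (homs rA rN :&: lker fA = 0)%VS.
  apply/eqP; rewrite -subv0; apply/subvP => f; rewrite memv_cap memv_ker lfunE.
  case/andP=> _ /eqP /= f0.
  by rewrite memv0 -[f]mul1mx -A1 -mulmxA f0 mulmx0.
have injB : (homs rB rN :&: lker fB = 0)%VS.
  apply/eqP; rewrite -subv0; apply/subvP => f; rewrite memv_cap memv_ker lfunE.
  case/andP=> _ /eqP /= f0.
  by rewrite memv0 -[f]mul1mx -B1 -mulmxA f0 mulmx0.
rewrite -(limg_dim_eq injA) -(limg_dim_eq injB) -dimv_disjoint_sum.
  congr (\dim _); apply/eqP; rewrite eqEsubv; apply/andP; split.
    apply/subvP => f /homsP homf; apply/memv_addP.
    exists (fA (iA *m f)).
      by apply: memv_img; apply/homsP; apply: mx_homM hiA homf.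
    exists (fB (iB *m f)).
      by apply: memv_img; apply/homsP; apply: mx_homM hiB homf.
    by rewrite !lfunE /= !mulmxA -mulmxDl AB1 mul1mx.
  rewrite subv_add; apply/andP; split.
    apply/subvP=> _ /memv_imgP[f /homsP homf ->].
    by rewrite lfunE; apply/homsP; apply: mx_homM hqA homf.
  apply/subvP=> _ /memv_imgP[f /homsP homf ->].
  by rewrite lfunE; apply/homsP; apply: mx_homM hqB homf.
apply/eqP; rewrite -subv0; apply/subvP => f; rewrite memv_cap memv0.
case/andP=> /memv_imgP[g _ def_g] /memv_imgP[g' _ def_g'].
rewrite def_g lfunE /= -[g]mul1mx -A1 -mulmxA.
have -> : qA *m g = f by rewrite def_g lfunE.
by rewrite def_g' lfunE /= (mulmxA iA) ABo mul0mx mulmx0.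
Qed.

Lemma homs_dim_grepr0 m (rN : reprG m) : \dim (homs (@grepr0 F gT G) rN) = 0.
Proof. by apply: homs_dim_eq0 => f _; apply/matrixP => -[]. Qed.

Lemma homs_dim_rsim n n' m (rM : reprG n) (rM' : reprG n') (rN : reprG m) :
  mx_rsim rM rM' -> \dim (homs rM rN) = \dim (homs rM' rN).
Proof.
by move/biproduct0/homs_dim_biproduct->; rewrite homs_dim_grepr0.
Qed.

Lemma homs_dim_dadd m (A B : representation F G) (rN : reprG m) :
  \dim (homs (dadd_grepr A B) rN) = (\dim (homs A rN) + \dim (homs B rN))%N.
Proof. by apply/homs_dim_biproduct/biproduct_rsim/mx_rsim_refl. Qed.

Lemma homs_dim_muln m (A : representation F G) k (rN : reprG m) :
  \dim (homs (muln_grepr A k) rN) = (k * \dim (homs A rN))%N.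
Proof.
elim: k => [|k IHk]; first by rewrite /muln_grepr big_ord0 homs_dim_grepr0.
by rewrite /muln_grepr big_ord_recl homs_dim_dadd IHk mulSn.
Qed.

Lemma homs_dim_sum m (I : Type) (s : seq I) (A : I -> representation F G)
    (rN : reprG m) :
  \dim (homs (\big[@dadd_grepr F gT G/@grepr0 F gT G]_(i <- s) A i) rN)
    = (\sum_(i <- s) \dim (homs (A i) rN))%N.
Proof.
elim: s => [|i s IHs]; first by rewrite !big_nil homs_dim_grepr0.
by rewrite !big_cons homs_dim_dadd IHs.
Qed.

End OneGroup.

Section Subgroup.

Variables (G H : {group gT}).
Hypothesis sHG : H \subset G.
Local Notation reprG := (mx_representation F G).

Lemma rtrace_term n m (rM : reprG n) (rN : reprG m) f x y :
    mx_hom (subg_repr rM sHG) (subg_repr rN sHG) f ->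
    x \in G -> y \in G -> x \in H :* y ->
  rM x^-1%g *m f *m rN x = rM y^-1%g *m f *m rN y.
Proof.
move=> homf Gx Gy /rcosetP[h Hh ->].
have Gh := subsetP sHG _ Hh.
rewrite invMg !repr_mxM ?groupV // !mulmxA -(mulmxA _ f) -[rN h]/(subg_repr rN sHG h).
by rewrite -homf //= mulmxA -(mulmxA _ _ (rM h)) -repr_mxM ?groupV // mulVg repr_mx1 mulmx1.
Qed.

Lemma rtrace_repr n m (rM : reprG n) (rN : reprG m) f y :
    mx_hom (subg_repr rM sHG) (subg_repr rN sHG) f -> y \in G ->
  rM (repr (H :* y))^-1%g *m f *m rN (repr (H :* y)) = rM y^-1%g *m f *m rN y.
Proof.
move=> homf Gy; have Hy : H :* y \in rcosets H G by apply/rcosetsP; exists y.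
have [Gr def_r] := repr_rcosets sHG Hy.
by rewrite (rtrace_term homf Gr Gy) // {2}def_r rcoset_refl.
Qed.

Lemma rtrace_reprV n m (rM : reprG n) (rN : reprG m) f y :
    mx_hom (subg_repr rM sHG) (subg_repr rN sHG) f -> y \in G ->
  rM (repr (H :* y^-1))^-1%g *m f *m rN (repr (H :* y^-1)) = rM y *m f *m rN y^-1%g.
Proof. by move=> homf Gy; rewrite rtrace_repr ?invgK ?groupV. Qed.

Lemma rtrace_hom n m (rM : reprG n) (rN : reprG m) f :
    mx_hom (subg_repr rM sHG) (subg_repr rN sHG) f ->
  mx_hom rM rN (rtrace H G rM rN f).
Proof.
move=> homf y Gy; rewrite mulmx_sumr mulmx_suml.
rewrite (reindex_inj (can_inj (rcosetK y))) /=; apply: eq_big => [C|C Cy].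
  apply/rcosetsP/rcosetsP=> -[z Gz def_C].
    exists (z * y^-1)%g; first by rewrite groupM ?groupV.
    by rewrite rcosetM -def_C rcosetK.
  by exists (z * y)%g; rewrite ?groupM // rcosetM def_C.
have [Gr def_Cy] := repr_rcosets sHG Cy.
have C_HG : C \in rcosets H G.
  have /rcosetsP[z Gz def_z] := Cy; apply/rcosetsP.
  exists (z * y^-1)%g; first by rewrite groupM ?groupV.
  by rewrite rcosetM -def_z rcosetK.
have [GC defC] := repr_rcosets sHG C_HG.
rewrite (rtrace_term homf Gr (groupM GC Gy)); last first.
  by rewrite rcosetM -defC {2}def_Cy rcoset_refl.
rewrite !mulmxA -repr_mxM ?groupV ?groupM // invMg mulKVg.
by rewrite repr_mxM // !mulmxA.
Qed.

Lemma rtraceM n m k l (rM : reprG n) (rN : reprG m) (rK : reprG k)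
    (rL : reprG l) u h v :
    mx_hom rK rM u -> mx_hom rN rL v ->
  u *m rtrace H G rM rN h *m v = rtrace H G rK rL (u *m h *m v).
Proof.
move=> homu homv; rewrite mulmx_sumr mulmx_suml; apply: eq_bigr => C.
case/(repr_rcosets sHG)=> Gx _.
by rewrite !mulmxA homu ?groupV // -!mulmxA homv.
Qed.

Lemma rtraceD n m (rM : reprG n) (rN : reprG m) f g :
  rtrace H G rM rN (f + g) = rtrace H G rM rN f + rtrace H G rM rN g.
Proof.
by rewrite -big_split; apply: eq_bigr => C _; rewrite mulmxDr mulmxDl.
Qed.

Lemma rtrace_homE n m (rM : reprG n) (rN : reprG m) f :
  mx_hom rM rN f -> rtrace H G rM rN f = #|G : H|%:R *: f.
Proof.
move=> homf; rewrite scaler_nat -sumr_const; apply: eq_bigr => C.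
case/(repr_rcosets sHG)=> Gx _; rewrite homf ?groupV // -mulmxA.
by rewrite -repr_mxM ?groupV // mulVg repr_mx1 mulmx1.
Qed.

Lemma gtrace_trans n m (rM : reprG n) (rN : reprG m) h :
  gtrace G rM rN h = rtrace H G rM rN (gtrace H rM rN h).
Proof.
rewrite /gtrace (sum_rcosets _ sHG); apply: eq_bigr => C CHG.
have [GC _] := repr_rcosets sHG CHG.
rewrite mulmx_sumr mulmx_suml; apply: eq_bigr => x Hx.
have Gx := subsetP sHG _ Hx.
by rewrite invMg !repr_mxM ?groupV // !mulmxA.
Qed.

(** A trace to G is also a trace to H: group the elements of G by left cosets
    of H, by inversion from the right ones. *)
Lemma gtrace_sub n m (rM : reprG n) (rN : reprG m) h :
  exists h', gtrace G rM rN h = gtrace H rM rN h'.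
Proof.
exists (\sum_(C in rcosets H G) rM (repr C) *m h *m rN (repr C)^-1%g).
rewrite /gtrace (reindex_inj invg_inj) /= (eq_bigl (mem G)) => [|x]; last first.
  by rewrite groupV.
rewrite (sum_rcosets _ sHG) exchange_big /= (reindex_inj invg_inj) /=.
rewrite (eq_bigl (mem H)) => [|x]; last by rewrite groupV.
apply: eq_bigr => x Hx; have Gx := subsetP sHG _ Hx.
rewrite mulmx_sumr mulmx_suml; apply: eq_bigr => C CHG.
have [GC _] := repr_rcosets sHG CHG.
by rewrite invgK !invMg invgK !repr_mxM ?groupV // !mulmxA.
Qed.

(** Being traced can be tested on a subgroup of index prime to the characteristic:
    the relative trace of the identity is the index. *)
Lemma traced_index n (rM : reprG n) :
    #|G : H|%:R != 0 :> F -> traced (subg_repr rM sHG) ->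
  traced rM.
Proof.
move=> nz [h /= tr1]; exists (#|G : H|%:R^-1 *: h).
rewrite gtrace_trans (_ : gtrace H _ _ _ = #|G : H|%:R^-1 *: 1%:M).
  rewrite rtrace_homE ?scalerA ?divff ?scale1r //.
  exact: mx_homZ (mx_hom1 _).
rewrite -tr1 scaler_sumr; apply: eq_bigr => x _.
by rewrite -scalemxAr -scalemxAl.
Qed.

End Subgroup.

End Traces.

(** * Induced modules and Frobenius reciprocity *)

Section Frobenius.

Variables (F : fieldType) (gT : finGroupType) (H G : {group gT}).
Hypothesis sHG : H \subset G.
Local Notation reprG := (mx_representation F G).
Local Notation reprH := (mx_representation F H).

Section Coordinates.

Variables (n : nat) (rH : reprH n).
Local Notation ind := (induced_repr rH sHG).
Local Notation blk := (ind_block rH).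

Lemma ind_blockMl h x : h \in H -> blk (h * x)%g = rH h *m blk x.
Proof.
move=> Hh; rewrite /ind_block groupMl //.
by case: ifP => Hx; rewrite ?mulmx0 // repr_mxM.
Qed.

Lemma ind_blockMr h x : h \in H -> blk (x * h)%g = blk x *m rH h.
Proof.
move=> Hh; rewrite /ind_block groupMr //.
by case: ifP => Hx; rewrite ?mul0mx // repr_mxM.
Qed.

Lemma ind_block1 : blk 1%g = 1%:M.
Proof. by rewrite /ind_block group1 repr_mx1. Qed.

(** Only the coset of y contributes to the sum. *)
Lemma sum_ind_block y z : y \in G ->
  \sum_(C in rcosets H G) blk (y * (repr C)^-1)%g *m blk (repr C * z)%g
    = blk (y * z)%g.
Proof.
move=> Gy; have HGy : H :* y \in rcosets H G by apply/rcosetsP; exists y.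
have [Gr def_r] := repr_rcosets sHG HGy.
have Hr : (y * (repr (H :* y))^-1)%g \in H.
  by rewrite -mem_rcoset -def_r rcoset_refl.
rewrite (bigD1 (H :* y)) //= big1 ?addr0 => [|C /andP[CHG neC]].
  rewrite {1}/ind_block Hr -ind_blockMl // -[in RHS](mulgKV (repr (H :* y)) y).
  by rewrite -!mulgA.
have [GC defC] := repr_rcosets sHG CHG.
rewrite /ind_block -mem_rcoset -defC; case: ifP => [Cy|]; last by rewrite mul0mx.
by case/negP: neC; rewrite defC eq_sym; apply/eqP/rcoset_eqP; rewrite -defC.
Qed.

(** The summand U (x) y of the induced module, as a map from U ... *)
Definition ind_in y : 'M[F]_(n, \sum_(i < #|rcosets H G|) n) :=
  \mxrow_j blk (y * (coset_rep j)^-1)%g.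

(** ... and the coordinate of an induced vector along U (x) y^-1. *)
Definition ind_out y : 'M[F]_(\sum_(i < #|rcosets H G|) n, n) :=
  \mxcol_i blk (coset_rep i * y)%g.

Lemma sum_coset_rep (V : zmodType) (f : gT -> V) :
  \sum_(i < #|rcosets H G|) f (coset_rep i) = \sum_(C in rcosets H G) f (repr C).
Proof. by apply/esym; exact: (big_enum_val (fun C : {set gT} => f (repr C))). Qed.

Lemma ind_inJ y z : y \in G -> ind_in y *m ind z = ind_in (y * z)%g.
Proof.
move=> Gy; rewrite /= /ind_mx mul_mxrow_mxblock; apply: eq_mxrow => j.
under eq_bigr => i _ do rewrite -(mulgA (coset_rep i)).
rewrite (sum_coset_rep (fun x => blk (y * x^-1)%g *m blk (x * (z * _))%g)).
by rewrite sum_ind_block // mulgA.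
Qed.

Lemma ind_outJ y z : z \in G -> ind z *m ind_out y = ind_out (z * y)%g.
Proof.
move=> Gz; rewrite /= /ind_mx mul_mxblock_mxrow; apply: eq_mxcol => i.
rewrite (sum_coset_rep (fun x => blk (_ * z * x^-1)%g *m blk (x * y)%g)).
by rewrite sum_ind_block ?mulgA // groupM // coset_rep_in.
Qed.

Lemma ind_inK y z : y \in G -> ind_in y *m ind_out z = blk (y * z)%g.
Proof.
move=> Gy; rewrite mul_mxrow_mxcol.
rewrite (sum_coset_rep (fun x => blk (y * x^-1)%g *m blk (x * z)%g)).
exact: sum_ind_block.
Qed.

Lemma ind_in_hom : mx_hom rH (subg_repr ind sHG) (ind_in 1).
Proof.
move=> h Hh; rewrite ind_inJ // mul1g mul_mxrow; apply: eq_mxrow => j.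
by rewrite -ind_blockMl // mul1g.
Qed.

Lemma ind_out_hom : mx_hom (subg_repr ind sHG) rH (ind_out 1).
Proof.
move=> h Hh; rewrite ind_outJ ?(subsetP sHG) // mulg1 mxcol_mul.
by apply: eq_mxcol => i; rewrite -ind_blockMr // mulg1.
Qed.

(** The induced module is the sum of the translates of U (x) 1. *)
Lemma rtrace_ind : rtrace H G ind ind (ind_out 1 *m ind_in 1) = 1%:M.
Proof.
transitivity (\sum_(C in rcosets H G)
    ind_out (repr C)^-1%g *m ind_in (repr C)).
  apply: eq_bigr => C CHG; have [GC _] := repr_rcosets sHG CHG.
  by rewrite mulmxA ind_outJ ?groupV // mulg1 -mulmxA ind_inJ // mul1g.
transitivity (\mxblock_(i, j) blk
   (@coset_rep gT H G i * (@coset_rep gT H G j)^-1)%g).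
  apply/mxblockP => i j; rewrite mxblockK -sum_ind_block ?coset_rep_in //.
  rewrite submxblock_sum; apply: eq_bigr => C _.
  by rewrite mul_mxcol_mxrow mxblockK.
rewrite -(repr_mx1 ind) /= /ind_mx; apply: eq_mxblock => i j.
by rewrite mulg1.
Qed.

End Coordinates.

Section Reciprocity.

Variables (n : nat) (rH : reprH n) (m : nat) (rN : reprG m).
Local Notation ind := (induced_repr rH sHG).

(** The extension of f from U to the induced module. *)
Definition frobenius (f : 'M[F]_(n, m)) := rtrace H G ind rN (ind_out rH 1 *m f).

Lemma frobenius_hom f :
  mx_hom rH (subg_repr rN sHG) f -> mx_hom ind rN (frobenius f).
Proof. move=> homf; apply: rtrace_hom; exact: mx_homM (ind_out_hom _) homf. Qed.

Lemma frobeniusK f :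
  mx_hom rH (subg_repr rN sHG) f -> ind_in rH 1 *m frobenius f = f.
Proof.
move=> homf; rewrite mulmx_sumr (bigD1 (H :* 1)) /=; last first.
  by apply/rcosetsP; exists 1%g.
have H1: H :* 1 \in rcosets H G by apply/rcosetsP; exists 1%g.
have [G1 def1] := repr_rcosets sHG H1.
have Hr : repr (H :* 1) \in H by rewrite rcoset1 repr_group.
rewrite [X in _ + X]big1 ?addr0 => [|C /andP[CHG neC]].
  rewrite !mulmxA ind_inJ // mul1g ind_inK ?groupV // mulg1 /ind_block groupV Hr.
  by rewrite homf ?groupV // -mulmxA -repr_mxM ?groupV // mulVg repr_mx1 mulmx1.
have [GC defC] := repr_rcosets sHG CHG.
rewrite !mulmxA ind_inJ // mul1g ind_inK ?groupV // mulg1 /ind_block groupV.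
case: ifP => [HC|_]; last by rewrite !mul0mx.
by case/eqP: neC; rewrite defC mulg1 rcoset_id.
Qed.

(** U (x) 1 generates the induced module. *)
Lemma ind_hom_eq0 f : mx_hom ind rN f -> ind_in rH 1 *m f = 0 -> f = 0.
Proof.
move=> homf f0; rewrite -[f]mul1mx -(rtrace_ind rH) mulmx_suml.
apply: big1 => C /(repr_rcosets sHG)[GC _].
by rewrite -!mulmxA homf // !mulmxA -(mulmxA _ _ f) f0 mulmx0 mul0mx.
Qed.

(** Frobenius reciprocity preserves the maps that are traces from the trivial
    subgroup: on U (x) 1 only the terms of H survive. *)
Lemma ind_in_gtrace k :
  ind_in rH 1 *m gtrace G ind rN (ind_out rH 1 *m k) = gtrace H rH rN k.
Proof.
rewrite mulmx_sumr (big_setID H) /= (setIidPr sHG) [X in _ + X]big1 ?addr0.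
  apply: eq_bigr => x Hx; rewrite !mulmxA ind_inJ // mul1g ind_inK ?groupV //.
    by rewrite mulg1 /ind_block groupV Hx.
  exact: subsetP sHG _ _.
move=> x /setDP[Gx nHx]; rewrite !mulmxA ind_inJ // mul1g ind_inK ?groupV //.
by rewrite mulg1 /ind_block groupV (negPf nHx) !mul0mx.
Qed.

End Reciprocity.

Lemma ind_traced n (rH : reprH n) :
  traced rH -> traced (induced_repr rH sHG).
Proof.
case=> h tr1; exists (ind_out rH 1 *m h *m ind_in rH 1).
rewrite (gtrace_trans sHG).
rewrite -(gtraceM _ (ind_out_hom rH) (ind_in_hom rH)) tr1 mulmx1.
exact: rtrace_ind.
Qed.

End Frobenius.

(** Higman's criterion, converse half: M is a quotient of the free module
    obtained by inducing its restriction to the trivial subgroup. *)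
Lemma projective_traced (F : fieldType) (gT : finGroupType) (G : {group gT})
    n (rM : mx_representation F G n) :
  mx_projective rM -> traced rM.
Proof.
move=> projM; pose s1 := sub1G G; pose r1 := subg_repr rM s1.
have hom1 : mx_hom r1 (subg_repr rM s1) 1%:M by exact: mx_hom1.
have fullc : row_full (frobenius s1 r1 rM 1%:M).
  by apply/row_fullP; exists (ind_in G r1 1); apply: frobeniusK.
have homc := frobenius_hom hom1.
have [s homs sc] := projM _ _ _ _ _ _ homc fullc (mx_hom1 rM).
apply: (traced_summand homs homc sc); apply: ind_traced.
exists 1%:M; rewrite /gtrace big_set1 invg1.
by rewrite -[rM 1%g]/(r1 1%g) repr_mx1 !mulmx1.
Qed.

(** * Modules over a cyclic group of order p *)

Section BinomialSums.

Variables (R : pzRingType) (p : nat) (g y : R).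
Hypotheses (pr_p : prime p) (p0 : p%:R = 0 :> R).
Hypotheses (yg : y * g = 1) (gp : g ^+ p = 1).

(** By Pascal's rule the difference of the two sides telescopes to the term
    C(p, j + 1), which vanishes. *)
Lemma binom_sum_step j : (j.+1 < p)%N ->
  (y - 1) * (\sum_(k < p) g ^+ k *+ 'C(k, j.+1)) = \sum_(k < p) g ^+ k *+ 'C(k, j).
Proof.
move=> lt_jp; set D1 := \sum_(k < p) _; set D := \sum_(k < p) _.
have gD : g * D + g * D1 = D1.
  apply/eqP; rewrite -subr_eq0 /D /D1 !mulr_sumr -big_split -sumrB /=.
  rewrite (eq_bigr (fun k : 'I_p => g ^+ k.+1 *+ 'C(k.+1, j.+1)
      - g ^+ k *+ 'C(k, j.+1))) => [|k _]; last first.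
    by rewrite !mulrnAr -!exprS binS mulrnDr [X in X - _]addrC.
  rewrite -(big_mkord xpredT (fun k => g ^+ k.+1 *+ 'C(k.+1, j.+1) - g ^+ k *+ 'C(k, j.+1))).
  rewrite (telescope_sumr (fun k => g ^+ k *+ 'C(k, j.+1))) // gp bin0n subr0.
  have /dvdnP[q ->] : (p %| 'C(p, j.+1))%N by rewrite prime_dvd_bin.
  by rewrite mulnC mulrnA p0 mul0rn.
have -> : D = y * (g * D) by rewrite mulrA yg mul1r.
by rewrite -[g * D](addrK (g * D1)) gD mulrBr mulrA yg mul1r mulrBl mul1r.
Qed.

(** In the group algebra of a cyclic group of order p in characteristic p, the
    sums weighted by the binomial coefficients C(k, j) run through the powers
    of the augmentation ideal as j decreases. *)
Lemma binom_sum l : (l < p)%N ->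
  \sum_(k < p) g ^+ k *+ 'C(k, p.-1 - l) = (y - 1) ^+ l * y.
Proof.
elim: l => [|l IHl] lt_lp.
  rewrite subn0 expr0 mul1r; have p_gt0 := prime_gt0 pr_p.
  case: p p_gt0 gp => // q _ gq /=.
  rewrite big_ord_recr /= binn mulr1n big1 ?add0r => [|k _]; last first.
    by rewrite bin_small ?mulr0n.
  by rewrite -[g ^+ q]mul1r -yg -mulrA -exprS gq mulr1.
rewrite exprS -mulrA -(IHl (ltnW lt_lp)) -binom_sum_step; last first.
  by rewrite -subSn ?subn_gt0; lia.
by congr (_ * _); apply: eq_bigr => k _; congr (_ *+ 'C(_, _)); lia.
Qed.

End BinomialSums.

Section Towers.

Variable F : fieldType.

(** The vectors A Y^k, k < c, from the generators A of a module over F[Y]. *)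
Definition tower n r (Y : 'M[F]_n) c (A : 'M_(r, n)) : 'M_(\sum_(k < c) r, n) :=
  \mxcol_(k < c) (A *m Y ^+ k).

(** A shortest relation between the A Y^k would, multiplied by a power of Y,
    give one on A Y^(c-1) alone. *)
Lemma tower_free n r (Y : 'M[F]_n) c (A : 'M_(r, n)) :
  A *m Y ^+ c = 0 -> row_free (A *m Y ^+ c.-1) -> row_free (tower Y c A).
Proof.
move=> AYc freeA; apply/inj_row_free => u; rewrite -[u]submxrowK.
rewrite mul_mxrow_mxcol => u0; rewrite -[0](submxrowK).
apply: eq_mxrow => j; rewrite submxrow0.
have AY0 d : (c <= d)%N -> A *m Y ^+ d = 0.
  by move=> le_cd; rewrite -(subnK le_cd) addnC exprD [_ * _]/(_ *m _) mulmxA AYc mul0mx.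
have [m] := ubnP j; elim: m j => // m IHm j; rewrite ltnS => le_jm.
apply: (row_free_inj freeA); rewrite mul0mx.
have /(congr1 (mulmx^~ (Y ^+ (c.-1 - j)))) := u0.
rewrite mul0mx mulmx_suml (bigD1 j) //= big1 ?addr0 => [|i neq_ij].
  by rewrite -!mulmxA -[Y ^+ j *m _]exprD subnKC //; have := ltn_ord j; lia.
rewrite -!mulmxA -[Y ^+ i *m _]exprD.
have [lt_ij|le_ji] := ltnP i j.
  by rewrite IHm ?mul0mx // (leq_trans lt_ij).
rewrite AY0 ?mulmx0 //; have := ltn_ord j.
by move: neq_ij; rewrite -val_eqE /=; lia.
Qed.

(** Values on free vectors can be prescribed. *)
Lemma tower_ext n r m (Y : 'M[F]_n) c (A : 'M_(r, n)) (B : 'I_c -> 'M_(r, m)) :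
    row_free (tower Y c A) ->
  exists h, forall j : 'I_c, A *m Y ^+ j *m h = B j.
Proof.
move=> freeT; exists (pinvmx (tower Y c A) *m \mxcol_j B j) => j.
rewrite mulmxA -[A *m _](mxcolK (fun k : 'I_c => A *m Y ^+ k)).
rewrite -/(tower Y c A) !submxcol_mul mulmxVp // mul1mx mxcolK.
by [].
Qed.

End Towers.

Section CyclicP.

Variables (F : fieldType) (p : nat) (charFp : p \in [pchar F]).
Variables (gT : finGroupType) (x : gT).
Hypothesis ox : #[x]%g = p.
Local Notation P := <[x]>%G.
Local Notation reprP := (mx_representation F P).

Let pr_p : prime p := pcharf_prime charFp.

(** The generator of the augmentation ideal of F[P], acting on M. *)
Definition aug n (rM : gT -> 'M[F]_n) : 'M_n := rM x^-1%g - 1.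

Lemma aug_fixed (G : {group gT}) n m (rM : mx_representation F G n)
    (f : 'M_(n, m)) : x \in G ->
  aug rM *m f = 0 -> forall j, rM (x ^+ j)%g *m f = f.
Proof.
move=> Gx; rewrite mulmxBl mul1mx => /eqP; rewrite subr_eq0 => /eqP.
exact: cycle_fixed.
Qed.

Lemma repr_cycleX n (rM : reprP n) k : rM (x ^+ k)%g = rM x ^+ k.
Proof.
elim: k => [|k IHk]; first by rewrite expg0 repr_mx1.
by rewrite expgS exprS repr_mxM ?mem_cycle ?cycle_id // IHk.
Qed.

Lemma repr_cycleXV n (rM : reprP n) k : rM (x ^+ k)^-1%g = rM x^-1%g ^+ k.
Proof.
rewrite -expgVn; elim: k => [|k IHk]; first by rewrite expg0 repr_mx1.
by rewrite expgS exprS repr_mxM ?groupX ?groupV ?cycle_id // IHk.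
Qed.

Lemma mulmx_xV n (rM : reprP n) : rM x * rM x^-1%g = 1.
Proof. by rewrite -[LHS]repr_mxM ?groupV ?cycle_id // mulgV repr_mx1. Qed.

Lemma mulmx_Vx n (rM : reprP n) : rM x^-1%g * rM x = 1.
Proof. by rewrite -[LHS]repr_mxM ?groupV ?cycle_id // mulVg repr_mx1. Qed.

Lemma repr_xp n (rM : reprP n) : rM x ^+ p = 1.
Proof. by rewrite -repr_cycleX -ox expg_order repr_mx1. Qed.

Lemma mx_pchar n : p%:R = 0 :> 'M[F]_n.
Proof. by rewrite -scaler_nat (pcharf0 charFp) scale0r. Qed.

Lemma big_cycle (V : nmodType) (f : gT -> V) :
  \sum_(z in P) f z = \sum_(k < p) f (x ^+ k)%g.
Proof.
have imP : [set (x ^+ k)%g | k : 'I_p] = P.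
  apply/setP => z; apply/imsetP/idP => [[k _ ->]|]; first exact: mem_cycle.
  by case/cyclePmin=> k lt_k ->; rewrite ox in lt_k; exists (Ordinal lt_k).
rewrite -imP big_imset //= => i j _ _ /eqP.
by rewrite eq_expg_mod_order ox !modn_small // => /eqP/val_inj.
Qed.

Lemma aug_commV n (rM : reprP n) k :
  aug rM ^+ k *m rM x^-1%g = rM x^-1%g *m aug rM ^+ k.
Proof.
apply/esym/(commrX k); apply: commrB; last exact: commr1.
exact: erefl.
Qed.

Lemma aug_comm n (rM : reprP n) k : rM x *m aug rM ^+ k = aug rM ^+ k *m rM x.
Proof.
apply: commrX; apply: commrB; last exact: commr1.
by rewrite /GRing.comm mulmx_xV mulmx_Vx.
Qed.

Lemma aug_p n (rM : reprP n) : aug rM ^+ p = 0.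
Proof.
have := @binom_sum _ p _ _ pr_p (mx_pchar n) (mulmx_Vx rM) (repr_xp rM) p.-1.
rewrite ltn_predL prime_gt0 // => /(_ isT) sumE.
have -> : aug rM ^+ p = aug rM * (aug rM ^+ p.-1 * rM x^-1%g) * rM x.
  by rewrite -!mulrA mulmx_Vx mulr1 -exprS prednK ?prime_gt0.
rewrite -sumE subnn; under eq_bigr => k _ do rewrite bin0 mulr1n.
have -> : aug rM = rM x^-1%g * (1 - rM x) by rewrite mulrBr mulr1 mulmx_Vx.
rewrite -(mulrA _ (1 - _)) -opprB mulNr -subrX1 repr_xp subrr oppr0.
by rewrite mulr0 mul0r.
Qed.

(** The trace over P expressed on a basis adapted to the augmentation
    filtration: the coefficient of A Y^j is an element of depth p - 1 - j. *)
Lemma mul_gtrace_cycle n m r (rM : reprP n) (rN : reprP m) h (A : 'M_(r, n)) :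
  A *m gtrace P rM rN h =
    \sum_(j < p) A *m aug rM ^+ j *m h *m (aug rN ^+ (p.-1 - j) *m rN x^-1%g).
Proof.
rewrite /gtrace big_cycle mulmx_sumr.
transitivity (\sum_(k < p) \sum_(j < p)
    A *m aug rM ^+ j *m h *m (rN x ^+ k *+ 'C(k, j))).
  apply: eq_bigr => k _; rewrite repr_cycleX repr_cycleXV.
  rewrite -[rM x^-1%g](subrK 1) exprD1n.
  rewrite (big_ord_widen p (fun i => aug rM ^+ i *+ 'C(k, i))) // big_mkcond /=.
  rewrite mulmx_suml mulmx_suml mulmx_sumr; apply: eq_bigr => j _.
  case: ltnP => [_|lt_kj]; last first.
    by rewrite !mul0mx mulmx0 bin_small ?mulr0n ?mulmx0.
  by rewrite -!scaler_nat -!scalemxAl -!scalemxAr !mulmxA.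
rewrite exchange_big; apply: eq_bigr => j _ /=.
rewrite -mulmx_sumr; congr (_ *m _).
have le_jp : (j <= p.-1)%N by rewrite -ltnS prednK ?prime_gt0.
have lt_p : (p.-1 - j < p)%N by have := prime_gt0 pr_p; lia.
have := binom_sum pr_p (mx_pchar m) (mulmx_Vx rN) (repr_xp rN) lt_p.
by rewrite (subKn le_jp).
Qed.

Lemma cycle_span n m k (rM : reprP n) (v : 'M_(k, n)) (W : 'M_(m, n)) :
    (forall j, v *m aug rM ^+ j <= W)%MS ->
  forall z, z \in P -> (v *m rM z <= W)%MS.
Proof.
move=> sW z Pz; have /cycleP[j def_z] : z^-1%g \in <[x]>%g by rewrite groupV.
have -> : z = ((x ^+ j)^-1)%g by rewrite -def_z invgK.
rewrite repr_cycleXV -[rM x^-1%g](subrK 1) exprD1n mulmx_sumr summx_sub // => i _.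
by rewrite -scaler_nat -scalemxAr scalemx_sub.
Qed.

Lemma aug_gen n (rM : reprP n) :
  exists A, A *m aug rM ^+ p.-1 = row_base (aug rM ^+ p.-1).
Proof.
have /submxP[A ->] : (row_base (aug rM ^+ p.-1) <= aug rM ^+ p.-1)%MS.
  by rewrite eq_row_base.
by exists A.
Qed.

(** If the rows of A Y^(p-1) are independent, those of A generate a free module. *)
Lemma rank_aug_le n (rM : reprP n) : (p * \rank (aug rM ^+ p.-1) <= n)%N.
Proof.
have [A defA] := aug_gen rM.
have freeT : row_free (tower (aug rM) p A).
  by apply: tower_free; rewrite ?aug_p ?mulmx0 // defA row_base_free.
move: (rank_leq_col (tower (aug rM) p A)); rewrite (eqP freeT).
by rewrite sum_nat_const card_ord.
Qed.

(** The sum over P is (g - 1)^(p-1) in characteristic p. *)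
Lemma aug_top n (rM : reprP n) :
  aug rM ^+ p.-1 *m rM x^-1%g = \sum_(z in P) rM z.
Proof.
have := @binom_sum _ p _ _ pr_p (mx_pchar n) (mulmx_Vx rM) (repr_xp rM) p.-1.
rewrite ltn_predL prime_gt0 // => /(_ isT) sumE.
transitivity (aug rM ^+ p.-1 * rM x^-1%g) => //; rewrite -sumE big_cycle subnn.
by apply: eq_bigr => k _; rewrite bin0 mulr1n repr_cycleX.
Qed.

Lemma aug_hom n m (rM : reprP n) (rN : reprP m) f k :
  mx_hom rM rN f -> aug rM ^+ k *m f = f *m aug rN ^+ k.
Proof.
move=> homf; have homY : aug rM *m f = f *m aug rN.
  by rewrite /aug mulmxBl mulmxBr mul1mx mulmx1 homf // groupV cycle_id.
elim: k => [|k IHk]; first by rewrite !expr0 mul1mx mulmx1.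
have stepM : aug rM ^+ k.+1 = aug rM *m aug rM ^+ k := exprS _ _.
have stepN : aug rN ^+ k.+1 = aug rN *m aug rN ^+ k := exprS _ _.
by rewrite stepM stepN -mulmxA IHk !mulmxA homY.
Qed.

Lemma aug_rank_biproduct n nA nB (rM : reprP n) (rA : reprP nA) (rB : reprP nB) k :
    biproduct rM rA rB ->
  (\rank (aug rM ^+ k) <= \rank (aug rA ^+ k) + \rank (aug rB ^+ k))%N.
Proof.
case=> iA [qA [iB [qB [[hiA hqA hiB hqB] A1 B1 AB1]]]].
rewrite -[aug rM ^+ k]mulmx1 -AB1 mulmxDr !mulmxA !(aug_hom _ hqA) !(aug_hom _ hqB).
apply: leq_trans (mxrank_add _ _) _.
by apply: leq_add; apply: leq_trans (mxrankM_maxl _ _) (mxrankM_maxr _ _).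
Qed.

(** If P acts on M with rank of Y^(p-1) as large as the dimension allows, a
    complement of the kernel of Y^(p-1) is a set of free generators; the
    trace of the matrix reading the coordinates of Y^(p-1) is the identity. *)
Lemma traced_of_rank n (rM : reprP n) :
  (n <= p * \rank (aug rM ^+ p.-1))%N -> traced rM.
Proof.
set Y := aug rM; set r := \rank _ => le_n; have p_gt0 := prime_gt0 pr_p.
have [A defA] := aug_gen rM.
have freeT : row_free (tower Y p A).
  by apply: tower_free; rewrite ?aug_p ?mulmx0 // defA row_base_free.
have fullT : row_full (tower Y p A).
  rewrite /row_full eqn_leq rank_leq_col (eqP freeT).
  by rewrite sum_nat_const card_ord.
have [h defh] := tower_ext (fun j : 'I_p => if j == p.-1 :> nat then A *m rM x else 0) freeT.
have Atr : A *m gtrace P rM rM h = A.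
  have lt_p1 : (p.-1 < p)%N by rewrite ltn_predL.
  rewrite mul_gtrace_cycle (bigD1 (Ordinal lt_p1)) //= big1 ?addr0 => [|j].
    (* The factor rM x in h cancels the one of the last term of the trace. *)
    rewrite (defh (Ordinal lt_p1)) /= eqxx subnn expr0 mul1mx -mulmxA.
    by rewrite [rM x *m _]mulmx_xV mulmx1.
  rewrite -val_eqE /= => /negPf ne_j.
  by rewrite (defh j) ne_j mul0mx.
exists h; apply: (row_full_inj fullT); rewrite mulmx1 mxcol_mul.
apply: eq_mxcol => k; rewrite -mulmxA -[in RHS]Atr -!mulmxA; congr (A *m _).
have trhom := gtrace_hom rM rM h.
have trx : gtrace P rM rM h *m rM x^-1%g = rM x^-1%g *m gtrace P rM rM h.
  by rewrite trhom ?groupV ?cycle_id.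
have : GRing.comm (gtrace P rM rM h) (Y ^+ k).
  apply: commrX; rewrite /Y /aug; apply: commrB; last exact: commr1.
  exact: trx.
by move=> comm_tr; apply/esym/comm_tr.
Qed.

End CyclicP.

(** * Elements of SL_2(F_p) *)

Section SL2Elements.

Variable p : nat.
Hypothesis pr_p : prime p.

Local Notation GL := {'GL_2['F_p]}.
Local Notation G := (SL2 p).
Local Notation B := (borel p).
Local Notation simpr := (mulr0, mul0r, mulr1, mul1r, addr0, add0r).
Implicit Types (x y z : GL) (r s : 'F_p).

Definition mat2 (a b c d : 'F_p) : 'M['F_p]_2 :=
  \matrix_(i, j) (if i == 0 then if j == 0 then a else b else
                  if j == 0 then c else d).

Lemma ord2P (P : 'I_2 -> Prop) : P 0 -> P 1 -> forall i, P i.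
Proof.
move=> P0 P1 [[|[|//]] lti].
  by have -> : Ordinal lti = 0 by apply: val_inj.
by have -> : Ordinal lti = 1 by apply: val_inj.
Qed.

Lemma big_ord2 (R : Type) (idx : R) (op : Monoid.law idx) (f : 'I_2 -> R) :
  \big[op/idx]_i f i = op (f 0) (f 1).
Proof.
by rewrite big_ord_recl big_ord1; congr (op (f _) (f _)); apply: val_inj.
Qed.

Lemma det2 (M : 'M['F_p]_2) : \det M = M 0 0 * M 1 1 - M 0 1 * M 1 0.
Proof.
rewrite (expand_det_row _ 0) big_ord2 /cofactor !det_mx11 !mxE /=.
rewrite expr0 mul1r expr1 mulN1r mulrN.
by congr (M _ _ * M _ _ - M _ _ * M _ _); apply: val_inj.
Qed.

Lemma GL2_M x y i j :
  GLval (x * y)%g i j = GLval x i 0 * GLval y 0 j + GLval x i 1 * GLval y 1 j :> 'F_p.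
Proof. by rewrite GL_MxE mxE big_ord2. Qed.

Lemma GL2_1 : (GLval (1%g : GL) 0 0 = 1 :> 'F_p) * (GLval (1%g : GL) 0 1 = 0 :> 'F_p)
  * (GLval (1%g : GL) 1 0 = 0 :> 'F_p) * (GLval (1%g : GL) 1 1 = 1 :> 'F_p).
Proof. by rewrite GL_1E !mxE. Qed.

Lemma GL2_eq x y :
    GLval x 0 0 = GLval y 0 0 -> GLval x 0 1 = GLval y 0 1 ->
    GLval x 1 0 = GLval y 1 0 -> GLval x 1 1 = GLval y 1 1 ->
  x = y.
Proof.
move=> e00 e01 e10 e11; apply: val_inj; apply/matrixP.
by apply: ord2P; apply: ord2P.
Qed.

Lemma SL2_det x : x \in G -> GLval x 0 0 * GLval x 1 1 - GLval x 0 1 * GLval x 1 0 = 1 :> 'F_p.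
Proof. by rewrite inE => /eqP <-; rewrite det2. Qed.

Lemma SL2M x y : x \in G -> y \in G -> (x * y)%g \in G.
Proof. by rewrite !inE GL_ME det_mulmx => /eqP-> /eqP->; rewrite mulr1. Qed.

Lemma SL2V x : x \in G -> x^-1%g \in G.
Proof. by rewrite !inE GL_VE det_inv => /eqP->; rewrite invr1. Qed.

Lemma gl2_key : {f : 'F_p -> 'F_p -> 'F_p -> 'F_p -> GL |
  forall a b c d, a * d - b * c = 1 -> val (f a b c d) = mat2 a b c d}.
Proof.
exists (fun a b c d => insubd (1%g : GL) (mat2 a b c d)) => a b c d det1.
rewrite val_insubd ifT // unitmxE det2 !mxE /= det1.
exact: unitr1.
Qed.

(** Sealed, so that elements are compared through their four entries and never
    by unfolding the construction of the general linear group. *)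
Definition gl2 := sval gl2_key.

Lemma gl2_val a b c d : a * d - b * c = 1 -> val (gl2 a b c d) = mat2 a b c d.
Proof. exact: (svalP gl2_key). Qed.

Lemma gl2_SL2 a b c d : a * d - b * c = 1 -> gl2 a b c d \in G.
Proof.
by move=> det1; rewrite inE -[GLval _]/(val _) gl2_val // det2 !mxE /= det1.
Qed.

Lemma gl2E a b c d : a * d - b * c = 1 ->
  ((GLval (gl2 a b c d) 0 0 = a) * (GLval (gl2 a b c d) 0 1 = b)
   * (GLval (gl2 a b c d) 1 0 = c) * (GLval (gl2 a b c d) 1 1 = d))%type.
Proof.
by move=> det1; rewrite -[GLval _]/(val _) gl2_val // !mxE.
Qed.

Lemma SL2_inv x : x \in G ->
  ((GLval x^-1%g 0 0 = GLval x 1 1 :> 'F_p) * (GLval x^-1%g 0 1 = - GLval x 0 1 :> 'F_p)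
   * (GLval x^-1%g 1 0 = - GLval x 1 0 :> 'F_p) * (GLval x^-1%g 1 1 = GLval x 0 0 :> 'F_p))%type.
Proof.
move/SL2_det=> det1.
have det1' : GLval x 1 1 * GLval x 0 0 - (- GLval x 0 1) * (- GLval x 1 0) = 1 :> 'F_p.
  by rewrite mulrNN mulrC.
suff -> : (x^-1)%g = gl2 (GLval x 1 1) (- GLval x 0 1) (- GLval x 1 0) (GLval x 0 0) by apply: gl2E.
apply: (mulgI x); rewrite mulgV; have E := gl2E det1'.
apply: GL2_eq; rewrite GL2_M !E !GL2_1.
- by rewrite mulrN det1.
- by rewrite mulrN mulrC addrC subrr.
- by rewrite mulrN mulrC subrr.
by rewrite mulrN addrC mulrC -det1; congr (_ - _); rewrite mulrC.
Qed.

Lemma borelP x : reflect (x \in G /\ GLval x 1 0 = 0) (x \in B).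
Proof.
by rewrite [x \in B]inE; apply: (iffP andP) => -[Gx /eqP x10]; split=> //; apply/eqP.
Qed.

Lemma borel_det x : x \in B -> GLval x 0 0 * GLval x 1 1 = 1 :> 'F_p.
Proof. by case/borelP=> /SL2_det <- ->; rewrite mulr0 subr0. Qed.

Lemma borel_neq0 x : x \in B -> GLval x 0 0 != 0 :> 'F_p.
Proof.
move/borel_det=> det1; apply: contra_eq_neq det1 => ->.
by rewrite mul0r eq_sym oner_neq0.
Qed.

Lemma borel_11 x : x \in B -> GLval x 1 1 = (GLval x 0 0)^-1 :> 'F_p.
Proof.
move=> Bx; apply: (mulfI (borel_neq0 Bx)).
by rewrite borel_det // divff // borel_neq0.
Qed.

Definition upper s := gl2 1 s 0 1.
Definition torus r := gl2 r 0 0 r^-1.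
(** Representatives of the points (s : 1) of the projective line; the identity
    represents (1 : 0). *)
Definition point s := gl2 s (-1) 1 0.

Arguments upper s%_R.
Arguments torus r%_R.
Arguments point s%_R.

Lemma upperE s : ((GLval (upper s) 0 0 = 1) * (GLval (upper s) 0 1 = s)
   * (GLval (upper s) 1 0 = 0) * (GLval (upper s) 1 1 = 1))%type.
Proof. by apply: gl2E; rewrite mulr0 subr0 mulr1. Qed.

Lemma torusE r : r != 0 -> ((GLval (torus r) 0 0 = r) * (GLval (torus r) 0 1 = 0)
   * (GLval (torus r) 1 0 = 0) * (GLval (torus r) 1 1 = r^-1))%type.
Proof. by move=> nz_r; apply: gl2E; rewrite mulr0 subr0 divff. Qed.

Lemma pointE s : ((GLval (point s) 0 0 = s) * (GLval (point s) 0 1 = -1)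
   * (GLval (point s) 1 0 = 1) * (GLval (point s) 1 1 = 0))%type.
Proof. by apply: gl2E; rewrite mulr0 mulr1 opprK add0r. Qed.

Lemma point_in s : point s \in G.
Proof. by apply: gl2_SL2; rewrite mulr0 mulr1 opprK add0r. Qed.

Lemma upper_borel s : upper s \in B.
Proof.
apply/borelP; split; last by rewrite upperE.
by apply: gl2_SL2; rewrite mulr0 subr0 mulr1.
Qed.

Lemma torus_borel r : r != 0 -> torus r \in B.
Proof.
move=> nz_r; apply/borelP; split; last by rewrite torusE.
by apply: gl2_SL2; rewrite mulr0 subr0 divff.
Qed.

Lemma upperD s t : upper (s + t) = (upper s * upper t)%g.
Proof.
apply: GL2_eq; rewrite GL2_M !upperE; rewrite ?simpr //.
exact: addrC.
Qed.

Lemma upper0 : upper 0 = 1%g.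
Proof. by apply: GL2_eq; rewrite upperE GL2_1. Qed.

Lemma upper_nat k : upper k%:R = (upper 1%R ^+ k)%g.
Proof.
elim: k => [|k IHk]; first by rewrite upper0 expg0.
by rewrite mulrS upperD IHk expgS.
Qed.

Lemma upper_inj : injective upper.
Proof. by move=> s t st; rewrite -[s](upperE s) st upperE. Qed.

Lemma Fp_nat s : (s : nat)%:R = s.
Proof. by rewrite natr_Zp. Qed.

Lemma upperX s : upper s = (upper 1%R ^+ s)%g.
Proof. by rewrite -upper_nat Fp_nat. Qed.

Lemma order_upper : #[upper 1%R]%g = p.
Proof.
apply/(nt_prime_order pr_p).
  rewrite -upper_nat; have /andP[_ /eqP->] := pchar_Fp pr_p.
  exact: upper0.
by rewrite -upper0; apply: contra_eq_neq (oner_neq0 'F_p) => /upper_inj->.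
Qed.

Local Notation P := <[upper 1%R]>%G.

Lemma unipP x : reflect (exists s, x = upper s) (x \in P).
Proof.
apply: (iffP idP) => [/cycleP[k ->]|[s ->]]; first by exists k%:R; rewrite upper_nat.
by apply/cycleP; exists s; apply: upperX.
Qed.

Lemma unip_sub_borel : P \subset B.
Proof. by rewrite cycle_subG upper_borel. Qed.

Lemma borel_decomp x : x \in B ->
  let r := GLval x 0 0 in let s := GLval x 0 1 * r in x = (upper s * torus r)%g.
Proof.
move=> Bx r s; have nz := borel_neq0 Bx; have [_ x10] := borelP _ Bx.
apply: GL2_eq; rewrite GL2_M !upperE !(torusE nz); rewrite ?simpr //.
  by rewrite mulfK.
by rewrite borel_11.
Qed.

Lemma upper_torus s r : r != 0 ->
  (upper s * torus r = torus r * upper (s * r^-1 ^+ 2))%g.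
Proof.
move=> nz; apply: GL2_eq; rewrite !GL2_M !upperE !(torusE nz);
  rewrite ?simpr //.
by rewrite expr2 mulrCA (mulrA r) divff // mul1r.
Qed.

Lemma torusM r s : r != 0 -> s != 0 -> (torus (r * s) = torus r * torus s)%g.
Proof.
move=> nzr nzs; apply: GL2_eq; rewrite GL2_M !torusE ?mulf_neq0 //;
  rewrite ?simpr //.
by rewrite invfM.
Qed.

(** An element of B is determined by its first row (r, s), with r nonzero. *)
Lemma card_borel : #|B| = (p * p.-1)%N.
Proof.
pose f x : 'F_p * 'F_p := (GLval x 0 1, GLval x 0 0).
have injf : {in B &, injective f}.
  move=> x y Bx By [e01 e00]; have [_ x10] := borelP _ Bx.
  have [_ y10] := borelP _ By.
  by apply: GL2_eq; rewrite ?x10 ?y10 // !borel_11 // e00.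
rewrite -(card_in_imset injf).
have -> : f @: B = setX setT (~: [set 0]).
  apply/setP => -[s r]; rewrite !inE /=; apply/imsetP/idP => [[x Bx [_ ->]]|nz].
    exact: borel_neq0.
  exists (torus r * upper (s / r))%g; first by rewrite groupM ?torus_borel ?upper_borel.
  rewrite /f !GL2_M !upperE !(torusE nz) ?simpr.
  by rewrite mulrC mulfVK.
by rewrite cardsX cardsT card_Fp // cardsC1 card_Fp.
Qed.

Lemma index_unip : #|B : P|%g = p.-1.
Proof.
apply/eqP; rewrite -(eqn_pmul2l (cardG_gt0 P)) Lagrange ?unip_sub_borel //.
by rewrite card_borel -orderE order_upper.
Qed.

Lemma point_decomp y : y \in G -> GLval y 1 0 != 0 ->
    let s := GLval y 0 0 / GLval y 1 0 in
  exists2 b, b \in B & y = (point s * b)%g /\ GLval b 0 0 = GLval y 1 0.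
Proof.
move=> Gy nz s; pose z := point s.
have Gz : z \in G := point_in _.
have zV := SL2_inv Gz; have E := pointE s.
exists (z^-1 * y)%g; last by rewrite mulKVg GL2_M !zV !E mul0r add0r opprK mul1r.
apply/borelP; split; first exact: SL2M (SL2V Gz) Gy.
by rewrite GL2_M !zV !E mulN1r mulfVK // addrC subrr.
Qed.

(** A nontrivial unipotent element fixes a single point of the projective line. *)
Lemma conj_upper_borel y s : y \in G -> y \notin B ->
  (y * upper s * y^-1)%g \in B -> s = 0.
Proof.
move=> Gy nBy /borelP[_]; have yV := SL2_inv Gy.
have nz : GLval y 1 0 != 0 by apply: contraNneq nBy => y10; apply/borelP.
rewrite !GL2_M !yV !upperE ?simpr mulrDl !mulrN (mulrC (GLval y 1 1)).
rewrite addrCA subrr addr0 => /eqP; rewrite oppr_eq0 !mulf_eq0 (negPf nz) /= orbF.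
by move/eqP.
Qed.

(** The right cosets of B in G are the points of the projective line. *)
Definition line_coset (o : option 'F_p) : {set GL} :=
  B :* (if o is Some s then (point s)^-1 else 1)%g.

Lemma line_coset_inj : injective line_coset.
Proof.
have neq s : (point s)^-1%g \notin B.
  apply/negP => /borelP[_]; rewrite (SL2_inv (point_in s)) pointE => /eqP.
  by rewrite oppr_eq0 oner_eq0.
move=> [s|] [t|] //; last 2 first.
- by move/rcoset_eqP; rewrite mem_rcoset invg1 mulg1 (negPf (neq _)).
- by move/esym/rcoset_eqP; rewrite mem_rcoset invg1 mulg1 (negPf (neq _)).
move/rcoset_eqP; rewrite mem_rcoset invgK => /borelP[_].
rewrite GL2_M !(SL2_inv (point_in s)) !pointE mulr1 mulN1r => /eqP.
by rewrite addrC subr_eq0 => /eqP->.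
Qed.

Lemma line_coset_im : line_coset @: setT = rcosets B G.
Proof.
apply/setP => C; apply/imsetP/rcosetsP => [[o _ ->]|[y Gy ->]].
  exists (if o is Some s then (point s)^-1 else 1)%g => //.
  by case: o => [s|]; [exact: SL2V (point_in s) | exact: group1].
have [y10|nz] := eqVneq (GLval y 1 0) 0.
  exists None; rewrite ?inE // /line_coset rcoset1 rcoset_id //.
  by apply/borelP.
have GyV : y^-1%g \in G := SL2V Gy.
have nzV : GLval y^-1%g 1 0 != 0 by rewrite !(SL2_inv Gy) oppr_eq0.
have [b Bb [def_y _]] := point_decomp GyV nzV.
set s := _ / _ in def_y; exists (Some s); rewrite ?inE //.
apply/rcoset_eqP; rewrite mem_rcoset invgK.
have -> : (y * point s = b^-1)%g by rewrite -[y in LHS]invgK def_y invMg mulgKV.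
by rewrite groupV.
Qed.

Lemma index_borel : #|G : B|%g = p.+1.
Proof.
rewrite /indexg -line_coset_im card_imset ?cardsT ?card_option ?card_Fp //.
exact: line_coset_inj.
Qed.

Lemma big_rcosets_borel (V : nmodType) (f : {set GL} -> V) :
  \sum_(C in rcosets B G) f C
    = f (B :* 1) + \sum_(s : 'F_p) f (B :* (point s)^-1).
Proof.
rewrite -line_coset_im big_imset /=; last by move=> ? ? _ _; apply: line_coset_inj.
rewrite (eq_bigl xpredT) => [|o]; last by rewrite inE.
rewrite (bigD1 None) //=; congr (_ + _).
rewrite (reindex_omap Some id) => [|[] //].
by apply: eq_bigl => s /=; rewrite eqxx.
Qed.

End SL2Elements.

Arguments upper {p} s%_R.
Arguments torus {p} r%_R.
Arguments point {p} s%_R.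

(** * The natural modules V_t *)

Section NaturalEntries.

Variables (F : fieldType) (p : nat) (charFp : p \in [pchar F]).
Local Notation emb := (Fp_emb charFp).

(** The specialization x = T, y = 1. *)
Definition dehomog : {mpoly F[2]} -> {poly F} :=
  mmap polyC (fun i : 'I_2 => if i == 0 then 'X else 1).

Lemma dehomogX t (i : 'I_t) : dehomog 'X_[V_monom i] = 'X^i.
Proof.
by rewrite /dehomog mmapX /mmap1 big_ord2 !mnmE /= expr1n mulr1.
Qed.

Lemma dehomog_coef t (f : {mpoly F[2]}) (k : 'I_t) :
  f \is t.-1.-homog -> (dehomog f)`_k = f@_(V_monom k).
Proof.
move=> homf; have t_gt0 : (0 < t)%N by case: t k {homf} => [[]|].
rewrite [in LHS](homog_expand t_gt0 homf) /dehomog raddf_sum coef_sum /=.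
rewrite (bigD1 k) //= big1 ?addr0 => [|i ne_ik].
  by rewrite mmapZ -/(dehomog _) dehomogX coefCM coefXn eqxx mulr1.
rewrite mmapZ -/(dehomog _) dehomogX coefCM coefXn.
by rewrite eq_sym (negPf (ne_ik : (i : nat) != k)) mulr0.
Qed.

Lemma dehomog_lin (M : 'M['F_p]_2) i :
  dehomog (tnth (lin_subst charFp M) i) = (emb (M i 0))%:P * 'X + (emb (M i 1))%:P.
Proof.
rewrite tnth_mktuple big_ord2 /dehomog raddfD /= !mmapZ !mmapX.
by rewrite /mmap1 !big_ord2 !mnmE /= !expr0 !expr1 !mul1r !mulr1.
Qed.

(** Dehomogenizing at y = 1: the rows of the matrix of g are the coefficient
    lists of (a T + b)^i (c T + d)^(t-1-i). *)
Lemma V_mxE t x (i k : 'I_t) :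
  V_mx charFp t x i k
    = (((emb (GLval x 0 0))%:P * 'X + (emb (GLval x 0 1))%:P) ^+ i
       * ((emb (GLval x 1 0))%:P * 'X + (emb (GLval x 1 1))%:P) ^+ (t.-1 - i))`_k.
Proof.
rewrite mxE -dehomog_coef; last exact: poly_act_homog.
rewrite /poly_act comp_mpolyX /dehomog rmorph_prod big_ord2 !rmorphXn /=.
by rewrite -!/(dehomog _) !dehomog_lin !mnmE.
Qed.

End NaturalEntries.

Section NaturalModules.

Variables (F : fieldType) (p : nat) (charFp : p \in [pchar F]).
Local Notation emb := (Fp_emb charFp).
Local Notation u1 := (upper (1%R : 'F_p)).
Let pr_p : prime p := pcharf_prime charFp.

Lemma coef_lin_exp (R : comNzRingType) (a b : R) n k :
  ((a%:P * 'X + b%:P) ^+ n)`_k = a ^+ k * b ^+ (n - k) *+ 'C(n, k).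
Proof.
rewrite addrC exprDn coef_sum.
under eq_bigr => i _.
  rewrite coefMn exprMn -!polyC_exp mulrA -polyCM coefCM coefXn.
  over.
have [le_kn|lt_nk] := leqP k n; last first.
  rewrite bin_small // mulr0n big1 // => i _.
  by rewrite gtn_eqF ?mulr0 ?mul0rn // (leq_ltn_trans _ lt_nk) // -ltnS.
rewrite (bigD1 (Ordinal (le_kn : (k < n.+1)%N))) //= eqxx mulr1 big1 ?addr0.
  by rewrite mulrC.
by move=> i; rewrite -val_eqE /= eq_sym => /negPf ->; rewrite mulr0 mul0rn.
Qed.

Lemma pchar_nat_neq0 k : (0 < k < p)%N -> k%:R != 0 :> F.
Proof.
case/andP=> k_gt0 lt_kp; rewrite -(dvdn_pcharf charFp).
by rewrite gtnNdvd.
Qed.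

Lemma pchar_bin_neq0 n k : (k <= n < p)%N -> 'C(n, k)%:R != 0 :> F.
Proof.
case/andP=> le_kn lt_np; rewrite -(dvdn_pcharf charFp); apply/negP => dvd_p.
have : (p %| n`!)%N by rewrite -(bin_fact le_kn) dvdn_mulr.
elim: n lt_np {le_kn dvd_p} => [|n IHn] lt_np.
  by rewrite fact0 Euclid_dvd1.
rewrite factS Euclid_dvdM // gtnNdvd //=.
by apply: IHn; apply: ltnW.
Qed.

Lemma emb_eq0 (s : 'F_p) : (emb s == 0) = (s == 0).
Proof. exact: fmorph_eq0. Qed.

Lemma upper1V : u1^-1%g = upper (-1).
Proof.
have Gu : u1 \in SL2 p by rewrite (subsetP (borel_sub p)) ?upper_borel.
by apply: GL2_eq; rewrite (SL2_inv Gu) !upperE ?oppr0.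
Qed.

Section Degree.

Variable d : nat.
Local Notation V := (V_repr charFp d.+1).
Local Notation Y := (aug u1 V).
Implicit Types (i k : 'I_d.+1) (w : 'rV[F]_d.+1).

Lemma V_torus r i k : r != 0 ->
  V (torus r) i k = (emb r ^+ i * emb r ^- (d - i)) *+ (i == k).
Proof.
move=> nz; rewrite /= V_mxE !(torusE nz) !rmorph0 fmorphV mul0r addr0 add0r.
rewrite exprMn -!polyC_exp mulrAC -polyCM coefCM coefXn eq_sym.
by rewrite -exprVn val_eqE mulr_natr.
Qed.

Lemma V_row0 x k : V x 0 k
  = emb (GLval x 1 0) ^+ k * emb (GLval x 1 1) ^+ (d - k) *+ 'C(d, k).
Proof. by rewrite /= V_mxE expr0 mul1r coef_lin_exp subn0. Qed.

Lemma V_last x i : V x i ord_max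
  = emb (GLval x 0 0) ^+ i * emb (GLval x 1 0) ^+ (d - i).
Proof.
rewrite /= V_mxE; set a := emb _; set b := emb _; set c := emb _; set e := emb _.
have sz (u v : F) n : (size (((u%:P * 'X) + v%:P) ^+ n) <= n.+1)%N.
  apply/leq_sizeP => j lt_nj; rewrite coef_lin_exp bin_small //.
have coefM_top (f g : {poly F}) m n : (size f <= m.+1)%N -> (size g <= n.+1)%N ->
    (f * g)`_(m + n) = f`_m * g`_n.
  move=> szf szg; have lt_m : (m < (m + n).+1)%N by rewrite ltnS leq_addr.
  rewrite coefM (bigD1 (Ordinal lt_m)) //= addKn big1 ?addr0 // => j.
  rewrite -val_eqE /= neq_ltn => /orP[lt_jm|lt_mj].
    by rewrite [g`__]nth_default ?mulr0 // (leq_trans szg) //; lia.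
  by rewrite [f`__]nth_default ?mul0r // (leq_trans szf).
have le_id : (i <= d)%N by rewrite -ltnS.
rewrite -[X in _`_X](subnKC le_id) coefM_top ?sz // !coef_lin_exp.
by rewrite !subnn !expr0 !binn !mulr1 !mulr1n.
Qed.

Lemma V_aug i k : Y i k =
  if (k < i)%N then (-1) ^+ (i - k) *+ 'C(i, k) else 0.
Proof.
have -> : Y i k = V (upper (-1)) i k - (i == k)%:R.
  by rewrite /aug upper1V; set A := V _; rewrite !mxE.
rewrite /= V_mxE !upperE !rmorph1 rmorph0 rmorphN1.
rewrite -polyC1 mul0r add0r polyC1 expr1n mulr1 -polyC1 coef_lin_exp expr1n mul1r.
case: ltngtP => [lt_ki|lt_ik|eq_ki].
- by rewrite -val_eqE /= (gtn_eqF lt_ki) subr0.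
- by rewrite bin_small // -val_eqE /= (ltn_eqF lt_ik) subr0.
by rewrite eq_ki binn subnn -val_eqE /= eq_ki eqxx subrr.
Qed.

(** Y lowers the degree in x, with leading coefficients that are invertible as
    long as the degree stays below p. *)
Lemma V_aug_step w m : (forall k, (m < k)%N -> w 0 k = 0) ->
  (forall k, (m <= k)%N -> (w *m Y) 0 k = 0) /\
  (forall k i, i = k.+1 :> nat -> i = m :> nat -> (w *m Y) 0 k = - w 0 i * m%:R).
Proof.
move=> w0; split=> [k le_mk|k i def_i def_m].
  rewrite mxE big1 // => j _; rewrite V_aug; case: ltnP => [lt_kj|]; last by rewrite mulr0.
  by rewrite w0 ?mul0r // (leq_ltn_trans le_mk).
rewrite mxE (bigD1 i) //= big1 ?addr0 => [|j].
  rewrite V_aug def_i leqnn -def_m def_i subSnn expr1 binSn -mulr_natr mulrA.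
  by rewrite mulrN1.
rewrite -val_eqE /= neq_ltn => /orP[lt_ji|lt_ij].
  by rewrite V_aug; case: ltnP => [|_]; rewrite ?mulr0 //; lia.
by rewrite w0 ?mul0r // -def_m.
Qed.

Lemma V_aug_depth w m : forall k, (d < k + m)%N -> (w *m Y ^+ m) 0 k = 0.
Proof.
elim: m => [|m IHm] k; first by rewrite addn0 ltnNge -ltnS ltn_ord.
rewrite exprSr mulmxA => lt_dk.
have w0 (j : 'I_d.+1) : (d - m < j)%N -> (w *m Y ^+ m) 0 j = 0 by move=> ?; apply: IHm; lia.
by have [H _] := V_aug_step w0; apply: H; lia.
Qed.

Hypothesis lt_dp : (d < p)%N.

Lemma V_aug_lead w m : (forall k, (m < k)%N -> w 0 k = 0) ->
    (forall i, i = m :> nat -> w 0 i != 0) ->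
  forall j, (j <= m)%N -> (m <= d)%N ->
    (forall k, (m - j < k)%N -> (w *m Y ^+ j) 0 k = 0) /\
    (forall i, i = (m - j)%N :> nat -> (w *m Y ^+ j) 0 i != 0).
Proof.
move=> w0 wm j le_jm le_md; elim: j le_jm => [|j IHj] lt_jm.
  by rewrite subn0 expr0 mulmx1.
have [wj0 wjm] := IHj (ltnW lt_jm); have [H1 H2] := V_aug_step wj0.
rewrite exprSr mulmxA; split=> [k lt_k|i def_i]; first by apply: H1; lia.
have lt_i1 : (i.+1 < d.+1)%N by lia.
rewrite (H2 i (Ordinal lt_i1)) //=; last by lia.
rewrite mulf_neq0 ?oppr_eq0 ?wjm //=; first by lia.
by apply: pchar_nat_neq0; lia.
Qed.

(** The monomials x^d and y^d. *)
Definition top_row : 'rV[F]_d.+1 := delta_mx 0 ord_max.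
Definition bot_row : 'rV[F]_d.+1 := delta_mx 0 0.

Lemma top_row_lead j : (j <= d)%N ->
    (forall k, (d - j < k)%N -> (top_row *m Y ^+ j) 0 k = 0) /\
    (forall i, i = (d - j)%N :> nat -> (top_row *m Y ^+ j) 0 i != 0).
Proof.
move=> le_jd; apply: V_aug_lead => // [k lt_dk|i def_i].
  by have := ltn_ord k; lia.
by rewrite mxE eqxx (_ : i = ord_max) ?eqxx ?oner_neq0 //; apply: val_inj.
Qed.

Lemma row_bot w : (forall k, (0 < k)%N -> w 0 k = 0) -> w = w 0 0 *: bot_row.
Proof.
move=> w0; apply/rowP => k; rewrite !mxE eqxx /=.
have [->|nz] := eqVneq k 0; first by rewrite mulr1.
by rewrite mulr0 w0 // lt0n.
Qed.

Lemma V_tower_full : row_full (tower Y d.+1 top_row).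
Proof.
have freeT : row_free (tower Y d.+1 top_row).
  apply: tower_free.
    by apply/rowP => k; rewrite V_aug_depth ?mxE //; lia.
  have [H1 H2] := top_row_lead (leqnn d).
  have -> : top_row *m Y ^+ d.+1.-1 = (top_row *m Y ^+ d) 0 0 *: bot_row.
    by apply: row_bot => k k_gt0; rewrite H1 // subnn.
  apply/row_freeP; exists (((top_row *m Y ^+ d) 0 0)^-1 *: bot_row^T).
  rewrite -scalemxAl -scalemxAr scalerA mulfV ?H2 ?subnn // scale1r.
  by rewrite /bot_row trmx_delta mul_delta_mx; apply/rowP => k; rewrite !mxE !ord1.
by rewrite /row_full -[X in _ == X]muln1 -[d.+1 in X in _ == X]card_ord -sum_nat_const (eqP freeT).
Qed.

(** The submodules of V for the unipotent subgroup are given by bounds on the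
    degree in x: the image of Y^m is cut out by the vanishing of the top m
    coordinates. *)
Lemma V_aug_image w m : (forall k, (d < k + m)%N -> w 0 k = 0) ->
  (w <= Y ^+ m)%MS.
Proof.
move=> w0; have [lt_dm|le_md] := ltnP d m.
  rewrite (_ : w = 0) ?sub0mx //; apply/rowP => k; rewrite w0 ?mxE //; lia.
have [q] : exists q, (q + m <= d.+1)%N /\ forall k, (q <= k)%N -> w 0 k = 0.
  by exists (d.+1 - m)%N; split=> [|k le_k]; [lia | apply: w0; lia].
elim: q w {w0} => [|q IHq] w [le_q w0].
  by rewrite (_ : w = 0) ?sub0mx //; apply/rowP => k; rewrite w0 ?mxE.
have lt_q : (q < d.+1)%N by lia.
have [H1 H2] := top_row_lead (leq_subr q d).
pose i := Ordinal lt_q; set u := top_row *m _ in H1 H2.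
have nz_u : u 0 i != 0 by apply: H2 => /=; lia.
have sub_u : (u <= Y ^+ m)%MS.
  have -> : u = top_row *m Y ^+ (d - q - m) *m Y ^+ m.
    by rewrite -mulmxA -[Y ^+ _ *m _]exprD subnK //; lia.
  exact: submxMl.
rewrite -[w](subrK ((w 0 i / u 0 i) *: u)) addmx_sub ?scalemx_sub //.
apply: IHq; split=> [|k le_qk]; first by lia.
rewrite -scaleNr; rewrite [LHS]mxE [X in _ + X]mxE mulNr.
have [->|ne_ki] := eqVneq k i; first by rewrite mulfVK ?subrr.
have lt_qk : (q < k)%N by rewrite ltn_neqAle le_qk eq_sym (ne_ki : (k : nat) != i).
by rewrite (w0 k) // (H1 k) ?mulr0 ?subrr //; lia.
Qed.

(** Powers of Y bring any nonzero vector down to a multiple of y^d, the Weyl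
    element exchanges y^d and x^d up to sign, and the powers of Y applied to
    x^d span the module. *)
Lemma V_irr : mx_irreducible V.
Proof.
apply/mx_irrP; split=> // U modU nzU.
have GU x : x \in SL2 p -> forall w, (w <= U)%MS -> (w *m V x <= U)%MS.
  move=> Gx w sw; apply: submx_trans (submxMr _ sw) _.
  exact: (mxmoduleP modU).
have GY w j : (w <= U)%MS -> (w *m Y ^+ j <= U)%MS.
  move=> sw; elim: j => [|j IHj]; first by rewrite expr0 mulmx1.
  rewrite exprSr mulmxA {2}/aug mulmxBr mulmx1 addmx_sub ?eqmx_opp // GU //.
  by rewrite groupV (subsetP (borel_sub p)) ?upper_borel.
have [w sw nzw] : exists2 w : 'rV[F]_d.+1, (w <= U)%MS & w != 0.
  by exists (nz_row U); rewrite ?nz_row_sub ?nz_row_eq0.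
have [i0 nzi0] : exists i, w 0 i != 0.
  apply/existsP; apply: contraNT nzw; rewrite negb_exists => /forallP w0.
  by apply/eqP/rowP => k; apply/eqP; rewrite mxE; have := w0 k; rewrite negbK.
case: (@arg_maxnP _ i0 (fun i => w 0 i != 0) val nzi0) => i nzi maxi.
have w0 k : (i < k)%N -> w 0 k = 0.
  by move=> lt_ik; apply: contraTeq lt_ik => /maxi /=; rewrite -leqNgt.
have wi k : k = i :> nat -> w 0 k != 0 by move/val_inj->.
have [H1 H2] := V_aug_lead w0 wi (leqnn i) (leq_ord i).
have s_bot : (bot_row <= U)%MS.
  have := GY w i sw; rewrite (@row_bot (w *m Y ^+ i)) => [|k k_gt0].
    by rewrite (eqmx_scale _ (H2 0 _)) //= subnn.
  by rewrite H1 // subnn.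
have s_top : (top_row <= U)%MS.
  have -> : top_row = bot_row *m V (point 0).
    rewrite -rowE; apply/rowP => k; rewrite [RHS]mxE V_row0 !pointE rmorph1 rmorph0.
    rewrite expr1n mul1r expr0n mxE eqxx -val_eqE /= subn_eq0.
    have := leq_ord k; rewrite leq_eqVlt => /orP[/eqP->|lt_kd].
      by rewrite eqxx leqnn binn.
    by rewrite ltn_eqF // leqNgt lt_kd /= mul0rn.
  exact: GU (point_in _) _ s_bot.
rewrite -sub1mx (submx_trans (_ : 1%:M <= tower Y d.+1 top_row)%MS) ?sub1mx ?V_tower_full //.
rewrite -[tower _ _ _]submxcolK; apply/row_subP => j.
have [k [l ->]] : exists k l, row j (\mxcol_k submxcol (tower Y d.+1 top_row) k)
    = row l (top_row *m Y ^+ (k : 'I_d.+1)).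
  by rewrite row_mxcol mxcolK; do 2!eexists.
exact: submx_trans (row_sub _ _) (GY _ _ s_top).
Qed.

End Degree.

End NaturalModules.

(** * Linear forms that are eigenvectors of the Borel subgroup *)

Section SimpleModules.

Variables (F : fieldType) (p : nat) (charFp : p \in [pchar F]).
Local Notation emb := (Fp_emb charFp).
Local Notation u1 := (upper (1%R : 'F_p)).
Local Notation G := (SL2 p).
Local Notation B := (borel p).
Let pr_p : prime p := pcharf_prime charFp.

Lemma Fp_expf (s : 'F_p) : s != 0 -> s ^+ p.-1 = 1.
Proof.
move=> nz; apply: (mulfI nz); rewrite mulr1 -exprS prednK ?prime_gt0 //.
by rewrite -[X in s ^+ X](card_Fp pr_p) expf_card.
Qed.

Lemma emb_expf (s : 'F_p) : s != 0 -> emb s ^+ p.-1 = 1.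
Proof. by move=> nz; rewrite -rmorphXn Fp_expf // rmorph1. Qed.

(** The sum is invariant under multiplication by a^k for every nonzero a, and
    some a^k differs from 1 unless k = 0 or k = p - 1. *)
Lemma sum_Fp_pow k : (k <= p.-1)%N ->
  \sum_(s : 'F_p) emb s ^+ k = if k == p.-1 then -1 else 0.
Proof.
have p_gt1 := prime_gt1 pr_p; move=> le_k.
under eq_bigr => s _ do rewrite -rmorphXn.
rewrite -rmorph_sum; have [->|ne_k] := eqVneq k p.-1.
  rewrite -(rmorphN1 emb); congr (emb _).
  rewrite (bigD1 0) //= expr0n (_ : (p.-1 == 0)%N = false) ?add0r; last by lia.
  rewrite (eq_bigr (fun=> 1)) => [|s nz]; last exact: Fp_expf.
  rewrite sumr_const; have -> : #|[pred i : 'F_p | i != 0]| = p.-1.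
    by rewrite cardC1 card_Fp.
  apply/eqP; rewrite -addr_eq0 -mulrSr prednK ?prime_gt0 //.
  by have /andP[] := pchar_Fp pr_p.
have lt_k : (k < p.-1)%N by rewrite ltn_neqAle ne_k.
rewrite (_ : \sum_s s ^+ k = 0) ?rmorph0 //.
have [->|k_gt0] := posnP k.
  by rewrite sumr_const card_Fp //; have /andP[_ /eqP] := pchar_Fp pr_p.
have [a nz_a ak1] : exists2 a : 'F_p, a != 0 & a ^+ k != 1.
  have : ~~ [forall a : 'F_p, (a != 0) ==> (a ^+ k == 1)].
    apply/negP => /forallP all1; move: lt_k; rewrite ltnNge => /negP; apply.
    have := @max_unity_roots _ k (enum [pred a : 'F_p | a != 0]) k_gt0.
    rewrite -cardE cardC1 card_Fp //; apply; last exact: enum_uniq.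
    apply/allP => a; rewrite mem_enum inE => nz.
    by apply/unity_rootP/eqP; apply: (implyP (all1 a)).
  by case/forallPn=> a; rewrite negb_imply => /andP[]; exists a.
apply: (mulfI (_ : a ^+ k - 1 != 0)); first by rewrite subr_eq0.
rewrite mulr0 mulrBl mul1r mulr_sumr.
rewrite [X in _ - X](reindex_inj (mulfI nz_a)) -sumrB big1 // => s _.
by rewrite exprMn subrr.
Qed.

Lemma card_roots_Fp (f : {poly F}) :
  (size f <= p)%N -> (forall s : 'F_p, f.[emb s] = 0) -> f = 0.
Proof.
move=> szf f0; apply: (@roots_geq_poly_eq0 _ f (map emb (enum 'F_p))).
- by apply/allP => _ /mapP[s _ ->]; apply/rootP.
- by rewrite map_inj_uniq ?enum_uniq //; apply: fmorph_inj.
by rewrite size_map -cardE card_Fp.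
Qed.

Section Functional.

Variables (n : nat) (rM : mx_representation F G n).

(** A linear form on M on which B acts through a character; these are the
    B-eigenvectors of the dual of M. *)
Definition eigenform c (f : 'cV[F]_n) :=
  forall x, x \in B -> rM x *m f = emb (GLval x 0 0) ^+ c *: f.

Lemma upper_fixed (f : 'cV[F]_n) :
  aug u1 rM *m f = 0 -> forall s, rM (upper s) *m f = f.
Proof.
move=> f0 s; have Gu : u1 \in G by rewrite (subsetP (borel_sub p)) ?upper_borel.
by have := aug_fixed Gu f0 s; rewrite -upperX.
Qed.

(** The p-group fixes a nonzero form, and the torus, being diagonalizable,
    acts on the fixed forms with an eigenvector. *)
Lemma eigenform_exists : (0 < n)%N ->
  exists c, [/\ (0 < c < p)%N & exists2 f, f != 0 & eigenform c f].
Proof.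
move=> n_gt0; have p_gt1 := prime_gt1 pr_p.
have sPG : <[u1]> \subset G.
  by apply: subset_trans (borel_sub p); rewrite unip_sub_borel.
pose Y := aug u1 (subg_repr rM sPG).
have exY : exists k, Y ^+ k == 0.
  by exists p; rewrite (aug_p charFp (order_upper pr_p)).
case: (ex_minnP exY) => m /eqP Ym0 minm.
have nzY : Y ^+ m.-1 != 0.
  case: m Ym0 minm => [|m] Ym0 minm; last by apply/negP => /minm; rewrite ltnn.
  rewrite -(mxrank_eq0 (_ : 'M_n)) expr0 in Ym0 *.
  by rewrite mxrank1 -lt0n.
have m_gt0 : (0 < m)%N.
  by case: m Ym0 nzY {minm} => // -> /eqP.
have /matrix0Pn[i [j nz_ij]] := nzY.
pose f1 := col j (Y ^+ m.-1).
have nz1 : f1 != 0 by apply/matrix0Pn; exists i, 0; rewrite mxE.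
have Y0 : aug u1 rM *m Y ^+ m.-1 = 0 by rewrite -[LHS]exprS prednK.
have fixU : forall s, rM (upper s) *m f1 = f1.
  by apply: upper_fixed; rewrite /f1 colE mulmxA Y0 mul0mx.
have GT s : s != 0 -> torus s \in G.
  by move=> nz; rewrite (subsetP (borel_sub p)) ?torus_borel.
have GU s : upper s \in G by rewrite (subsetP (borel_sub p)) ?upper_borel.
(* The components of f1 for the characters of the torus; their sum
   is a nonzero multiple of f1. *)
pose f c := \sum_(s : 'F_p | s != 0) emb s ^- c *: (rM (torus s) *m f1).
have eigf c : eigenform c (f c).
  move=> x Bx; have [def_x nz] := (borel_decomp Bx, borel_neq0 Bx).
  rewrite {1}def_x; set r := GLval x 0 0 in nz *; set t := _ * r.
  rewrite repr_mxM ?GU ?GT // -mulmxA.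
  have -> : rM (torus r) *m f c = emb r ^+ c *: f c.
    rewrite mulmx_sumr scaler_sumr (reindex_inj (mulfI (_ : r^-1 != 0))) ?invr_eq0 //=.
    apply: eq_big => [s|s]; first by rewrite mulf_eq0 invr_eq0 negb_or nz.
    rewrite mulf_eq0 invr_eq0 negb_or nz /= => nzs.
    rewrite -scalemxAr mulmxA -repr_mxM ?GT ?mulf_neq0 ?invr_eq0 //.
    rewrite -torusM ?mulf_neq0 ?invr_eq0 // mulrA divff // mul1r scalerA.
    by rewrite rmorphM fmorphV exprMn invfM exprVn invrK.
  rewrite -scalemxAr; congr (_ *: _); rewrite mulmx_sumr; apply: eq_bigr => s nzs.
  rewrite -scalemxAr mulmxA -repr_mxM ?GU ?GT // upper_torus //.
  by rewrite repr_mxM ?GU ?GT // -mulmxA fixU.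
have [c lt_c nzf] : exists2 c, (0 < c < p)%N & f c != 0.
  have : ~~ [forall c : 'I_p.-1, f c.+1 == 0].
    apply/negP => /forallP f0; case/eqP: nz1.
    have : \sum_(c < p.-1) f c.+1 = 0 by apply: big1 => c _; apply/eqP.
    rewrite exchange_big (bigD1 1) ?oner_eq0 //= [X in _ + X]big1 ?addr0 => [|s /andP[nzs ne1]].
      have -> : torus (1 : 'F_p) = 1%g.
        by apply: GL2_eq; rewrite (torusE (oner_neq0 _)) GL2_1 ?invr1.
      rewrite repr_mx1 mul1mx; under eq_bigr => c _ do rewrite rmorph1 expr1n invr1 scale1r.
      rewrite sumr_const card_ord -scaler_nat => /eqP; rewrite scaler_eq0 => /orP[|/eqP//].
      by rewrite (negPf (pchar_nat_neq0 charFp _)) //; lia.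
    rewrite -scaler_suml; set z := \sum_(c < _) _.
    suff -> : z = 0 by rewrite scale0r.
    have -> : z = (emb s)^-1 * \sum_(c < p.-1) (emb s)^-1 ^+ c.
      by rewrite mulr_sumr; apply: eq_bigr => c _; rewrite -exprVn exprS.
    apply: (mulfI (_ : (emb s)^-1 - 1 != 0)).
      rewrite subr_eq0 -(inj_eq invr_inj) invrK invr1 -(rmorph1 emb).
      by rewrite (inj_eq (fmorph_inj _)).
    by rewrite mulr0 mulrCA -subrX1 exprVn emb_expf // invr1 subrr mulr0.
  case/forallPn=> c nzf; exists c.+1 => //.
  by have := ltn_ord c; lia.
by exists c; split=> //; exists (f c).
Qed.

End Functional.

End SimpleModules.

(** * Nonzero modules map onto natural modules *)

Section Exhaustion.

Variables (F : fieldType) (p : nat) (charFp : p \in [pchar F]).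
Local Notation emb := (Fp_emb charFp).
Local Notation G := (SL2 p).
Local Notation B := (borel p).
Local Notation V d := (V_repr charFp d.+1).
Local Notation q := #|rcosets B G|.
Local Notation rep i := (@coset_rep _ B G i).
Let pr_p : prime p := pcharf_prime charFp.

(** The coefficient of x^d; it is the evaluation of a polynomial at (1, 0). *)
Definition last_col d : 'cV[F]_d.+1 := delta_mx ord_max 0.

Lemma V_last_col d x i : (V d x *m last_col d) i 0
  = emb (GLval x 0 0) ^+ i * emb (GLval x 1 0) ^+ (d - i).
Proof. by rewrite -colE mxE V_last. Qed.

Lemma last_col_form d : eigenform charFp (V d) d (last_col d).
Proof.
move=> x Bx; have [_ x10] := borelP _ Bx.
apply/colP => i; rewrite V_last_col x10 rmorph0 expr0n subn_eq0 !mxE eqxx andbT.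
have := leq_ord i; rewrite leq_eqVlt -val_eqE /= => /orP[/eqP->|lt_id].
  by rewrite leqnn eqxx.
by rewrite (ltn_eqF lt_id) leqNgt lt_id !mulr0.
Qed.

Lemma bot_row_borel d x : x \in B ->
  bot_row F d *m V d x = emb (GLval x 0 0) ^- d *: bot_row F d.
Proof.
move=> Bx; have [_ x10] := borelP _ Bx.
apply/rowP => k; rewrite -rowE [LHS]mxE V_row0 x10 rmorph0 expr0n !mxE eqxx /=.
rewrite borel_11 // fmorphV exprVn; have [->|nz] := eqVneq k 0.
  by rewrite subn0 bin0 mul1r mulr1.
by rewrite -[(k : nat) == 0%N]/(k == 0) (negPf nz) mul0r mulr0 mul0rn.
Qed.

Lemma rtrace_borel n m (rM : mx_representation F G n)
    (rN : mx_representation F G m) f :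
    mx_hom (subg_repr rM (borel_sub p)) (subg_repr rN (borel_sub p)) f ->
  rtrace B G rM rN f
    = f + \sum_(s : 'F_p) rM (point s) *m f *m rN (point s)^-1%g.
Proof.
move=> homf; rewrite /rtrace big_rcosets_borel (rtrace_repr homf (group1 G)).
rewrite invg1 !repr_mx1 mul1mx mulmx1; congr (_ + _); apply: eq_bigr => s _.
exact: rtrace_reprV homf (point_in s).
Qed.

(** The values of a form of weight c are those at representatives of the cosets,
    up to scalars that are the same for all modules. *)
Lemma form_coset c z : z \in G -> exists i a, forall n
  (rM : mx_representation F G n) f, eigenform charFp rM c f ->
  rM z *m f = a *: (rM (rep i)^-1%g *m f).
Proof.
move=> Gz; have GzV : z^-1%g \in G by rewrite groupV.
have Cz : B :* z^-1 \in rcosets B G by apply/rcosetsP; exists z^-1%g.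
have def_i := enum_rankK_in Cz Cz; set i := enum_rank_in Cz _ in def_i.
pose b := (rep i * z)%g.
have Bb : b \in B.
  by rewrite /b -[z]invgK -mem_rcoset -def_i -rcoset_coset_rep ?borel_sub ?rcoset_refl.
exists i, (emb (GLval b 0 0) ^+ c) => n rM f eigf.
have -> : z = ((rep i)^-1 * b)%g by rewrite mulKg.
rewrite repr_mxM ?groupV ?coset_rep_in ?borel_sub ?(subsetP (borel_sub p)) //.
by rewrite -mulmxA eigf // -scalemxAr.
Qed.

Lemma row_coset d z : z \in G -> exists i a,
  bot_row F d *m V d z = a *: (bot_row F d *m V d (rep i)).
Proof.
move=> Gz; have Cz : B :* z \in rcosets B G by apply/rcosetsP; exists z.
have def_i := enum_rankK_in Cz Cz; set i := enum_rank_in Cz _ in def_i.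
pose b := (z * (rep i)^-1)%g.
have Bb : b \in B.
  by rewrite coset_rep_mem ?borel_sub // def_i.
exists i, (emb (GLval b 0 0) ^- d).
have {1}-> : z = (b * rep i)%g by rewrite mulgKV.
rewrite repr_mxM ?coset_rep_in ?borel_sub ?(subsetP (borel_sub p)) //.
by rewrite mulmxA bot_row_borel // -scalemxAl.
Qed.

(** The values of a form at the points of the projective line: M is mapped to
    functions on the line, homogeneous of some degree. *)
Definition values n (rM : mx_representation F G n) (f : 'cV[F]_n) : 'M[F]_(n, q) :=
  \matrix_(k, i) (rM (rep i)^-1%g *m f) k 0.

(** Functions on the line are paired with the orbit of y^d, which consists of
    the dth powers of linear forms. *)
Definition covalues d : 'M[F]_(q, d.+1) :=
  \matrix_(i, l) (bot_row F d *m V d (rep i)) 0 l.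

Lemma values_covalues n (rM : mx_representation F G n) f d :
  values rM f *m covalues d = rtrace B G rM (V d) (f *m bot_row F d).
Proof.
apply/matrixP => k l; rewrite mxE summxE.
rewrite -(@sum_coset_rep _ B G _
  (fun x => (rM x^-1%g *m (f *m bot_row F d) *m V d x) k l)).
apply: eq_bigr => i _; rewrite [values _ _ _ _]mxE [covalues _ _ _]mxE.
by rewrite mulmxA -(mulmxA (_ *m f)) [RHS]mxE big_ord1.
Qed.

(** A polynomial of degree d < p is determined by its values at the points
    (s, 1). *)
Lemma values_free d : (d < p)%N -> row_free (values (V d) (last_col d)).
Proof.
move=> lt_dp; apply/inj_row_free => u u0.
have uV z : z \in G -> u *m V d z *m last_col d = 0.
  move=> Gz; have [i [a def_z]] := form_coset d Gz.
  rewrite -mulmxA def_z; last exact: last_col_form.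
  rewrite -scalemxAr (_ : u *m _ = 0) ?scaler0 //.
  apply/rowP => j; have /matrixP/(_ 0 i) := u0.
  rewrite !mxE !ord1 => {2}<-; apply: eq_bigr => k _.
  by rewrite [in RHS]mxE.
pose f := \poly_(i < d.+1) u 0 (inord i).
have f0 : f = 0.
  apply: (card_roots_Fp (charFp := charFp)) => [|s]; first exact: leq_trans (size_poly _ _) lt_dp.
  have /matrixP/(_ 0 0) := (uV _ (point_in s)).
  rewrite -mulmxA mxE [RHS]mxE => <-; rewrite horner_poly; apply: eq_bigr => i _.
  by rewrite V_last_col !pointE rmorph1 expr1n mulr1 inord_val.
apply/rowP => i; rewrite mxE; have := coef0 F i; rewrite -f0 coef_poly ltn_ord.
by rewrite inord_val.
Qed.

(** The powers (s x + y)^d span V_(d+1): a form that kills them is a polynomial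
    of degree d in s that vanishes on F_p, and the binomial coefficients in
    front of its coefficients are invertible. *)
Lemma covalues_rank d : (d < p)%N -> \rank (covalues d) = d.+1.
Proof.
move=> lt_dp; rewrite -mxrank_tr; apply/eqP; apply/inj_row_free => u u0.
pose w := u^T; have Rw : covalues d *m w = 0.
  by rewrite -[LHS]trmxK trmx_mul /w trmxK u0 trmx0.
have Vw z : z \in G -> bot_row F d *m V d z *m w = 0.
  move=> Gz; have [i [a ->]] := row_coset d Gz.
  rewrite -scalemxAl (_ : _ *m w = 0) ?scaler0 //.
  apply/rowP => j; have /matrixP/(_ i j) := Rw.
  rewrite !mxE => {2}<-; apply: eq_bigr => k _.
  by rewrite [covalues _ _ _]mxE !ord1.
pose f := \poly_(k < d.+1) (w (inord k) 0 *+ 'C(d, k)).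
have f0 : f = 0.
  apply: (card_roots_Fp (charFp := charFp)) => [|s]; first exact: leq_trans (size_poly _ _) lt_dp.
  have det1 : 1 * 1 - 0 * s = 1 by rewrite mul0r subr0 mulr1.
  have /matrixP/(_ 0 0) := (Vw _ (gl2_SL2 det1)).
  rewrite mxE [RHS]mxE => <-; rewrite horner_poly; apply: eq_bigr => k _.
  rewrite -rowE [(row _ _) _ _]mxE V_row0 !(gl2E det1) rmorph1 expr1n mulr1 inord_val.
  by rewrite !mulrnAl mulrC.
apply/rowP => k; rewrite mxE; have := coef0 F k; rewrite -f0 coef_poly ltn_ord.
rewrite inord_val -mulr_natr mxE => /eqP; rewrite mulf_eq0.
rewrite (negPf (pchar_bin_neq0 charFp _)) ?orbF //; last by rewrite leq_ord.
by move/eqP.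
Qed.

Lemma form_row_hom n (rM : mx_representation F G n) f c d :
    eigenform charFp rM c f -> (c + d = p.-1)%N ->
  mx_hom (subg_repr rM (borel_sub p)) (subg_repr (V d) (borel_sub p))
    (f *m bot_row F d).
Proof.
move=> eigf cd x Bx; rewrite /= mulmxA eigf // -mulmxA bot_row_borel //.
rewrite -scalemxAl -scalemxAr; congr (_ *: _).
have nz : emb (GLval x 0 0) ^+ d != 0 by rewrite expf_neq0 // emb_eq0 borel_neq0.
by apply: (mulIf nz); rewrite mulVf // -exprD cd emb_expf // borel_neq0.
Qed.

(** Evaluation and pairing compose to zero because the sum over F_p of a
    monomial of degree less than p - 1 vanishes. *)
Lemma values_pairing c d : (c + d = p.-1)%N ->
  values (V c) (last_col c) *m covalues d = 0.
Proof.
move=> cd; rewrite values_covalues rtrace_borel; last first.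
  exact: form_row_hom (last_col_form _) cd.
apply/matrixP => i k; rewrite mxE summxE [RHS]mxE.
have -> : (last_col c *m bot_row F d) i k = ((i == c :> nat) && (k == 0))%:R.
  by rewrite /last_col /bot_row mul_delta_mx mxE -val_eqE.
under eq_bigr => s _.
  rewrite mulmxA -(mulmxA (_ *m last_col _)) mxE big_ord1 V_last_col.
  rewrite -rowE [(row _ _) _ _]mxE V_row0 !(SL2_inv (point_in s)) !pointE.
  rewrite rmorph1 expr1n mulr1 rmorphN1 -mulrnAl mulrA mulrAC -exprD.
  over.
rewrite -mulr_suml (sum_Fp_pow charFp); last by have := leq_ord i; lia.
have [->|ne_k] := eqVneq k 0.
  rewrite andbT subn0 bin0 expr0 mulr1 -cd eqn_add2r.
  by case: eqP; rewrite ?addrN ?addr0.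
rewrite andbF ifF ?mul0r ?addr0 //; apply/negbTE.
have : (0 < k)%N by rewrite lt0n.
by have := leq_ord i; have := leq_ord k; lia.
Qed.

(** Every nonzero module has a nonzero map to some natural module. A form of
    weight c gives a map from M to functions on the projective line; either its
    composite with the pairing, which lands in V_(p - c), is nonzero, or its
    image lies in the kernel of the pairing, which is V_(c + 1). *)
Lemma natural_quotient n (rM : mx_representation F G n) : (0 < n)%N ->
  exists d, (d < p)%N /\ exists2 h, h != 0 & mx_hom rM (V d) h.
Proof.
case/(eigenform_exists charFp rM) => c [/andP[c_gt0 lt_cp] [f nzf eigf]].
pose d := (p.-1 - c)%N; have cd : (c + d = p.-1)%N by rewrite /d; lia.
have lt_dp : (d < p)%N by lia.
have homA := rtrace_hom (form_row_hom eigf cd).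
have [A0 | nzA] := eqVneq (rtrace B G rM (V d) (f *m bot_row F d)) 0; last first.
  by exists d; split=> //; exists (rtrace B G rM (V d) (f *m bot_row F d)).
have sub_f : (values rM f <= values (V c) (last_col c))%MS.
  have sub1 : (values rM f <= kermx (covalues d))%MS.
    by apply/sub_kermxP; rewrite values_covalues.
  apply: submx_trans sub1 _.
  have sub_c : (values (V c) (last_col c) <= kermx (covalues d))%MS.
    exact/sub_kermxP/values_pairing.
  rewrite -(geq_leqif (mxrank_leqif_sup sub_c)) mxrank_ker covalues_rank //.
  rewrite (eqP (values_free lt_cp)) -[q]/(#|G : B|%g) index_borel //.
  by lia.
have [h def_f] := submxP sub_f.
have hV z : z \in G -> h *m V c z *m last_col c = rM z *m f.
  move=> Gz; have [i [a def_z]] := form_coset c Gz.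
  rewrite (def_z _ _ _ eigf) -mulmxA (def_z _ _ _ (last_col_form _)) -scalemxAr.
  congr (_ *: _); apply/colP => k; have /matrixP/(_ k i) := def_f.
  rewrite mxE => ->; rewrite !mxE; apply: eq_bigr => j _.
  by rewrite [in RHS]mxE.
exists c; split=> //; exists h.
  apply: contraNneq nzf => h0; have := hV 1%g (group1 _).
  by rewrite h0 !mul0mx repr_mx1 mul1mx => <-.
move=> y Gy; apply/eqP; rewrite -subr_eq0; apply/eqP.
apply: (row_free_inj (values_free lt_cp)); rewrite mul0mx.
apply/matrixP => k i; rewrite [RHS]mxE.
have Gi : (rep i)^-1%g \in G by rewrite groupV coset_rep_in ?borel_sub.
have -> : ((rM y *m h - h *m V c y) *m values (V c) (last_col c)) k i
    = ((rM y *m h - h *m V c y) *m (V c (rep i)^-1%g *m last_col c)) k 0.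
  by rewrite !mxE; apply: eq_bigr => j _; rewrite [values _ _ _ _]mxE.
rewrite mulmxA !mulmxBl -!mulmxA (mulmxA h) hV // [V c y *m _]mulmxA -repr_mxM //.
by rewrite (mulmxA h) hV ?groupM // mulmxA -repr_mxM // subrr mxE.
Qed.

End Exhaustion.

(** * Projective covers of simple modules *)

Section Covers.

Variables (F : closedFieldType) (gT : finGroupType) (G : {group gT}).
Local Notation reprG := (mx_representation F G).

Lemma traced_projective n (rM : reprG n) : traced rM -> mx_projective rM.
Proof. by case=> h /gtrace_projective. Qed.

Lemma traced_biproductr n nA nB (rM : reprG n) (rA : reprG nA) (rB : reprG nB) :
  biproduct rM rA rB -> traced rM -> traced rB.
Proof.
case=> iA [qA [iB [qB [[hiA hqA hiB hqB] A1 B1 AB1]]]].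
exact: traced_summand hiB hqB B1.
Qed.

Lemma irr_surj n m (rM : reprG n) (rN : reprG m) f :
  mx_irreducible rN -> mx_hom rM rN f -> f != 0 -> row_full f.
Proof.
move=> /mx_irrP[_ irrN] homf nz; have := irrN <<f>>%MS.
rewrite (eqmx_module _ (genmxE f)) /row_full genmxE; apply; last first.
  by rewrite -mxrank_eq0 genmxE mxrank_eq0.
by rewrite -[f]mul1mx; apply: mx_hom_im homf (mxmodule1 _).
Qed.

Section OneCover.

Variables (n : nat) (rP : reprG n) (m : nat) (rN : reprG m).
Hypotheses (irrN : mx_irreducible rN) (coverP : projective_cover rP rN).

(** A map t into P whose composite with the covering map is nonzero is onto,
    the kernel of the latter being superfluous; it splits as P is projective. *)
Lemma cover_split k (rM : reprG k) t f :
    mx_hom rP rN f -> (forall W : 'M_n, mxmodule rP W -> row_full (W *m f) -> row_full W) ->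
    mx_hom rM rP t -> t *m f != 0 ->
  exists K : representation F G, biproduct rM rP K.
Proof.
move=> homf supf homt nz; have homg := mx_homM homt homf.
have fullt : row_full t.
  have := supf <<t>>%MS; rewrite (eqmx_module _ (genmxE t)) /row_full genmxE.
  apply; first by rewrite -[t]mul1mx; apply: mx_hom_im homt (mxmodule1 _).
  rewrite (eqmxMr f (genmxE t)); exact: irr_surj irrN homg nz.
have [s homs st] := coverP.1 _ _ _ _ _ _ homt fullt (mx_hom1 rP).
exact: biproduct_split homs homt st.
Qed.

Lemma projective_summand k (rM : reprG k) g :
    traced rM -> mx_hom rM rN g -> g != 0 ->
  exists K : representation F G, biproduct rM rP K.
Proof.
move=> trM homg nz; have [_ [f [homf fullf supf]]] := coverP.
have [t homt tf] := traced_projective trM homf fullf homg.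
by apply: (cover_split homf supf homt); rewrite tf.
Qed.

(** A nonzero map to a simple module that factors through a projective module
    exhibits the projective cover of its target as a summand of its source. *)
Lemma gtrace_summand_cover k (rM : reprG k) h :
  gtrace G rM rN h != 0 -> exists K : representation F G, biproduct rM rP K.
Proof.
move=> nz; have [_ [f [homf /row_fullP[s sf] supf]]] := coverP.
apply: (cover_split homf supf (gtrace_hom _ _ (h *m s))).
by rewrite -[_ *m f]mul1mx mulmxA (gtraceM _ (mx_hom1 _) homf) mul1mx -mulmxA sf mulmx1.
Qed.

Lemma cover_degree : (0 < n)%N.
Proof.
have [_ [f [_ fullf _]]] := coverP; have /mx_irrP[m_gt0 _] := irrN.
by apply: leq_trans m_gt0 _; rewrite -(eqP fullf) rank_leq_row.
Qed.

(** The kernel of the covering map f is the largest proper submodule of P, so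
    that a nonzero map from P to a simple module is f followed by an
    isomorphism. *)
Lemma cover_factor m' (rN' : reprG m') f g :
    mx_irreducible rN' -> mx_hom rP rN f ->
    (forall W : 'M_n, mxmodule rP W -> row_full (W *m f) -> row_full W) ->
    f != 0 -> mx_hom rP rN' g -> g != 0 ->
  exists s, [/\ f = g *m s, mx_hom rN' rN s & m' = m].
Proof.
move=> irrN' homf supf nzf homg nzg.
have /row_fullP[g' g'g] := irr_surj irrN' homg nzg.
have kerf : kermx g *m f = 0.
  apply: contraNeq nzg => nz; have modK := mx_hom_kermx homg.
  have : row_full (kermx g).
    apply: supf => //; case/mx_irrP: irrN => _ /(_ <<kermx g *m f>>%MS).
    rewrite (eqmx_module _ (genmxE _)) /row_full genmxE; apply.
      exact: mx_hom_im homf modK.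
    by rewrite -mxrank_eq0 genmxE mxrank_eq0.
  by case/row_fullP=> u uk; rewrite -[g]mul1mx -uk -mulmxA mulmx_ker mulmx0.
have fE : f = g *m (g' *m f).
  apply/eqP; rewrite eq_sym -subr_eq0 mulmxA -[X in _ - X]mul1mx -mulmxBl.
  have /submxP[u ->] : (g *m g' - 1%:M <= kermx g)%MS.
    by apply/sub_kermxP; rewrite mulmxBl mul1mx -mulmxA g'g mulmx1 subrr.
  by rewrite -mulmxA kerf mulmx0.
have homs : mx_hom rN' rN (g' *m f).
  move=> x Gx; rewrite -[LHS]mul1mx -g'g -[LHS]mulmxA (mulmxA g) -homg //.
  by rewrite -(mulmxA _ g) -fE homf // mulmxA.
have nzs : g' *m f != 0 by apply: contraNneq nzf => s0; rewrite fE s0 mulmx0.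
exists (g' *m f); split=> //; have fulls := irr_surj irrN homs nzs.
have kers : kermx (g' *m f) == 0.
  apply/negPn/negP => nzk; case/mx_irrP: irrN' => _ /(_ (kermx (g' *m f))).
  move/(_ (mx_hom_kermx homs) nzk)/row_fullP=> [u uk].
  by case/eqP: nzs; rewrite -[LHS]mul1mx -uk -mulmxA mulmx_ker mulmx0.
rewrite kermx_eq0 in kers.
by rewrite -(eqP fulls) (eqP kers).
Qed.

Lemma cover_nz f : row_full (f : 'M[F]_(n, m)) -> f != 0.
Proof.
have /mx_irrP[m_gt0 _] := irrN; rewrite /row_full.
by apply: contraTneq => ->; rewrite mxrank0 eq_sym -lt0n.
Qed.

(** The dimension suffices to tell the simple modules V_1, ..., V_p apart. *)
Lemma cover_homs_neq m' (rN' : reprG m') :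
  mx_irreducible rN' -> m' != m -> \dim (homs rP rN') = 0%N.
Proof.
move=> irrN' neq; apply: homs_dim_eq0 => g homg.
have [_ [f [homf fullf supf]]] := coverP.
apply: contraNeq neq => nzg.
by have [s [_ _ ->]] := cover_factor irrN' homf supf (cover_nz fullf) homg nzg.
Qed.

(** Schur's lemma. *)
Lemma cover_homs : \dim (homs rP rN) = 1%N.
Proof.
have [_ [f [homf fullf supf]]] := coverP; have nzf := cover_nz fullf.
rewrite (_ : homs rP rN = <[f]>%VS) ?dim_vline ?nzf //.
apply/eqP; rewrite eqEsubv -memvE; apply/andP; split; last exact/homsP.
apply/subvP => g /homsP homg; have [->|nzg] := eqVneq g 0; first exact: mem0v.
have [s [def_f homs_s _]] := cover_factor irrN homf supf nzf homg nzg.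
have absN : mx_absolutely_irreducible rN.
  exact: (@group_closure_closed_field F gT G).
have /is_scalar_mxP[a def_s] : is_scalar_mx s.
  apply: mx_abs_irr_cent_scalar absN _ _.
  by apply/centgmxP => x Gx; rewrite homs_s.
apply/vlineP; exists a^-1; rewrite def_f def_s mul_mx_scalar scalerA.
have [a0|nza] := eqVneq a 0; last by rewrite mulVf // scale1r.
by case/eqP: nzf; rewrite def_f def_s a0 mul_mx_scalar scale0r.
Qed.

End OneCover.

(** An indecomposable module mapping onto a simple module through a projective
    module is a projective cover, hence projective. *)
Lemma indecomposable_gtrace n (rP : reprG n) m (rN : reprG m) k (rV : reprG k) h :
    mx_irreducible rN -> projective_cover rP rN ->
    mx_indecomposable rV -> ~ mx_projective rV ->
  gtrace G rV rN h = 0.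
Proof.
move=> irrN coverP [k_gt0 indV] nprojV; apply/eqP; apply: contraT => nz.
have [K biV] := gtrace_summand_cover irrN coverP nz; case: nprojV.
have n_gt0 := cover_degree irrN coverP.
case: biV => iP [qP [iK [qK [[hiP hqP hiK hqK] P1 K1 PK1]]]].
have [PKo KPo] := biproduct_ortho P1 K1 PK1.
have modP : mxmodule rV <<iP>>%MS.
  rewrite (eqmx_module _ (genmxE iP)) -[iP]mul1mx.
  exact: mx_hom_im hiP (mxmodule1 _).
have modK : mxmodule rV <<iK>>%MS.
  rewrite (eqmx_module _ (genmxE iK)) -[iK]mul1mx.
  exact: mx_hom_im hiK (mxmodule1 _).
have [] := indV _ _ modP modK.
- apply/eqmxP; rewrite submx1 sub1mx -sub1mx -PK1 addmx_sub_adds //.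
    by rewrite genmxE submxMl.
  by rewrite genmxE submxMl.
- apply/eqP; rewrite -submx0; apply/rV_subP => u.
  rewrite sub_capmx !genmxE => /andP[/submxP[v def_u] /submxP[w def_w]].
  have uP : u *m qP = 0 by rewrite def_w -mulmxA KPo mulmx0.
  have uK : u *m qK = 0 by rewrite def_u -mulmxA PKo mulmx0.
  by rewrite submx0 -[u]mulmx1 -PK1 mulmxDr !mulmxA uP uK !mul0mx addr0.
- move/eqP; rewrite -mxrank_eq0 genmxE => /eqP rk0.
  have : row_free iP by apply/row_freeP; exists qP.
  by rewrite /row_free rk0 eq_sym => /eqP n0; rewrite n0 in n_gt0.
move/eqP; rewrite -mxrank_eq0 genmxE mxrank_eq0 => /eqP iK0.
have qPi : qP *m iP = 1%:M by rewrite -PK1 iK0 mulmx0 addr0.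
move=> m' k' rN1 rN2 f g homf fullf homg.
have [t homt tf] := coverP.1 _ _ _ _ _ _ homf fullf (mx_homM hiP homg).
exists (qP *m t); first exact: mx_homM hqP homt.
by rewrite -mulmxA tf mulmxA qPi mul1mx.
Qed.

End Covers.

(** * The decomposition of a projective module *)

Section Decomposition.

Variables (F : closedFieldType) (p : nat) (charFp : p \in [pchar F]).
Variable P : nat -> representation F (SL2 p).
Hypothesis coverP : forall i : nat, (1 <= i <= p)%N ->
  projective_cover (P i) (V_repr charFp i).
Local Notation grepr := (representation F (SL2 p)).
Local Notation V := (V_repr charFp).

Lemma V_repr_irr i : (1 <= i <= p)%N -> mx_irreducible (V i).
Proof. by case: i => // d /= lt_dp; apply: V_irr. Qed.

Lemma homs_cover i j : (1 <= i <= p)%N -> (1 <= j <= p)%N ->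
  \dim (homs (P i) (V j)) = (i == j).
Proof.
move=> ip jp; have [<-|ne_ij] := eqVneq i j.
  exact: cover_homs (V_repr_irr ip) (coverP ip).
by apply: (cover_homs_neq (V_repr_irr ip) (coverP ip) (V_repr_irr jp)); rewrite eq_sym.
Qed.

(** Split off copies of P_i as long as there are maps to V_i. *)
Lemma split_power i (Q : grepr) : (1 <= i <= p)%N -> traced Q ->
  exists k (Q' : grepr), [/\ mx_rsim Q (dadd_grepr (muln_grepr (P i) k) Q'),
    traced Q', \dim (homs Q' (V i)) = 0%N
    & forall j, (\dim (homs Q' (V j)) <= \dim (homs Q (V j)))%N].
Proof.
move=> ip; have [m] := ubnP (rdegree Q); elim: m Q => // m IHm Q lt_m trQ.
have [h0|nz] := eqVneq (\dim (homs Q (V i))) 0%N.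
  exists 0%N, Q; split=> //; rewrite /muln_grepr big_ord0.
  exact/biproduct_rsim/biproduct0/mx_rsim_refl.
have [g homg nzg] : exists2 g, mx_hom Q (V i) g & g != 0.
  exists (vpick (homs Q (V i))); first exact/homsP/memv_pick.
  by rewrite vpick0 -dimv_eq0.
have [K biK] := projective_summand (V_repr_irr ip) (coverP ip) trQ homg nzg.
have degQ := biproduct_degree (biK : biproduct Q (P i) K).
have degP := cover_degree (V_repr_irr ip) (coverP ip).
have lt_K : (rdegree K < m)%N by lia.
have [k [Q' [simK trQ' homQ' leQ']]] := IHm K lt_K (traced_biproductr biK trQ).
exists k.+1, Q'; split=> // [|j]; last first.
  by rewrite (homs_dim_biproduct _ biK) (leq_trans (leQ' j)) ?leq_addl.
have /biproduct_rsim := biproduct_trans biK ((biproduct_rsim _ _ _).2 simK).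
rewrite /muln_grepr big_ord_recl.
by case: (P i) => ? ?; case: (\big[_/_]_(_ < _) _).
Qed.

(** A projective module is the sum of the covers of the simple modules in its
    head; the multiplicity is the number of independent maps to each of them. *)
Lemma projective_decomposition (Q : grepr) : traced Q ->
  mx_rsim Q (\big[@dadd_grepr F _ (SL2 p)/@grepr0 F _ (SL2 p)]_(1 <= i < p.+1)
    muln_grepr (P i) (\dim (homs Q (V i)))).
Proof.
(* First some multiplicities, found by splitting off the covers one i at a time;
   counting maps to V_i identifies them afterwards. *)
pose sum (s : seq nat) n := \big[@dadd_grepr F _ (SL2 p)/@grepr0 F _ (SL2 p)]_(i <- s)
  muln_grepr (P i) (n i).
have exn s : uniq s -> (forall i, i \in s -> 1 <= i <= p)%N -> forall Q : grepr,
    traced Q -> (forall j, (1 <= j <= p)%N -> j \notin s -> \dim (homs Q (V j)) = 0%N) ->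
    exists n, mx_rsim Q (sum s n).
  elim: s => [_ _ | i s IHs /= /andP[nis us] sp] {}Q trQ homQ0.
    exists (fun=> 0%N); rewrite /sum big_nil.
    have [Q0|Q_gt0] := posnP (rdegree Q).
      exists 0 => // [|x _]; first by rewrite /row_free mxrank0 Q0.
      by rewrite mulmx0 mul0mx.
    have [d [lt_dp [h nzh homh]]] := natural_quotient charFp Q Q_gt0.
    by rewrite (homs_dim0 (homQ0 d.+1 lt_dp isT) homh) eqxx in nzh.
  have ip : (1 <= i <= p)%N by rewrite sp ?mem_head.
  have [k [Q' [simQ trQ' homQ' leQ']]] := split_power ip trQ.
  have [j s_j||n simQ'] := IHs us _ Q' trQ'.
  - by rewrite sp // inE s_j orbT.
  - move=> j jp njs; have [->//|ne_ji] := eqVneq j i.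
    apply/eqP; rewrite -leqn0 (leq_trans (leQ' j)) // homQ0 //.
    by rewrite inE negb_or ne_ji.
  exists (fun j => if j == i then k else n j); rewrite /sum big_cons eqxx.
  rewrite (eq_big_seq (fun j => muln_grepr (P j) (n j))) => [|j s_j]; last first.
    by have /negPf-> : j != i by apply: contraNneq nis => <-.
  apply/biproduct_rsim; apply: biproduct_eqr simQ'.
  exact/biproduct_rsim.
move=> trQ; have [n simQ] : exists n, mx_rsim Q (sum (index_iota 1 p.+1) n).
  apply: exn trQ _ => [|i|j jp]; first exact: iota_uniq.
    by rewrite mem_index_iota.
  by rewrite mem_index_iota ltnS jp.
suff n_def i : i \in index_iota 1 p.+1 -> \dim (homs Q (V i)) = n i.
  have eqS : sum (index_iota 1 p.+1) (fun i => \dim (homs Q (V i)))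
      = sum (index_iota 1 p.+1) n.
    by apply: eq_big_seq => i /n_def->.
  change (mx_rsim Q (sum (index_iota 1 p.+1) (fun i => \dim (homs Q (V i))))).
  by rewrite eqS.
move=> i_in; have ip : (1 <= i <= p)%N by move: i_in; rewrite mem_index_iota ltnS.
rewrite (homs_dim_rsim _ simQ) homs_dim_sum (bigD1_seq i) ?iota_uniq //=.
rewrite homs_dim_muln homs_cover // eqxx muln1 big_seq_cond big1 ?addn0 // => j.
rewrite mem_index_iota ltnS => /andP[jp ne_ji].
by rewrite homs_dim_muln homs_cover // (negPf ne_ji) muln0.
Qed.

End Decomposition.

(** * Uniserial modules of the Borel subgroup *)

Section Uniserial.

Variables (F : fieldType) (p : nat) (charFp : p \in [pchar F]).
Local Notation emb := (Fp_emb charFp).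
Local Notation u1 := (upper (1%R : 'F_p)).
Local Notation B := (borel p).
Let pr_p : prime p := pcharf_prime charFp.

(** The characters r |-> r^m of the torus are distinct modulo p - 1: otherwise
    the sum of the r^k, for some 0 < k < p - 1, would be p - 1 instead of 0. *)
Lemma emb_expf_eq m n : (forall r : 'F_p, r != 0 -> emb r ^+ m = emb r ^+ n)
  <-> m = n %[mod p.-1].
Proof.
have mod_exp r k : r != 0 -> emb r ^+ k = emb r ^+ (k %% p.-1).
  move=> nz; rewrite {1}(divn_eq k p.-1) exprD mulnC exprM.
  by rewrite emb_expf // expr1n mul1r.
split=> [eqX | eq_mod r nz]; last by rewrite mod_exp // eq_mod -mod_exp.
wlog le_nm : m n eqX / (n %% p.-1 <= m %% p.-1)%N => [IH|].
  have /orP[/IH|/IH] := leq_total (n %% p.-1) (m %% p.-1); first exact.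
  by move=> H; apply/esym/H => r nz; rewrite eqX.
have p1_gt0 : (0 < p.-1)%N by have := prime_gt1 pr_p; lia.
set k := (m %% p.-1 - n %% p.-1)%N.
have lt_k : (k < p.-1)%N by rewrite (leq_ltn_trans (leq_subr _ _)) ?ltn_mod.
have expk r : r != 0 -> emb r ^+ k = 1.
  move=> nz; have nze : emb r != 0 by rewrite emb_eq0.
  apply: (mulIf (expf_neq0 (n %% p.-1) nze)).
  by rewrite -exprD subnK // mul1r -!mod_exp // eqX.
have [k0|k_gt0] := posnP k.
  by apply/eqP; rewrite eqn_leq le_nm andbT -subn_eq0 -/k k0.
have := sum_Fp_pow charFp (ltnW lt_k); rewrite (ltn_eqF lt_k).
rewrite (bigD1 0) //= rmorph0 expr0n gtn_eqF // add0r.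
rewrite (eq_bigr (fun=> 1)) => [|r nz]; last exact: expk.
rewrite sumr_const cardC1 card_Fp // => /eqP.
by rewrite (negPf (pchar_nat_neq0 charFp _)) //; lia.
Qed.

Section Generator.

Variables (a : int) (b : nat) (U : mx_representation F B b).
Local Notation rP := (subg_repr U (unip_sub_borel p)).
Local Notation Y := (aug u1 U).

(** The translates of v by the unipotent elements span U. *)
Lemma unip_trivial_span m (v : 'rV[F]_b) (D : 'M[F]_(b, m)) c :
    row_full (tower Y c v) -> (forall s, v *m U (upper s) *m D = 0) -> D = 0.
Proof.
move=> fullv D0; have GU s : upper s \in B := upper_borel s.
have vYD k s : v *m Y ^+ k *m U (upper s) *m D = 0.
  elim: k s => [|k IHk] s; first by rewrite expr0 mulmx1.
  rewrite exprSr mulmxA {2}/aug mulmxBr mulmx1 mulmxBl mulmxBl IHk subr0.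
  rewrite -!mulmxA (mulmxA (U _)) -repr_mxM ?groupV ?GU //.
  rewrite (_ : (u1^-1 * upper s)%g = upper (-1 + s)); last by rewrite upperD -upper1V.
  by have := IHk (-1 + s); rewrite -!mulmxA.
apply: (row_full_inj fullv); rewrite mulmx0 mxcol_mul.
rewrite -[RHS](@submxcolK _ _ _ _ (0 : 'M_(\sum_(_ < c) 1, m))).
apply: eq_mxcol => k; rewrite submxcol0.
by have := vYD k 0; rewrite upper0 repr_mx1 mulmx1.
Qed.

(** The projection of U to its top composition factor. *)
Lemma top_form : (0 < b)%N -> is_U charFp a U -> exists2 f : 'cV[F]_b, f != 0
  & mx_hom U (S_repr charFp (a + 2 * b.-1%:Z)) f.
Proof.
move=> b_gt0 [_ [Us [compU [szU lastU simU]]]].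
have lt_b : (b.-1 < b)%N by lia.
have := simU _ lt_b; rewrite /series_repr /subseries_repr /section_repr.
set modM := mx_subseries_module' _ _; set modT := mx_subseries_module _ _.
set M := (0 :: Us)`_b.-1 in modM *; set T := Us`_b.-1 in modT *.
have fullT : (1%:M <= T)%MS.
  by have -> : T = last 0 Us; [rewrite -nth_last szU | rewrite lastU].
set modW := section_module _ _; set W := <<in_factmod M T>>%MS in modW *.
case=> f def1 freef homf; have oneW : (in_factmod M 1%:M <= W)%MS.
  by rewrite genmxE [X in (_ <= X)%MS]in_factmodE [X in (X <= _)%MS]in_factmodE submxMr.
pose h := in_submod W (in_factmod M 1%:M).
have homh : mx_hom U (submod_repr modW) h.
  move=> x Bx; rewrite -(in_submodJ modW) // -(in_factmodJ modM) // mul1mx.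
  by rewrite [in RHS]in_factmodE [RHS]in_submodE -mulmxA -in_submodE.
exists (h *m f); last exact: mx_homM homh homf.
apply/eqP => f0; have : h = 0 by apply: (row_free_inj freef); rewrite f0 mul0mx.
move/(congr1 (@val_submod _ _ W _)); rewrite in_submodK // linear0 => /eqP.
rewrite in_factmod_eq0 => M1; move: def1; rewrite genmxE.
have /eqP-> : in_factmod M T == 0.
  by rewrite in_factmod_eq0 (submx_trans (submx1 _) M1).
by rewrite mxrank0.
Qed.

(** A vector outside the maximal submodule generates the uniserial module, and
    averaging over the torus makes it an eigenvector. *)
Lemma uniserial_generator : (0 < b)%N -> is_U charFp a U ->
  exists v : 'rV[F]_b, [/\ row_full (tower Y b v), row_free (tower Y b v),
    v *m Y ^+ b = 0
    & forall r : 'F_p, r != 0 ->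
        v *m U (torus r) = emb r ^ (a + 2 * b.-1%:Z) *: v].
Proof.
move=> b_gt0 defU; have [f nzf homf] := top_form b_gt0 defU.
have [uniU _] := defU; set chi := a + 2 * b.-1%:Z in homf *.
have GT r : r != 0 -> torus r \in B by exact: torus_borel.
have f_tor r : r != 0 -> U (torus r) *m f = emb r ^ chi *: f.
  by move=> nz; rewrite homf ?GT //= /S_mx (torusE nz) mul_mx_scalar.
have [v0 v0f] : exists v0 : 'rV[F]_b, v0 *m f = 1%:M.
  have /matrix0Pn[i [j nzij]] := nzf.
  exists ((f i j)^-1 *: delta_mx 0 i); rewrite -scalemxAl -rowE.
  by apply/matrixP => k l; rewrite !mxE !ord1 in nzij *; rewrite mulVf.
(* The sign is the inverse of the order p - 1 of the torus. *)
pose v := - \sum_(r : 'F_p | r != 0) emb r ^ (- chi) *: (v0 *m U (torus r)).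
have nze r : r != 0 -> emb r != 0 by move=> nz; rewrite emb_eq0.
have vf : v *m f = 1%:M.
  rewrite /v mulNmx mulmx_suml (eq_bigr (fun=> 1%:M)) => [|r nz].
    rewrite sumr_const cardC1 card_Fp // -scaler_nat -scaleNr.
    rewrite (_ : - p.-1%:R = 1) ?scale1r //.
    apply/eqP; rewrite eq_sym -addr_eq0 -mulrS prednK ?prime_gt0 //.
    by rewrite (pcharf0 charFp).
  rewrite -scalemxAl -mulmxA f_tor // -scalemxAr scalerA v0f.
  by rewrite -expfzDr ?nze // addNr expr0z scale1r.
have v_tor r : r != 0 -> v *m U (torus r) = emb r ^ chi *: v.
  move=> nz; rewrite /v mulNmx scalerN; congr (- _).
  rewrite mulmx_suml scaler_sumr [RHS](reindex_inj (mulIf nz)) /=.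
  apply: eq_big => [s|s nzs]; first by rewrite mulf_eq0 negb_or nz andbT.
  rewrite -scalemxAl -mulmxA -repr_mxM ?GT // -torusM // scalerA; congr (_ *: _).
  rewrite rmorphM expfzMl mulrC -mulrA -expfzDr ?nze // addNr expr0z mulr1.
  by [].
have rkK : \rank (kermx f) = b.-1.
  have rk1 : \rank f = 1%N.
    by apply/eqP; rewrite eqn_leq rank_leq_col lt0n mxrank_eq0.
  by rewrite mxrank_ker rk1 subn1.
have fullW : row_full (cyclic_mx U v).
  have nsWK : ~~ (cyclic_mx U v <= kermx f)%MS.
    apply/negP => sWK; have /sub_kermxP := submx_trans (cyclic_mx_id U v) sWK.
    by rewrite vf => /matrixP/(_ 0 0); rewrite !mxE => /eqP; rewrite oner_eq0.
  have [/(negP nsWK)//|sKW] := uniU _ _ (cyclic_mx_module U v) (mx_hom_kermx homf).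
  have : (kermx f < cyclic_mx U v)%MS by rewrite ltmxE sKW.
  move/rank_ltmx; rewrite rkK => lt_rk.
  by rewrite /row_full eqn_leq rank_leq_col; lia.
have exY : exists k, v *m Y ^+ k == 0.
  by exists p; rewrite (aug_p charFp (order_upper pr_p) rP) mulmx0.
case: (ex_minnP exY) => c /eqP vYc0 minc.
have nzv : v != 0.
  by apply: contra_eq_neq vf => ->; rewrite mul0mx; apply/eqP => /matrixP/(_ 0 0);
     rewrite !mxE => /esym/eqP; rewrite oner_eq0.
have c_gt0 : (0 < c)%N.
  by case: c vYc0 {minc} => //; rewrite expr0 mulmx1 => /eqP; rewrite (negPf nzv).
have freev : row_free (tower Y c v).
  apply: tower_free => //; rewrite /row_free eqn_leq rank_leq_row lt0n mxrank_eq0.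
  by apply/negP => /minc; rewrite leqNgt ltn_predL c_gt0.
have vYc k : (v *m Y ^+ k <= tower Y c v)%MS.
  have [lt_kc|le_ck] := ltnP k c; last first.
    by rewrite -(subnKC le_ck) exprD [_ * _]/(_ *m _) mulmxA vYc0 mul0mx sub0mx.
  rewrite -[v *m _](mxcolK (fun k : 'I_c => v *m Y ^+ k) (Ordinal lt_kc)).
  by rewrite -/(tower Y c v) -[tower Y c v in X in (X <= _)%MS]mul1mx -submxcol_mul submxMl.
have fullv : row_full (tower Y c v).
  rewrite -sub1mx; apply: submx_trans (_ : 1%:M <= cyclic_mx U v)%MS _; first by rewrite sub1mx.
  apply/rV_subP => w /cyclic_mxP[A /envelop_mxP[al ->] ->].
  rewrite mulmx_sumr summx_sub // => x Bx; rewrite -scalemxAr scalemx_sub //.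
  pose r := GLval x 0 0; have nz : r != 0 := borel_neq0 Bx.
  pose s := GLval x 0 1 * r * r^-1 ^+ 2.
  have def_x : x = (torus r * upper s)%g by rewrite {1}(borel_decomp Bx) upper_torus.
  rewrite def_x repr_mxM ?GT ?upper_borel // mulmxA v_tor // -scalemxAl scalemx_sub //.
  by apply: (cycle_span (rM := rP) vYc); apply/unipP; exists s.
have c_b : c = b.
  by apply/eqP; rewrite -(eqP fullv) (eqP freev) sum_nat_const card_ord muln1.
by rewrite c_b in fullv freev vYc0; exists v; split.
Qed.

End Generator.

End Uniserial.

(** * Maps from the projective part of the induced module *)

Section CoordinateSpace.

Variables (F : fieldType) (n : nat) (K : {pred 'I_n}).

(** The row vectors supported on K. *)
Definition coord_space : {vspace 'rV[F]_n} :=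
  limg (linfun (mulmxr (\matrix_(i < #|K|, j < n) (enum_val i == j)%:R))).

Lemma coord_spaceP (w : 'rV[F]_n) :
  reflect (forall k, k \notin K -> w 0 k = 0) (w \in coord_space).
Proof.
apply: (iffP idP) => [/memv_imgP[u _ ->] k nKk|w0].
  rewrite lfunE /= mxE big1 // => i _; rewrite mxE.
  have /negPf-> : enum_val i != k by apply: contraNneq nKk => <-; apply: enum_valP.
  by rewrite mulr0.
apply/memv_imgP; exists (\row_i w 0 (enum_val i)); first exact: memvf.
rewrite lfunE /=; apply/rowP => k; rewrite mxE.
have [Kk|nKk] := boolP (k \in K).
  rewrite (bigD1 (enum_rank_in Kk k)) //= big1 ?addr0 => [|i ne_i].
    by rewrite !mxE enum_rankK_in // eqxx mulr1.
  rewrite !mxE; case: eqP => [def_k|]; last by rewrite mulr0.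
  by case/eqP: ne_i; apply: enum_val_inj; rewrite enum_rankK_in.
rewrite w0 // big1 // => i _; rewrite !mxE.
have /negPf-> : enum_val i != k by apply: contraNneq nKk => <-; apply: enum_valP.
by rewrite mulr0.
Qed.

Lemma coord_space_dim : \dim coord_space = #|K|.
Proof.
rewrite /coord_space limg_dim_eq.
  by rewrite dimvf /dim /= mul1n.
apply/eqP; rewrite -subv0; apply/subvP => u; rewrite memv_cap memv_ker lfunE.
case/andP=> _ /eqP /= u0; rewrite memv0; apply/eqP/rowP => i.
have /matrixP/(_ 0 (enum_val i)) := u0; rewrite !mxE => <-.
rewrite (bigD1 i) //= mxE eqxx mulr1 big1 ?addr0 // => j ne_ji.
by rewrite mxE (inj_eq enum_val_inj) (negPf ne_ji) mulr0.
Qed.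

End CoordinateSpace.

Section InducedHoms.

Variables (F : closedFieldType) (p : nat) (charFp : p \in [pchar F]).
Local Notation emb := (Fp_emb charFp).
Local Notation u1 := (upper (1%R : 'F_p)).
Local Notation G := (SL2 p).
Local Notation B := (borel p).
Local Notation P := <[u1]>%G.
Local Notation sBG := (borel_sub p).
Local Notation sPB := (unip_sub_borel p).
Let pr_p : prime p := pcharf_prime charFp.

Lemma unip_sub_SL2 : P \subset G.
Proof. exact: subset_trans sPB sBG. Qed.

Variables (a b : nat) (U : mx_representation F B b).
Hypotheses (b_gt0 : (0 < b)%N) (le_bp : (b <= p)%N).
Variable v : 'rV[F]_b.
Hypotheses (fullv : row_full (tower (aug u1 U) b v))
  (freev : row_free (tower (aug u1 U) b v)) (vYb : v *m aug u1 U ^+ b = 0).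
Hypothesis v_torus : forall r : 'F_p, r != 0 ->
  v *m U (torus r) = emb r ^+ (a + 2 * b.-1) *: v.

Variable d : nat.
Hypothesis lt_dp : (d < p)%N.
Local Notation V := (V_repr charFp d.+1).

(** The degrees in x that occur in the image of Y^(p-b) and have the weight of
    the generator v of U. *)
Definition head_weights : {pred 'I_d.+1} :=
  [pred k : 'I_d.+1 | (k + p <= b + d)%N
     && (a + 2 * b.-1 + (d - k) == k %[mod p.-1])].

Lemma weight_mem (w : 'rV[F]_d.+1) :
    (forall k : 'I_d.+1, (d + b < k + p)%N -> w 0 k = 0) ->
    (forall r : 'F_p, r != 0 -> w *m V (torus r) = emb r ^+ (a + 2 * b.-1) *: w) ->
  w \in coord_space F head_weights.
Proof.
move=> w_depth w_wt; apply/coord_spaceP => k; rewrite inE negb_and -ltnNge.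
case/orP=> [lt_k|neq_wt]; first by apply: w_depth; lia.
apply: contraNeq neq_wt => nz; apply/eqP/(emb_expf_eq charFp) => r nzr.
have /matrixP/(_ 0 k) := w_wt r nzr; rewrite [RHS]mxE mxE (bigD1 k) //= big1 => [|i ne_ik].
  rewrite addr0 V_torus // eqxx mulr1n [RHS]mulrC => /(mulfI nz) wt.
  by rewrite exprD -wt mulfVK // expf_neq0 // emb_eq0.
by rewrite V_torus // (negPf ne_ik) mulr0n mulr0.
Qed.

Lemma memP_weight (w : 'rV[F]_d.+1) : w \in coord_space F head_weights ->
  (w <= aug u1 V ^+ (p - b))%MS /\
  (forall r : 'F_p, r != 0 -> w *m V (torus r) = emb r ^+ (a + 2 * b.-1) *: w).
Proof.
move/coord_spaceP => w0; split.
  apply: V_aug_image => // k lt_k; apply: w0; rewrite inE negb_and -ltnNge.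
  by apply/orP; left; lia.
move=> r nzr; apply/rowP => k; rewrite [RHS]mxE mxE (bigD1 k) //= big1 => [|i ne_ik].
  rewrite addr0 V_torus // eqxx mulr1n.
  have [/andP[_ /eqP wt]|nKk] := boolP (k \in head_weights); last first.
    by rewrite (w0 k) // mul0r mulr0.
  have /(emb_expf_eq charFp)/(_ r nzr) <- := wt; rewrite exprD.
  by rewrite mulfK 1?mulrC // expf_neq0 // emb_eq0.
by rewrite V_torus // (negPf ne_ik) mulr0n mulr0.
Qed.

Lemma generator_aug0 j : (b <= j)%N -> v *m aug u1 U ^+ j = 0.
Proof.
by move=> le_bj; rewrite -(subnKC le_bj) exprD [_ * _]/(_ *m _) mulmxA vYb mul0mx.
Qed.

(** As Y^b kills v, a trace takes v into the image of Y^(p-b). *)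
Lemma gtrace_depth h (k : 'I_d.+1) : (d + b < k + p)%N ->
  (v *m gtrace P U V h) 0 k = 0.
Proof.
move=> lt_k; rewrite (mul_gtrace_cycle charFp (order_upper pr_p)
  (subg_repr U sPB) (subg_repr V unip_sub_SL2)) /= summxE big1 // => j _.
have [lt_jb|le_bj] := ltnP j b; last first.
  by rewrite [v *m _ ^+ j]generator_aug0 // !mul0mx mxE.
have -> := aug_commV (subg_repr V unip_sub_SL2) (p.-1 - j).
by rewrite mulmxA V_aug_depth //; lia.
Qed.

Lemma repr_upper_torus (H : {group _}) n (rM : mx_representation F H n) s r :
    B \subset H -> r != 0 ->
  rM (upper s) *m rM (torus r) = rM (torus r) *m rM (upper (s * r^-1 ^+ 2)).
Proof.
move=> sBH nz; have HB x : x \in B -> x \in H := subsetP sBH x.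
by rewrite -!repr_mxM ?HB ?upper_borel ?torus_borel // upper_torus.
Qed.

(** If T and S, which permute the operators A and C in the same way, act on v0
    and on its image w by the same scalar, then f commutes with T on the orbit
    of v0. *)
Lemma eigenvector_equivariant n m (v0 : 'rV[F]_n) (w : 'rV[F]_m) A A' T f C C' S c :
    A *m T = T *m A' -> C *m S = S *m C' -> v0 *m T = c *: v0 -> w *m S = c *: w ->
    A *m f = f *m C -> A' *m f = f *m C' -> v0 *m f = w ->
  v0 *m A *m (T *m f - f *m S) = 0.
Proof.
move=> AT CS vT wS Af A'f vf; rewrite mulmxBr -!mulmxA (mulmxA A) AT.
rewrite -(mulmxA T) A'f (mulmxA v0) vT -scalemxAl (mulmxA v0) vf.
rewrite (mulmxA A) Af -(mulmxA f) CS (mulmxA v0) vf (mulmxA w) wS -scalemxAl.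
exact: subrr.
Qed.

(** Conversely every vector of the image of Y^(p-b) is the value at v of a
    trace, which is B-equivariant as soon as that vector has the weight of v. *)
Lemma gtrace_onto (w : 'rV[F]_d.+1) : w \in coord_space F head_weights ->
  exists h, [/\ v *m gtrace P U V h = w
    & mx_hom U (subg_repr V sBG) (gtrace P U V h)].
Proof.
case/memP_weight=> /submxP[w1 def_w] w_wt; set Y := aug u1 V in def_w.
(* Only the term of index b - 1 of the expansion of the trace survives; the
   factor V u1 cancels the last factor of that term. *)
have [h defh] := tower_ext
  (fun j : 'I_b => if j == b.-1 :> nat then w1 *m V u1 else 0) freev.
have Gu : u1 \in G by rewrite (subsetP sBG) ?upper_borel.
have vtr : v *m gtrace P U V h = w.
  rewrite (mul_gtrace_cycle charFp (order_upper pr_p)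
    (subg_repr U sPB) (subg_repr V unip_sub_SL2)) /=.
  have lt_b1 : (b.-1 < p)%N by lia.
  rewrite (bigD1 (Ordinal lt_b1)) //= big1 ?addr0 => [|j ne_j].
    have lt_bb : (b.-1 < b)%N by lia.
    have := defh (Ordinal lt_bb); rewrite /= eqxx => ->.
    have -> : (p.-1 - b.-1 = p - b)%N by lia.
    rewrite def_w -/Y.
    have YV : V u1 *m Y ^+ (p - b) = Y ^+ (p - b) *m V u1.
      exact: (aug_comm (subg_repr V unip_sub_SL2)).
    by rewrite mulmxA -(mulmxA w1) YV mulmxA repr_mxK.
  have [lt_jb|le_bj] := ltnP j b; last first.
    by rewrite [v *m _ ^+ j]generator_aug0 // !mul0mx.
  have := defh (Ordinal lt_jb); rewrite /= => ->.
  by rewrite ifF ?mul0mx //; apply/negbTE; rewrite -val_eqE in ne_j.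
exists h; split=> //; set f := gtrace P U V h in vtr *.
have homP : mx_hom (subg_repr U sPB) (subg_repr V unip_sub_SL2) f.
  exact: (gtrace_hom (subg_repr U sPB) (subg_repr V unip_sub_SL2)).
have fU s : U (upper s) *m f = f *m V (upper s).
  by apply: homP; apply/unipP; exists s.
have GU s : upper s \in B := upper_borel s.
have GG x : x \in B -> x \in G := subsetP sBG x.
have fT r : r != 0 -> U (torus r) *m f = f *m V (torus r).
  move=> nz; apply/eqP; rewrite -subr_eq0; apply/eqP.
  have GT : torus r \in B := torus_borel nz.
  apply: (unip_trivial_span fullv) => s.
  have UT := repr_upper_torus U s (subxx B) nz.
  have VT := repr_upper_torus V s sBG nz.
  exact: (eigenvector_equivariant UT VT (v_torus nz) (w_wt r nz) (fU s) (fU _) vtr).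
move=> x Bx; change (U x *m f = f *m V x); have nz := borel_neq0 Bx.
have BT := torus_borel nz; rewrite (borel_decomp Bx).
rewrite (repr_mxM U (GU _) BT) (repr_mxM V (GG _ (GU _)) (GG _ BT)).
by rewrite -mulmxA fT // mulmxA fU !mulmxA.
Qed.

Section Summand.

Variables (W Q : representation F G).
Hypotheses (biU : biproduct (induced_repr U sBG) W Q) (trQ : traced Q).
Hypothesis noW : forall h, gtrace G W V h = 0.

(** Frobenius reciprocity restricted to the maps that factor through projective
    modules: all maps from Q do, and no map from W does, so that the maps from
    Q are the B-maps from U that are traces from the trivial subgroup. *)
Lemma homs_dim_induced : \dim (homs Q V) = #|head_weights|.
Proof.
case: biU => iW [qW [iQ [qQ [[hiW hqW hiQ hqQ] W1 Q1 WQ1]]]].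
pose E := ind_in G U 1; pose x0 := v *m E *m qQ.
have homE : mx_hom U (subg_repr (induced_repr U sBG) sBG) E := ind_in_hom sBG U.
pose Th : 'Hom('M[F]_(rdegree Q, d.+1), 'rV[F]_d.+1) := linfun (mulmx x0).
rewrite -(coord_space_dim F) -(limg_dim_eq (_ : homs Q V :&: lker Th = 0)%VS).
  congr (\dim _); apply/eqP; rewrite eqEsubv; apply/andP; split.
    apply/subvP => _ /memv_imgP[f /homsP homf ->]; rewrite lfunE /=.
    have [h trh] := trQ.
    pose f1 := qQ *m f; have homf1 : mx_hom (induced_repr U sBG) V f1 := mx_homM hqQ homf.
    have def_f1 : f1 = gtrace G (induced_repr U sBG) V (qQ *m h *m f).
      by rewrite -(gtraceM _ hqQ homf) trh mulmx1.
    rewrite -mulmxA -/f1; apply: weight_mem => [k lt_k|r nz]; last first.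
      rewrite -2!mulmxA -homf1 ?(subsetP sBG) ?torus_borel //.
      rewrite (mulmxA E) -homE ?torus_borel // !mulmxA v_torus //.
      by rewrite -!scalemxAl.
    have [h' ->] : exists h', f1 = gtrace P (induced_repr U sBG) V h'.
      by rewrite def_f1; apply: (gtrace_sub unip_sub_SL2).
    rewrite -mulmxA.
    have homEP : mx_hom (subg_repr U sPB)
        (subg_repr (induced_repr U sBG) unip_sub_SL2) E.
      by move=> x Px; apply: homE; apply: (subsetP sPB).
    have := gtraceM h' homEP (mx_hom1 (subg_repr V unip_sub_SL2)).
    by rewrite !mulmx1 /= => ->; apply: gtrace_depth.
  apply/subvP => w /gtrace_onto[h [vtr homf]].
  pose g := gtrace G (induced_repr U sBG) V (ind_out G U 1 *m h).
  have Eg : E *m g = p.-1%:R *: gtrace P U V h.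
    rewrite ind_in_gtrace -[gtrace B U V h]/(gtrace B U (subg_repr V sBG) h).
    by rewrite (gtrace_trans sPB) (rtrace_homE sPB homf) (index_unip pr_p).
  have homg : mx_hom (induced_repr U sBG) V g := gtrace_hom _ _ _.
  have gQ : g = qQ *m (iQ *m g).
    rewrite mulmxA -[LHS]mul1mx -WQ1 mulmxDl -(mulmxA qW).
    by rewrite -[iW *m g]mulmx1 (gtraceM _ hiW (mx_hom1 V)) noW mulmx0 add0r.
  have nz : p.-1%:R != 0 :> F.
    by apply: (pchar_nat_neq0 charFp); have := prime_gt1 pr_p; lia.
  have -> : w = Th (p.-1%:R^-1 *: (iQ *m g)).
    rewrite /Th lfunE /= -scalemxAr /x0 -!mulmxA -gQ Eg -scalemxAr scalerA.
    by rewrite mulVf // scale1r vtr.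
  apply: memv_img; apply/homsP/mx_homZ; exact: mx_homM hiQ homg.
apply/eqP; rewrite -subv0; apply/subvP => f; rewrite memv_cap memv_ker lfunE.
case/andP=> /homsP homf /eqP /= vf0; rewrite memv0.
have homf1 := mx_homM hqQ homf.
have Ef0 : E *m (qQ *m f) = 0.
  apply: (unip_trivial_span fullv) => s.
  rewrite -mulmxA (mulmxA (U _)) homE ?upper_borel //= -(mulmxA E).
  rewrite [induced_repr U sBG _ *m _]homf1 ?(subsetP sBG) ?upper_borel //.
  by rewrite !mulmxA -/x0 vf0 mul0mx.
by rewrite -[f]mul1mx -Q1 -mulmxA (ind_hom_eq0 homf1 Ef0) mulmx0.
Qed.

End Summand.

End InducedHoms.

(** * Arithmetic of the multiplicities *)

Section GammaInverse.

Lemma GammaE p i j :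
  Gamma p i j = (-1) ^+ (i + j) * ((minn i j)%:R - 2 * i%:R * j%:R / p%:R).
Proof. by rewrite /Gamma; case: leqP => _. Qed.

(** The Cartan matrix of a block is tridiagonal, with entries 2 and 1 and a
    last diagonal entry 3; the entry 3 is expressed by y (h + 1) = y h. Gamma
    is its Green function, and the products telescope. *)
Lemma Gamma_inverse (p h k : nat) (y : nat -> rat) :
    p = h.*2.+1 -> (1 <= k <= h)%N -> y 0%N = 0 -> y h.+1 = y h ->
  \sum_(1 <= j < h.+1) Gamma p k j * (y j.-1 + 2 * y j + y j.+1) = y k.
Proof.
move=> def_p /andP[k_gt0 le_kh] y0 yh.
have nzp : p%:R != 0 :> rat by rewrite pnatr_eq0 def_p.
pose f := Gamma p k; pose W j := f j.-1 * y j - f j * y j.-1.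
have f0 : f 0%N = 0 by rewrite /f GammaE minn0 mulr0 mul0r subrr mulr0.
have f_step j : (0 < j)%N -> f j.-1 + 2 * f j + f j.+1 = (j == k)%:R.
  case: j => // j _; rewrite /f !GammaE /= !addnS !exprS -!natr1.
  set s := (-1) ^+ (k + j).
  transitivity (s * ((minn k j)%:R - 2 * (minn k j.+1)%:R + (minn k j.+2)%:R)).
    by field.
  have [lt_kj|[lt_jk|eq_jk]] : (k < j.+1 \/ j.+1 < k \/ k = j.+1)%N by lia.
  - have [-> -> ->] : [/\ minn k j = k, minn k j.+1 = k & minn k j.+2 = k].
      by split; lia.
    by rewrite (gtn_eqF lt_kj) mulr0n; ring.
  - have [-> -> ->] : [/\ minn k j = j, minn k j.+1 = j.+1 & minn k j.+2 = j.+2].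
      by split; lia.
    by rewrite (ltn_eqF lt_jk) mulr0n -!natr1; ring.
  have [-> -> ->] : [/\ minn k j = j, minn k j.+1 = j.+1 & minn k j.+2 = j.+1].
    by split; lia.
  rewrite eq_jk eqxx mulr1n /s eq_jk addSn exprS -!natr1 addnn -signr_odd odd_double expr0.
  by ring.
have stepW j : (1 <= j < h.+1)%N ->
    f j * (y j.-1 + 2 * y j + y j.+1) = (W j.+1 - W j) + (j == k)%:R * y j.
  by case/andP=> j_gt0 _; rewrite -f_step // /W /=; ring.
rewrite (eq_big_nat _ _ stepW) big_split /= telescope_sumr //.
rewrite (bigD1_seq k) ?iota_uniq ?mem_index_iota ?k_gt0 ?ltnS //=.
rewrite eqxx mul1r big1 ?addr0 => [|j /negPf->]; last by rewrite mul0r.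
rewrite /W /= yh y0 f0 mulr0 mul0r !subr0 -mulrBl.
suff -> : f h - f h.+1 = 0 by rewrite mul0r add0r.
rewrite /f !GammaE (minn_idPl le_kh) (minn_idPl (leqW le_kh)) addnS exprS -natr1.
have defp : p%:R = 2 * h%:R + 1 :> rat by rewrite def_p -addn1 natrD -muln2 natrM mulrC.
have nzh : 2 * h%:R + 1 != 0 :> rat by rewrite -defp.
by rewrite defp; field.
Qed.

End GammaInverse.

Section HeadCount.

(** With a + 2 (b - 1) + d = 2 c the congruence says that k = c - j h for some
    integer j, and the bounds on b and d leave 0 <= j < 5. *)
Lemma head_count (h a b d : nat) (p := h.*2.+1) :
    (0 < h)%N -> (a < h.*2)%N -> (1 <= b <= p)%N -> (d < p)%N ->
  #|[pred k : 'I_d.+1 | (k + p <= b + d)%N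
     && (a + 2 * b.-1 + (d - k) == k %[mod p.-1])]|
  = if odd (a + d) then 0%N else
    (\sum_(j < 5) ((j * h <= (a + 2 * b.-1 + d)./2)
      && ((a + 2 * b.-1 + d)./2 + p <= b + d + j * h)))%N.
Proof.
move=> h_gt0 lt_a /andP[b_gt0 le_b] lt_d.
have p1 : p.-1 = (2 * h)%N by rewrite mul2n.
rewrite -sum1_card big_mkcond /=.
have modE (k : 'I_d.+1) : (k + p <= b + d)%N ->
    (a + 2 * b.-1 + (d - k) == k %[mod p.-1])
      = (p.-1 %| a + 2 * b.-1 + d - 2 * k)%N.
  move=> le_k; have le_kd := leq_ord k; rewrite eqn_mod_dvd; last by lia.
  by congr (_ %| _)%N; lia.
case: ifP => [odd_ad|even_ad].
  rewrite big1 // => k _; rewrite ifF //; apply/negP => /andP[le_k].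
  rewrite modE // p1 => /dvdnP[q def_q].
  have := congr1 odd def_q; rewrite oddM oddM andbF.
  by have le_kd := leq_ord k; rewrite /p in le_b le_k lt_d; lia.
set c := (a + 2 * b.-1 + d)./2.
have def_c : (a + 2 * b.-1 + d = 2 * c)%N.
  by rewrite /c; move: even_ad; lia.
transitivity (\sum_(k < d.+1) \sum_(j < 5) ((k + j * h == c) && (k + p <= b + d)))%N.
  apply: eq_bigr => k _; rewrite inE; have [le_k|_] := boolP (k + p <= b + d)%N; last first.
    by rewrite big1 // => j _; rewrite andbF.
  rewrite /= modE // def_c p1 -mulnBr dvdn_pmul2l //.
  have le_kc : (k <= c)%N by rewrite /p in le_k lt_d le_b; lia.
  case: ifP => [/dvdnP[q def_q]|ndvd].
    have lt_q : (q < 5)%N.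
      rewrite ltnNge; apply/negP => le_q.
      have : (5 * h <= q * h)%N by rewrite leq_mul2r le_q orbT.
      by rewrite /p in le_k lt_d le_b; lia.
    rewrite (bigD1 (Ordinal lt_q)) //= -def_q subnKC // eqxx /= big1 // => j.
    rewrite -val_eqE andbT /= => ne_j; apply/eqP; rewrite eqb0; apply/negP => /eqP def_j.
    case/negP: ne_j; rewrite -(eqn_pmul2r h_gt0); apply/eqP; lia.
  rewrite big1 // => j _; rewrite andbT; apply/eqP; rewrite eqb0; apply/negP => /eqP def_j.
  by rewrite -def_j addKn dvdn_mull in ndvd.
rewrite exchange_big; apply: eq_bigr => j _ /=.
case: (leqP (j * h) c) => [le_jc|lt_cj] /=; last first.
  by rewrite big1 // => k _; rewrite gtn_eqF //; lia.
case: (leqP (c + p)) => [le_c|lt_c].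
  have lt_k : (c - j * h < d.+1)%N by rewrite /p in le_c le_b; lia.
  rewrite (bigD1 (Ordinal lt_k)) //= subnK // eqxx big1 /= => [|k].
    by have -> : (c - j * h + p <= b + d)%N by lia.
  by rewrite -val_eqE /= => ne_k; apply/eqP; rewrite eqb0; apply/negP => /andP[/eqP]; lia.
rewrite big1 // => k _; apply/eqP; rewrite eqb0; apply/negP => /andP[/eqP]; lia.
Qed.

End HeadCount.

Section Alpha.

Lemma floor_div (X : int) (n : nat) (m : int) : (0 < n)%N ->
  m * n%:Z <= X < (m + 1) * n%:Z -> Num.floor (X%:~R / n%:R : rat) = m.
Proof.
move=> n_gt0 /andP[le_X lt_X]; apply: floor_def.
have n_gt0' : 0 < n%:R :> rat by rewrite ltr0n.
rewrite ler_pdivlMr // ltr_pdivrMr //.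
rewrite -[n%:R]/(n%:Z%:~R) -!rmorphM /= ler_int ltr_int.
by rewrite le_X.
Qed.

Lemma ceil_div (X : int) (n : nat) (m : int) : (0 < n)%N ->
  (m - 1) * n%:Z < X <= m * n%:Z -> Num.ceil (X%:~R / n%:R : rat) = m.
Proof.
move=> n_gt0 /andP[lt_X le_X]; apply: ceil_def.
have n_gt0' : 0 < n%:R :> rat by rewrite ltr0n.
rewrite ler_pdivrMr // ltr_pdivlMr //.
rewrite -[n%:R]/(n%:Z%:~R) -!rmorphM /= ler_int ltr_int.
by rewrite lt_X.
Qed.

(* Case analysis on the indicator functions in the goal, dropping at once the
   combinations that contradict the bounds in the context. *)
Ltac split_leq := repeat match goal with |- context [leq ?x ?y] =>
  let E := fresh "E" in
  destruct (leq x y) eqn:E; cbn [andb nat_of_bool]; try (exfalso; lia) end.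

Ltac split_le := repeat match goal with |- context [(?x <= ?y)%R] =>
  let E := fresh "E" in
  destruct (x <= y)%R eqn:E; cbn [andb nat_of_bool]; try (exfalso; lia) end.

Lemma thetaE (h a b c : nat) (p := h.*2.+1) :
    (0 < h)%N -> (a < h.*2)%N -> (1 <= b <= p)%N -> (c < h.*2)%N ->
  theta p a b c = if odd (a + c) then 0 else
    ((c + 2 <= 2 * b + a)%N : nat)%:Z + ((c + 2 + 2 * h <= 2 * b + a)%N : nat)%:Z
      + ((c + 2 + 4 * h <= 2 * b + a)%N : nat)%:Z - ((c < a)%N : nat)%:Z.
Proof.
move=> h_gt0 lt_a /andP[b_gt0 le_b] lt_c; rewrite /theta !modn2 oddD.
have -> : ((odd a : nat) != odd c) = odd a (+) odd c.
  by case: (odd a); case: (odd c).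
case: ifP => // _.
have p1 : p%:R - 1 = h.*2%:R :> rat by rewrite /p -natr1 addrK.
have -> : (2 * (b%:R - 1) + a%:R - c%:R : rat)
    = (2 * (b%:Z - 1) + a%:Z - c%:Z)%:~R.
  by rewrite rmorphB rmorphD rmorphM rmorphB.
have -> : (a%:R - c%:R : rat) = (a%:Z - c%:Z)%:~R by rewrite rmorphB.
rewrite p1 (@floor_div _ _ (((c + 2 <= 2 * b + a)%N : nat)%:Z
  + ((c + 2 + 2 * h <= 2 * b + a)%N : nat)%:Z
  + ((c + 2 + 4 * h <= 2 * b + a)%N : nat)%:Z - 1)); last 2 first.
- by rewrite double_gt0.
- by rewrite /p in le_b; split_leq; lia.
rewrite (@ceil_div _ _ ((c < a)%N : nat)%:Z) ?double_gt0 //; first by lia.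
by split_leq; lia.
Qed.

(** The multiplicity of P_t in Ind U in closed form, for t < p = 2 h + 1. *)
Definition heads (h a b t : nat) : int :=
  if odd (a + t) then
    (((a < t) && (4 * h + 3 <= 2 * b + a + t))%N : nat)%:Z
      + ((6 * h + 3 <= 2 * b + a + t)%N : nat)%:Z
  else 0.

Lemma heads_count (h a b d : nat) (p := h.*2.+1) :
    (0 < h)%N -> (a < h.*2)%N -> (1 <= b <= p)%N -> (d < h.*2)%N ->
  (#|[pred k : 'I_d.+1 | (k + p <= b + d)%N
     && (a + 2 * b.-1 + (d - k) == k %[mod p.-1])]|)%:Z = heads h a b d.+1.
Proof.
move=> h_gt0 lt_a bp lt_d; rewrite head_count //; last by rewrite ltnS ltnW.
have odd1 : odd (a + d.+1) = ~~ odd (a + d) by rewrite addnS.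
rewrite /heads odd1; have [//|ev] := ifPn (odd (a + d)); rewrite /=.
rewrite !big_ord_recl big_ord0 /=; set c := _./2.
have def_c : (a + 2 * b.-1 + d = 2 * c)%N by rewrite /c; lia.
have /andP[b_gt0 le_b] := bp; move: c def_c => c def_c.
rewrite /bump /=; split_leq; lia.
Qed.

Lemma heads_count_top (h a b : nat) (p := h.*2.+1) :
    (0 < h)%N -> (a < h.*2)%N -> (1 <= b <= p)%N ->
  (#|[pred k : 'I_(h.*2).+1 | (k + p <= b + h.*2)%N
     && (a + 2 * b.-1 + (h.*2 - k) == k %[mod p.-1])]|)%:Z = alpha p a b p.
Proof.
move=> h_gt0 lt_a bp; rewrite head_count //.
have -> : alpha p a b p = theta p a b 0.
  rewrite /alpha /green_mult eqxx /= subr0 /ell eqxx orbT.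
  by case: ifP.
rewrite thetaE ?double_gt0 // addn0 oddD odd_double addbF.
case: ifP => // ev.
rewrite !big_ord_recl big_ord0 /=; set c := _./2.
have def_c : (a + 2 * b.-1 + h.*2 = 2 * c)%N by rewrite /c; lia.
have /andP[b_gt0 le_b] := bp; move: c def_c => c def_c.
rewrite /bump /=; split_leq; lia.
Qed.

Lemma ellE (h a b t : nat) (p := h.*2.+1) :
    (0 < h)%N -> (a < h.*2)%N -> (1 <= b <= p)%N -> (1 <= t <= h.*2)%N ->
  ell p a b t = if odd (a + t) then
    ((t + 1 <= 2 * b + a)%N : nat)%:Z + ((t + 1 + 2 * h <= 2 * b + a)%N : nat)%:Z
      + ((t + 1 + 4 * h <= 2 * b + a)%N : nat)%:Z - ((t <= a)%N : nat)%:Z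
    + (if t == 1%N then 0 else
      ((2 * h + 3 <= 2 * b + a + t)%N : nat)%:Z
      + ((4 * h + 3 <= 2 * b + a + t)%N : nat)%:Z
      + ((6 * h + 3 <= 2 * b + a + t)%N : nat)%:Z
      - ((2 * h + 2 <= a + t)%N : nat)%:Z) else 0.
Proof.
move=> h_gt0 lt_a bp; case: t => // t lt_t.
rewrite /ell (_ : t.+1 == p = false) ?orbF; last by rewrite /p; lia.
rewrite addnS /= eqSS subn1 /=.
have opp : t != 0%N -> theta p a b (p - t.+1) = if odd (a + t) then 0 else
      ((2 * h + 3 <= 2 * b + a + t.+1)%N : nat)%:Z
      + ((4 * h + 3 <= 2 * b + a + t.+1)%N : nat)%:Z
      + ((6 * h + 3 <= 2 * b + a + t.+1)%N : nat)%:Z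
      - ((2 * h + 2 <= a + t.+1)%N : nat)%:Z.
  move=> t_gt0; rewrite /p subSS thetaE //; last by lia.
  have -> : odd (a + (h.*2 - t)) = odd (a + t) by lia.
  by case: ifP => // _; congr (_%:Z + _%:Z + _%:Z - _%:Z); congr nat_of_bool; lia.
have pred : theta p a b t = if odd (a + t) then 0 else
    ((t.+1 + 1 <= 2 * b + a)%N : nat)%:Z + ((t.+1 + 1 + 2 * h <= 2 * b + a)%N : nat)%:Z
      + ((t.+1 + 1 + 4 * h <= 2 * b + a)%N : nat)%:Z - ((t.+1 <= a)%N : nat)%:Z.
  rewrite thetaE //.
  by case: ifP => // _; congr (_%:Z + _%:Z + _%:Z - _%:Z); congr nat_of_bool; lia.
have [t0|nzt] := eqVneq t 0%N.
  by rewrite -[in LHS]t0 pred; case: (odd _); rewrite /= ?addr0.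
by rewrite pred opp //; case: (odd _); rewrite /= ?addnS ?addr0.
Qed.

(** The composition factors of the projective part are obtained from its head
    through the Cartan matrix: P_t has V_t twice and V_(p-1-t) and V_(p+1-t)
    once as factors, apart from V_p, which is projective. The identity is checked on each of the ranges that define
    the numbers involved. *)
Lemma alpha_chain (h a b t : nat) (p := h.*2.+1) :
    (0 < h)%N -> (a < h.*2)%N -> (1 <= b <= p)%N -> (1 <= t <= h.*2)%N ->
  alpha p a b t = 2 * heads h a b t + heads h a b (h.*2 - t)
    + (if t == 1%N then 0 else heads h a b (h.*2.+2 - t)).
Proof.
move=> h_gt0 lt_a bp tp; rewrite /alpha (ellE h_gt0 lt_a bp tp) /green_mult.
have [/andP[b_gt0 le_b] /andP[t_gt0 le_t]] := (bp, tp).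
rewrite (_ : t == p = false) 1?[false || _]/=; last by rewrite /p; lia.
rewrite (_ : (t == a %[mod 2]) = ~~ odd (a + t)); last first.
  by rewrite !modn2 oddD; case: (odd a); case: (odd t).
rewrite /heads (_ : odd (a + (h.*2 - t)) = odd (a + t)); last by lia.
rewrite (_ : odd (a + (h.*2.+2 - t)) = odd (a + t)); last by lia.
have [odd_at|_] := boolP (odd (a + t)); last first.
  by case: ifP; rewrite ?subr0; case: eqP.
have [e def_e] : exists e, (a + t = 2 * e + 1)%N by exists (a + t)./2; lia.
rewrite [~~ true]/= (_ : p.-1./2 = h); last by rewrite /p doubleK.
rewrite /green_mult_low /green_ls {odd_at tp bp}.
subst p; rewrite -!mul2n; rewrite -mul2n in lt_a le_t le_b.
case: (leqP b ((2 * h).+1 - 1)) => [lt_b|b_p]; last first.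
  by case: eqP => t1; split_leq; lia.
repeat match goal with |- context [if (?x <= ?y)%R then _ else _] =>
  let E := fresh "E" in destruct (x <= y)%R eqn:E; try (exfalso; lia) end.
all: rewrite /=.
all: case: (leqP t h) => th.
all: case: (eqVneq t 1%N) => t1.
all: by split_leq; split_le; lia.
Qed.

End Alpha.

Section Multiplicity.

Lemma heads0 (h a b : nat) : (a < h.*2)%N -> (b <= h.*2.+1)%N -> heads h a b 0 = 0.
Proof.
move=> lt_a le_b; rewrite /heads !addn0 ltn0 /= add0r.
by rewrite (_ : (6 * h + 3 <= 2 * b + a)%N = false) ?if_same //; lia.
Qed.

(** In each of the two blocks the simple modules V_1, V_(p-2), V_3, ... (or
    V_(p-1), V_2, V_(p-3), ...) form a chain, along which the relation between
    the composition factors and the head is the one inverted by Gamma. *)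
Lemma proj_mult_heads (h a b i : nat) (p := h.*2.+1) :
    (0 < h)%N -> (a < h.*2)%N -> (1 <= b <= p)%N -> (1 <= i <= h.*2)%N ->
  proj_mult p a b i = (heads h a b i)%:~R.
Proof.
move=> h_gt0 lt_a bp ip; pose o := odd i.
pose x j := if odd j (+) o then (p - j)%N else j.
pose y (j : nat) : rat := if j == 0%N then 0 else (heads h a b (x j))%:~R.
pose k := if (i <= h)%N then i else (p - i)%N.
have chain j : (1 <= j < h.+1)%N ->
    (alpha p a b (x j))%:~R = y j.-1 + 2 * y j + y j.+1.
  move=> /andP[j_gt0 lt_j]; rewrite /y /x /=.
  have odd1 : odd j.-1 = ~~ odd j by lia.
  have -> : (j == 0%N) = false by lia.
  rewrite odd1 !addNb; case: (odd j (+) o) => /=.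
    rewrite (alpha_chain h_gt0 lt_a bp); last by rewrite /p; lia.
    rewrite (_ : (p - j == 1)%N = false); last by rewrite /p; lia.
    have -> : (h.*2 - (p - j) = j.-1)%N by rewrite /p; lia.
    have -> : (h.*2.+2 - (p - j) = j.+1)%N by rewrite /p; lia.
    rewrite !rmorphD rmorphM /=; congr (_ + _); rewrite addrC; congr (_ + _).
    by case: eqP => // ->; rewrite heads0 //; case/andP: bp.
  rewrite (alpha_chain h_gt0 lt_a bp); last by lia.
  have -> : (h.*2 - j = p - j.+1)%N by rewrite /p; lia.
  rewrite !rmorphD rmorphM /= addrC addrA; congr (_ + _ + _).
  have -> : (j.-1 == 0%N) = (j == 1%N) by lia.
  by case: eqP => // _; congr (heads _ _ _ _)%:~R; rewrite /p; lia.
(* As p - h = h + 1, one more step of the chain repeats its last module. *)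
have yh : y h.+1 = y h.
  rewrite /y /x /= addNb; have -> : (h == 0%N) = false by lia.
  by case: (odd h (+) o) => /=; congr (heads _ _ _ _)%:~R; rewrite /p; lia.
have kp : (1 <= k <= h)%N by rewrite /k; case: (leqP i h) => le_i; rewrite /p; lia.
have yk : y k = (heads h a b i)%:~R.
  rewrite /y (_ : (k == 0%N) = false); last by lia.
  congr (heads _ _ _ _)%:~R; rewrite /x /k /o; case: (leqP i h) => le_i.
    by rewrite addbb.
  have -> : odd (p - i) = ~~ odd i by rewrite /p; lia.
  by rewrite addNb addbb /= /p; lia.
rewrite -yk -(Gamma_inverse (erefl p) kp (erefl _) yh).
rewrite /proj_mult (_ : i == p = false); last by rewrite /p; lia.
have -> : p.-1./2 = h by rewrite /p doubleK.
rewrite -/k (eq_big_nat _ _ (fun j jp => congr1 ( *%R (Gamma p k j)) (esym (chain j jp)))).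
rewrite [RHS](bigID odd) /= /x /o; case: (odd i).
  by congr (_ + _); apply: eq_bigr => j; [move=> -> | move=> /negPf->].
by congr (_ + _); apply: eq_bigr => j; [move=> -> | move=> /negPf->].
Qed.

Lemma proj_mult_count (p a b d : nat) :
    odd p -> (1 < p)%N -> (a <= p - 2)%N -> (1 <= b <= p)%N -> (d < p)%N ->
  (#|[pred k : 'I_d.+1 | (k + p <= b + d)%N
     && (a + 2 * b.-1 + (d - k) == k %[mod p.-1])]|)%:R = proj_mult p a b d.+1.
Proof.
move=> odd_p p_gt1 le_a bp lt_d.
have [h def_p] : exists h, p = h.*2.+1 by exists p./2; lia.
have h_gt0 : (0 < h)%N by lia.
have lt_a : (a < h.*2)%N by lia.
rewrite {odd_p p_gt1 le_a}def_p in bp lt_d *.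
have [lt_dh|] := ltnP d h.*2.
  rewrite proj_mult_heads // -(heads_count h_gt0 lt_a bp lt_dh).
  by rewrite pmulrn.
rewrite ltnS in lt_d; move=> le_d; have {le_d lt_d}-> : d = h.*2 by lia.
by rewrite /proj_mult eqxx -(heads_count_top h_gt0 lt_a bp) pmulrn.
Qed.

End Multiplicity.

(** * The Green correspondent as a summand *)

Section InducedDepth.

Variables (F : fieldType) (p : nat) (charFp : p \in [pchar F]).
Variables (gT : finGroupType) (x : gT) (H G : {group gT}).
Hypotheses (ox : #[x]%g = p) (sHG : H \subset G) (sPG : <[x]>%G \subset G).

(** The subspaces U (x) w z, for z a power of x, are distinct summands of the
    induced module, so that Y^(p-1), which is the sum over these powers up to a
    unit, is injective on U (x) w. *)
Lemma induced_aug_rank n (U : mx_representation F H n) w :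
    w \in G -> (forall z, z \in <[x]>%g -> (w * z * w^-1)%g \in H -> z = 1%g) ->
  (n <= \rank (aug x (induced_repr U sHG) ^+ p.-1))%N.
Proof.
move=> Gw freew; pose ind := induced_repr U sHG.
have one : ind_in G U w *m (aug x ind ^+ p.-1 *m ind x^-1%g)
    *m ind_out G U w^-1%g = 1%:M.
  rewrite (aug_top charFp ox (subg_repr ind sPG)) mulmx_sumr mulmx_suml.
  rewrite (bigD1 1%g) ?group1 //= [X in _ + X]big1 ?addr0.
    by rewrite (ind_inJ sHG U _ Gw) ind_inK ?mulg1 // mulgV ind_block1.
  move=> z /andP[Pz nz]; rewrite (ind_inJ sHG U _ Gw).
  rewrite (ind_inK sHG U _ (groupM Gw (subsetP sPG z Pz))).
  by rewrite /ind_block ifN //; apply: contra nz => /(freew _ Pz)->.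
rewrite -{1}(mxrank1 F n) -one.
apply: leq_trans (mxrankM_maxl _ _) _; apply: leq_trans (mxrankM_maxr _ _) _.
exact: mxrankM_maxl.
Qed.

End InducedDepth.

Section GreenSummand.

Variables (F : closedFieldType) (p : nat) (charFp : p \in [pchar F]).
Local Notation u1 := (upper (1%R : 'F_p)).
Local Notation G := (SL2 p).
Local Notation B := (borel p).
Local Notation P := <[u1]>%G.
Local Notation sBG := (borel_sub p).
Local Notation sPB := (unip_sub_borel p).
Local Notation sPG := (unip_sub_SL2 p).
Let pr_p : prime p := pcharf_prime charFp.

Variables (b : nat) (U : mx_representation F B b).
Local Notation Ind := (Representation (induced_repr U sBG)).

(** A point outside the line fixed by B has trivial stabilizer in P. *)
Lemma induced_borel_rank :
  (b <= \rank (aug u1 (induced_repr U sBG) ^+ p.-1))%N.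
Proof.
have Gw := point_in (0 : 'F_p).
apply: (induced_aug_rank charFp (order_upper pr_p) sBG sPG U Gw) => z /unipP[s ->].
have nBw : point (0 : 'F_p) \notin B.
  apply/negP => /borelP[_]; have [[_ ->] _] := pointE (0 : 'F_p).
  exact/eqP/oner_neq0.
by move/(conj_upper_borel Gw nBw)->; exact: upper0.
Qed.

Lemma index_borel_eq1 : #|G : B|%:R = 1 :> F.
Proof. by rewrite index_borel // -addn1 natrD (pcharf0 charFp) add0r. Qed.

Lemma index_unip_SL2_neq0 : #|G : P|%:R != 0 :> F.
Proof.
rewrite -(Lagrange_index sBG sPB) natrM index_borel_eq1 mul1r index_unip //.
by apply: (pchar_nat_neq0 charFp); have := prime_gt1 pr_p; lia.
Qed.

(** As p + 1 = 1 in F, the identity of V is its own relative trace from B. It is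
    the sum of the traces of the projections onto U and onto the projective
    complement R; the first one factors through Ind U and the second one through
    a projective module, so that by Fitting's lemma the first is invertible. *)
Lemma green_summand (V : representation F G) :
    green_correspondent U V ->
  exists Q : representation F G, biproduct Ind V Q.
Proof.
case=> indV nprojV [R [projR simV]].
pose UR : representation F B := Representation U.
have biV : biproduct (subg_repr V sBG) UR R by apply/biproduct_rsim.
case: biV => iU [qU [iR [qR [[hiU hqU hiR hqR] U1 R1 UR1]]]].
have [k trR] := projective_traced projR.
have homE : mx_hom U (subg_repr (induced_repr U sBG) sBG) (ind_in G U 1) := ind_in_hom sBG U.
pose al := rtrace B G V (induced_repr U sBG) (qU *m ind_in G U 1).
pose be := frobenius sBG U V iU.
have homal : mx_hom V Ind al := rtrace_hom (mx_homM hqU homE).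
have hombe : mx_hom Ind V be := frobenius_hom hiU.
have ab : al *m be = rtrace B G V V (qU *m iU).
  rewrite -[al]mul1mx (rtraceM sBG _ (mx_hom1 V) hombe) mul1mx.
  by rewrite -(mulmxA qU) (frobeniusK hiU).
pose ta := gtrace G V V (qR *m k *m iR).
have ab_ta : 1%:M - al *m be = ta.
  have -> : ta = rtrace B G V V (qR *m iR).
    rewrite /ta (gtrace_trans sBG); congr (rtrace _ _ _ _ _).
    rewrite -[gtrace B V V _]/(gtrace B (subg_repr V sBG) (subg_repr V sBG) _).
    by rewrite -(gtraceM _ hqR hiR) trR mulmx1.
  have -> : 1%:M = rtrace B G V V 1%:M.
    by rewrite (rtrace_homE sBG (mx_hom1 V)) index_borel_eq1 scale1r.
  by rewrite ab -UR1 rtraceD addrC addKr.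
have homab : mx_hom V V (al *m be) := mx_homM homal hombe.
have [uab | ] := indecomposable_endo indV homab.
  apply: (biproduct_split homal (mx_homM hombe (mx_hom_inv homab uab))).
  by rewrite mulmxA mulmxV.
rewrite ab_ta => uta; case: nprojV.
have homta : mx_hom V V ta := gtrace_hom _ _ _.
apply: (@gtrace_projective _ _ _ _ _ (qR *m k *m iR *m invmx ta)).
rewrite -[qR *m k *m iR]mul1mx -(gtraceM _ (mx_hom1 V) (mx_hom_inv homta uta)).
by rewrite mul1mx -/ta mulmxV.
Qed.

(** The complement of V is projective: its dimension does not exceed p times
    the rank of Y^(p-1), as V restricted to P is U plus a projective module and
    Y^(p-1) kills U when b < p. *)
Lemma green_complement (V Q : representation F G) (v : 'rV[F]_b) :
    (b < p)%N -> row_full (tower (aug u1 U) b v) -> v *m aug u1 U ^+ b = 0 ->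
    green_correspondent U V -> biproduct Ind V Q ->
  traced Q.
Proof.
move=> lt_bp fullv vYb [indV nprojV [R [projR simV]]] biQ.
pose UR : representation F B := Representation U.
have biV : biproduct (subg_repr V sBG) UR R by apply/biproduct_rsim.
have degV : rdegree V = (b + rdegree R)%N := biproduct_degree biV.
have subP n nA nB (rM : mx_representation F B n) (rA : mx_representation F B nA)
    (rB : mx_representation F B nB) : biproduct rM rA rB ->
    biproduct (subg_repr rM sPB) (subg_repr rA sPB) (subg_repr rB sPB).
  case=> iA [qA [iB [qB [[hiA hqA hiB hqB] A1 B1 AB1]]]].
  exists iA, qA, iB, qB; split=> //; split=> x /(subsetP sPB) Bx.
  - exact: hiA. - exact: hqA. - exact: hiB. - exact: hqB.
have subG n nA nB (rM : mx_representation F G n) (rA : mx_representation F G nA)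
    (rB : mx_representation F G nB) : biproduct rM rA rB ->
    biproduct (subg_repr rM sPG) (subg_repr rA sPG) (subg_repr rB sPG).
  case=> iA [qA [iB [qB [[hiA hqA hiB hqB] A1 B1 AB1]]]].
  exists iA, qA, iB, qB; split=> //; split=> x /(subsetP sPG) Gx.
  - exact: hiA. - exact: hqA. - exact: hiB. - exact: hqB.
pose rI := \rank (aug u1 (induced_repr U sBG) ^+ p.-1).
pose rV := \rank (aug u1 V ^+ p.-1); pose rQ := \rank (aug u1 Q ^+ p.-1).
pose rR := \rank (aug u1 R ^+ p.-1).
have rkI : (rI <= rV + rQ)%N := aug_rank_biproduct p.-1 (subG _ _ _ _ _ _ biQ).
have rkV : (rV <= \rank (aug u1 U ^+ p.-1) + rR)%N :=
  aug_rank_biproduct p.-1 (subP _ _ _ _ _ _ biV).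
have rkR : (p * rR <= rdegree R)%N :=
  rank_aug_le charFp (order_upper pr_p) (subg_repr R sPB).
have U0 : aug u1 U ^+ p.-1 = 0.
  apply: (row_full_inj fullv); rewrite mulmx0 mxcol_mul.
  rewrite -[RHS](@submxcolK _ _ _ _ (0 : 'M_(\sum_(_ < b) 1, b))).
  apply: eq_mxcol => k; rewrite submxcol0 -mulmxA -[_ *m aug u1 U ^+ _]exprD.
  have -> : (k + p.-1 = b + (k + p.-1 - b))%N by lia.
  by rewrite exprD [_ * _]/(_ *m _) mulmxA vYb mul0mx.
rewrite U0 mxrank0 add0n in rkV.
have rk_b : (b <= rI)%N := induced_borel_rank.
have degI : (p.+1 * b = rdegree V + rdegree Q)%N.
  rewrite -(biproduct_degree (biQ : biproduct Ind V Q)).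
  change (p.+1 * b = \sum_(i < #|rcosets B G|) b)%N.
  by rewrite sum_nat_const card_ord -[#|rcosets B G|]/(#|G : B|%g) index_borel.
apply: (traced_index index_unip_SL2_neq0 (sHG := sPG)).
have trQ := traced_of_rank charFp (order_upper pr_p) (rM := subg_repr Q sPG).
apply: trQ.
change (p * rQ >= rdegree Q)%N.
have : (p * b <= p * (rR + rQ))%N by rewrite leq_mul2l; lia.
by rewrite mulnDr; lia.
Qed.

(** For b = p the module U is free over P, of index prime to p in B. *)
Lemma induced_traced (v : 'rV[F]_b) :
    b = p -> row_free (tower (aug u1 U) b v) -> traced (induced_repr U sBG).
Proof.
move=> def_b freev; apply: ind_traced.
have nz : #|B : P|%:R != 0 :> F.
  rewrite index_unip //; apply: (pchar_nat_neq0 charFp).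
  by have := prime_gt1 pr_p; lia.
apply: (traced_index nz (sHG := sPB)).
have trU := traced_of_rank charFp (order_upper pr_p) (rM := subg_repr U sPB).
apply: trU.
rewrite {1}def_b -[X in (X <= _)%N]muln1 leq_mul2l lt0n mxrank_eq0; apply/orP; right.
apply/negP => /eqP Y0; have lt_b : (b.-1 < b)%N by have := prime_gt0 pr_p; lia.
have [h /(_ (Ordinal lt_b))/=] := tower_ext (fun _ : 'I_b => 1%:M : 'M[F]_1) freev.
have -> : b.-1 = p.-1 by rewrite def_b.
rewrite -[aug u1 U ^+ _]/(aug u1 (subg_repr U sPB) ^+ _) Y0 mulmx0 mul0mx.
by move/matrixP/(_ 0 0); rewrite !mxE => /esym/eqP; rewrite oner_eq0.
Qed.

End GreenSummand.

(** * The decomposition of the induced module *)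

Theorem corollary5p5 (F : closedFieldType) (p : nat) (charFp : p \in [pchar F])
    (odd_p : odd p) (a b : nat) (le_a : (a <= p - 2)%N)
    (le_b : (1 <= b <= p)%N)
    (U : mx_representation F (borel p) b) (defU : is_U charFp a%:Z U)
    (P : nat -> representation F (SL2 p))
    (defP : forall i : nat, (1 <= i <= p)%N ->
      projective_cover (P i) (V_repr charFp i))
    (V : representation F (SL2 p))
    (defV : (b <= p - 1)%N -> green_correspondent U V) :
  exists n : nat -> nat,
    (forall i : nat, (1 <= i <= p)%N -> (n i)%:R = proj_mult p a b i) /\
    mx_rsim (induced_repr U (borel_sub p))
      (dadd_grepr
         (if (b <= p - 1)%N then V else @grepr0 F _ (SL2 p))
         (\big[@dadd_grepr F _ (SL2 p)/@grepr0 F _ (SL2 p)]_(1 <= i < p.+1)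
            muln_grepr (P i) (n i))).
Proof.
have pr_p : prime p := pcharf_prime charFp.
have p_gt1 := prime_gt1 pr_p.
have b_gt0 : (0 < b)%N by case/andP: le_b.
have le_bp : (b <= p)%N by case/andP: le_b.
have [v [fullv freev vYb v_tor]] := uniserial_generator b_gt0 defU.
have v_torus r : r != 0 :> 'F_p ->
    v *m U (torus r) = Fp_emb charFp r ^+ (a + 2 * b.-1) *: v.
  by move=> nz; rewrite (v_tor r nz).
set W := if (b <= p - 1)%N then V else _.
have [Q [biQ trQ noW]] : exists Q : representation F (SL2 p),
    [/\ biproduct (induced_repr U (borel_sub p)) W Q, traced Q
      & forall d h, (d < p)%N -> gtrace (SL2 p) W (V_repr charFp d.+1) h = 0].
  rewrite {}/W; have [le_b1 | lt_b] := leqP b (p - 1).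
    have lt_bp : (b < p)%N by lia.
    have [Q biQ] := green_summand charFp (defV le_b1).
    have trQ := green_complement charFp lt_bp fullv vYb (defV le_b1) biQ.
    exists Q; split=> // d h lt_dp; case: (defV le_b1) => indV nprojV _.
    have dp : (1 <= d.+1 <= p)%N by [].
    exact: (indecomposable_gtrace h (V_repr_irr charFp dp) (defP _ dp) indV nprojV).
  have def_b : b = p by lia.
  exists (Representation (induced_repr U (borel_sub p))); split.
  - exact: biproduct0 (mx_rsim_refl _).
  - exact: (induced_traced charFp def_b freev).
  - by move=> d h _; apply/matrixP => -[].
exists (fun i => \dim (homs Q (V_repr charFp i))); split=> [[//|d] /= lt_dp|].
  rewrite -(proj_mult_count odd_p p_gt1 le_a le_b lt_dp).
  congr (_%:R); apply: (homs_dim_induced b_gt0 le_bp fullv freev vYb v_torus lt_dp biQ trQ).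
  by move=> h; apply: noW.
apply/biproduct_rsim; apply: biproduct_eqr biQ _.
exact: (projective_decomposition (charFp := charFp) defP trQ).
Qed.
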